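(* Let $\{(G_n,\mathcal M(G_n))\}_{n\ge1}$ be finite (random) marked networks, $G_n$ having vertex set $[n]$, with empirical rooted laws $\mathcal P_n$. Assume: (B1) $\mathcal P_n\overset{\mathbb P}{\Rightarrow}\mathcal P$ for a deterministic rooted law $\mathcal P$; (B2) every finite-network response is bounded, nonnegative, nondecreasing and $1$-Lipschitz, and the same holds $\mathcal P$-a.s. at every vertex of the limiting forward component; (B3) $x_o^{+,k}-x_o^{-,k}\to0$ a.s. as $k\to\infty$ on the limiting network; the bounded risk domain assumption and the quantitative loss and risk regularity assumption (both stated in the context); and that the limiting network is a forward-locally-finite multitype tree with type-indexed responses $f_v=f_{\tau_v}\in\mathsf F_{\mathrm{ne}}$ having the branching property stated in the context, with $B(t)=\mathfrak b(f_t)\in L^1(\mathcal T,\mu)$ and with $T_W$ well defined as a bounded positive operator on $L^1(\mathcal T,\mu)$ of spectral radius $r_1(T_W)<1$. Then for every measurable finite-network equilibrium selection $x^\star(n)$, either $\sigma\in\{-,+\}$, and every $k\ge0$, $$|\varrho(\eta_n)-\varrho(\eta_n^{\sigma,k})|\le L_\varrho\operatorname{Lip}_\ell\,\frac1n\sum_{i=1}^n\delta_i^k(n),\qquad |\varrho(\eta^{\sigma,k})-\varrho(\eta)|\le L_\varrho\operatorname{Lip}_\ell\,\Gamma_k(B).$$ Consequently, for every fixed $k$, $$|\varrho(\eta_n)-\varrho(\eta)|\le 2L_\varrho\operatorname{Lip}_\ell\,\Gamma_k(B)+o_{\mathbb P}(1),\qquad n\to\infty .$$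
   Context: **Marks.** $\mathcal T$ is a Polish space (of types) with a complete compatible metric. $\mathsf F_{\mathrm{ne}}$ is the set of bounded, nonnegative, nondecreasing, $1$-Lipschitz $f:\mathbb R\to\mathbb R$ with metric $\|f-g\|_\infty$, and $\mathfrak b(f):=\sup_zf(z)$. The vertex-mark space is $\mathsf M^V=\mathcal T\times\mathbb R\times\mathsf F_{\mathrm{ne}}$ with a complete product metric $d_{\mathsf M^V}$; a vertex $v$ has mark $m_v=(\tau_v,\epsilon_v,f_v)$ (type, shock, response). The edge-mark space is $\mathsf M^E=(0,\infty)$ with $d_{\mathsf M^E}(c,c')=|\log c-\log c'|$; an edge $(v,u)$ has mark $C_{vu}>0$ (exposure). **Rooted marked graphs and local topology.** A directed graph $G=(V,E)$ is forward locally finite if every vertex has finite out-degree. A rooted marked directed graph $(G,o,\mathcal M(G))$ is such a graph with a root $o\in V$ and marks $m_v\in\mathsf M^V$, $m_e\in\mathsf M^E$. An isomorphism is a vertex bijection preserving edges in both directions, the root, and all marks; $\mathcal G_*$ is the set of isomorphism classes. Let $d_G^+(o,v)$ be the length of a shortest directed path from $o$ to $v$ ($\infty$ if none), $V_k^+(o)=\{v:d_G^+(o,v)\le k\}$ and $E_k^+(o)=\{(v,u)\in E:d_G^+(o,v)<k\}$. For $\xi=[G,o,\mathcal M(G)]$, $[\xi]_k$ is the isomorphism class of the rooted marked graph with vertex set $V_k^+(o)$, edge set $E_k^+(o)$ and the original marks; $\mathfrak X_k$ is the set of such classes. Put $d_V=1\wedge d_{\mathsf M^V}$, $d_E=1\wedge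 d_{\mathsf M^E}$. For $a,b\in\mathfrak X_r$ let $d_r(a,b)=1$ if there is no root-preserving isomorphism of the underlying directed graphs (ignoring marks), and otherwise $d_r(a,b)=\min_\phi\max\{\max_v d_V(m_v,m'_{\phi(v)}),\max_{(v,u)}d_E(m_{(v,u)},m'_{(\phi(v),\phi(u))})\}$ over such isomorphisms $\phi$ (an empty maximum is $0$). Set $d_{\mathrm{loc}}(\xi,\xi')=\sum_{r\ge0}2^{-r-1}d_r([\xi]_r,[\xi']_r)$, and let $\widetilde{\mathcal G}_*$ be the quotient of $\mathcal G_*$ by $\{d_{\mathrm{loc}}=0\}$, a Polish space with metric $d_{\mathrm{loc}}$. **Empirical rooted laws.** $\mathcal P_n=\frac1n\sum_{i=1}^n\delta_{[G_n,i,\mathcal M(G_n)]}$. $\mathcal P_n\overset{\mathbb P}{\Rightarrow}\mathcal P$ means $\int h\,d\mathcal P_n\to\int h\,d\mathcal P$ in probability for every bounded continuous $h:\widetilde{\mathcal G}_*\to\mathbb R$. **Weights, iterates, equilibria.** $W_{vu}=C_{vu}/\sum_{w:(v,w)\in E}C_{vw}$ for an edge, $0$ otherwise (vertices without outgoing edges have zero network input). On $G_n$ write $W_{ij}(n),\tau_i(n),\epsilon_i(n),f_i$. An equilibrium of the finite network satisfies $x_i=f_i\bigl(\sum_jW_{ij}(n)x_j+\epsilon_i(n)\bigr)$, $i\in[n]$; a measurable selection $x^\star(n)$ is a random vector that is an equilibrium of the realized network. $(G,o,\mathcal M(G))$ is a random rooted network with law $\mathcal P$, $G$ being the root's forward component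 $V(G)=\bigcup_rV_r^+(o)$. On $G_n$ or $G$ the extremal iterates are $x_v^{-,0}=0$, $x_v^{+,0}=\mathfrak b(f_v)$, $x_v^{\pm,k+1}=f_v\bigl(\sum_uW_{vu}x_u^{\pm,k}+\epsilon_v\bigr)$; on $G_n$ they are denoted $x_i^{\pm,k}(n)$. $x_o^\star$ is the common a.s. limit of $x_o^{\pm,k}$. Put $\delta_i^k(n)=x_i^{+,k}(n)-x_i^{-,k}(n)$. **Bounded risk domain assumption (nonexpansive case).** There is a deterministic $B_*<\infty$ with, a.s., $\mathfrak b(f_i)\le B_*$ and $\mathfrak b(f_v)\le B_*$ for all finite and limiting vertices; $K_x=[0,B_*]$; the loss map $\ell:\mathcal T\times\mathbb R\to\mathbb R$, $\ell(t,z)=\ell_t(z)$, is jointly continuous and uniformly bounded on $\mathcal T\times K_x$. $K_\ell$ is a compact interval containing $\ell(\mathcal T\times K_x)$. **Loss laws.** $\eta_n=\frac1n\sum_i\delta_{\ell_{\tau_i(n)}(x_i^\star(n))}$, $\eta=\operatorname{Law}(\ell_{\tau_o}(x_o^\star))$, $\eta_n^{\sigma,k}=\frac1n\sum_i\delta_{\ell_{\tau_i(n)}(x_i^{\sigma,k}(n))}$, $\eta^{\sigma,k}=\operatorname{Law}(\ell_{\tau_o}(x_o^{\sigma,k}))$. **Quantitative loss and risk regularity assumption.** There is a finite $\operatorname{Lip}_\ell$ with $|\ell_t(z)-\ell_t(z')|\le\operatorname{Lip}_\ell|z-z'|$ for $t\in\mathcal T$, $z,z'\in K_x$. $\rho:L^\infty\to\mathbb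 R$ (on an atomless probability space) is law invariant, monotone, and cash invariant, $\rho(Z+c)=\rho(Z)+c$, with law representation $\varrho:\mathcal D\to\mathbb R$, $\rho(Z)=\varrho(\operatorname{Law}(Z))$, $\mathcal D\subseteq\mathscr P(K_\ell)$. All the loss laws above belong to $\mathcal D$, and there is $L_\varrho<\infty$ with $|\varrho(\nu)-\varrho(\nu')|\le L_\varrho W_1(\nu,\nu')$ for $\nu,\nu'\in\mathcal D$, $W_1$ being the $1$-Wasserstein distance. **Branching property.** At every vertex of the limiting tree (edges directed from parents to children), conditional on its type, its children's types, and its primitive outgoing exposures, the descendant marked subtrees rooted at the children are independent and have the same type-conditioned rooted laws as the original tree (the subtree at a child $u$ has the law of the whole tree given $\tau_o=t$, at $t=\tau_u$). **Operator.** $\mu=\operatorname{Law}(\tau_o)$; $(f_t)_{t\in\mathcal T}$ is a measurable family; $Q_W(s,A)=\mathbb E[\sum_{u:(o,u)\in E(G)}W_{ou}\mathbf 1_{\{\tau_u\in A\}}\mid\tau_o=s]$ (a measurable version); $(T_Wh)(s)=\int h(t)Q_W(s,dt)$; identities involving conditional laws hold $\mu$-a.e.; $r_1$ is the spectral radius on $L^1(\mathcal T,\mu)$; $\Gamma_k(B)=\int_{\mathcal T}(T_W^kB)(s)\,\mu(ds)$. $o_{\mathbb P}(1)$ denotes a sequence of random variables converging to $0$ in probability. *)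

(* Defs.v *)
From HB Require Import structures.
From mathcomp Require Import all_boot all_order all_algebra.
From mathcomp Require Import all_classical all_reals all_analysis.
From mathcomp Require Import complex.

Set Implicit Arguments.
Unset Strict Implicit.
Unset Printing Implicit Defensive.

Import Order.TTheory GRing.Theory Num.Theory.
Import numFieldNormedType.Exports.

Local Open Scope classical_set_scope.
Local Open Scope ring_scope.

HB.mixin Record isSeparable T & Topological T := {
  separable_subproof : exists2 D : set T, countable D & dense D
}.

(* [mdist] is the complete compatible metric; [Pointed] is what the library
   requires of the carrier of a measurable space. *)
#[short(type="polishType")]
HB.structure Definition Polish (R : realType) :=
  {T of Metric R T & CompletePseudoMetric R T & Pointed T & isSeparable T}.

Notation borel T := (g_sigma_algebraType (@open T)).

Section Laws.
Context (R : realType) {d d' : measure_display}.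
Context {X : measurableType d} {Y : measurableType d'}.

(* The law of [f]; the value for a non-measurable [f] is a dummy. *)
Definition law (P : probability X R) (f : X -> Y) : probability Y R :=
  match pselect (f \in mfun) with
  | left mf => distribution P (mfun_Sub mf)
  | right _ => dirac point
  end.

Definition empirical n (x : 'I_n.+1 -> Y) (A : set Y) : \bar R :=
  ((n.+1%:R^-1)%:E * \sum_(i < n.+1) \d_(x i) A)%E.

Section empirical_probability.
Variables (n : nat) (x : 'I_n.+1 -> Y).

Let empiricalE : empirical x =
  mscale (n.+1%:R^-1)%:nng (msum (fun i => \d_(x (inord i))) n.+1).
Proof.
apply/funext => A; rewrite /empirical /mscale/= /msum; congr (_ * _)%E.
by apply: eq_bigr => i _; rewrite inord_val.
Qed.

Let empirical0 : empirical x set0 = 0%E.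
Proof. by rewrite empiricalE measure0. Qed.

Let empirical_ge0 A : (0 <= empirical x A)%E.
Proof. by rewrite empiricalE measure_ge0. Qed.

Let empirical_sigma_additive : semi_sigma_additive (empirical x).
Proof. by rewrite empiricalE; exact: measure_semi_sigma_additive. Qed.

HB.instance Definition _ := isMeasure.Build _ _ _ (empirical x)
  empirical0 empirical_ge0 empirical_sigma_additive.

Let empirical_setT : empirical x setT = 1%:E.
Proof.
rewrite /empirical (eq_bigr (fun=> 1%:E)); last by move=> i _; rewrite diracT.
by rewrite sumEFin -EFinM sumr_const card_ord mulVf// pnatr_eq0.
Qed.

HB.instance Definition _ := Measure_isProbability.Build _ _ _ (empirical x)
  empirical_setT.
End empirical_probability.

End Laws.
Arguments empirical R {d' Y n} x A.

Section Responses.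
Context (R : realType).

Definition response_fun (f : R -> R) : Prop :=
  [/\ exists M, forall z, f z <= M,
      forall z, 0 <= f z,
      {homo f : z z' / z <= z'} &
      forall z z', `|f z - f z'| <= `|z - z'|].

Record response := Response {
  response_val :> R -> R;
  responseP : response_fun response_val
}.

HB.instance Definition _ := gen_eqMixin response.
HB.instance Definition _ := gen_choiceMixin response.

Lemma response0_subproof : response_fun (fun=> 0).
Proof. by split=> // [|z z']; [exists 0 | rewrite subrr normr0]. Qed.

HB.instance Definition _ :=
  isPointed.Build response (Response response0_subproof).

Definition bsup (f : response) : R := sup (range f).

Definition response_dist (f g : response) : R :=
  sup [set `|f z - g z| | z in [set: R]].

Lemma response_dist_ub (f g : response) z :
  `|f z - g z| <= response_dist f g.
Proof.
apply: ub_le_sup; last by exists z.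
case: (responseP f) => -[M fM] f0 _ _; case: (responseP g) => -[N gN] g0 _ _.
exists (M + N) => _ [y _ <-]; rewrite (le_trans (ler_normB _ _))//.
by rewrite !ger0_norm// lerD.
Qed.

Lemma response_dist_le (f g : response) a :
  (forall z, `|f z - g z| <= a) -> response_dist f g <= a.
Proof.
move=> fga; apply: ge_sup; first by exists `|f 0 - g 0|, 0.
by move=> _ [z _ <-].
Qed.

Lemma response_distxx f : response_dist f f = 0.
Proof.
apply/eqP; rewrite eq_le; apply/andP; split.
  by apply: response_dist_le => z; rewrite subrr normr0.
by rewrite (le_trans _ (response_dist_ub f f 0)).
Qed.

Lemma response_dist_positivity f g : response_dist f g = 0 -> f = g.
Proof.
move=> fg0; have fg : response_val f = response_val g.
  apply/funext => z; apply/eqP; rewrite -subr_eq0 -normr_le0 -fg0.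
  exact: response_dist_ub.
by case: f g {fg0} fg => f hf [g hg] /= fg; subst g; congr Response.
Qed.

Lemma response_dist_sym f g : response_dist f g = response_dist g f.
Proof.
by apply/eqP; rewrite eq_le; apply/andP; split; apply: response_dist_le => z;
  rewrite distrC; exact: response_dist_ub.
Qed.

Lemma response_dist_triangle g f h :
  response_dist f h <= response_dist f g + response_dist g h.
Proof.
apply: response_dist_le => z; rewrite (le_trans (ler_distD (g z) _ _))//.
by rewrite lerD// response_dist_ub.
Qed.

HB.instance Definition _ := isMetric.Build R response response_distxx
  response_dist_positivity response_dist_sym response_dist_triangle.

End Responses.

Section Networks.
Context (R : realType) (T : polishType R).

(* Type, shock, response; the standing assumptions on responses are part of
   [response]. *)
Definition vmark : Type := (T * R * response R)%type.

(* A product metric; every product metric on the marks induces the same local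
   topology. *)
Definition vmark_dist (m m' : vmark) : R :=
  Num.max (mdist m.1.1 m'.1.1)
    (Num.max `|m.1.2 - m'.1.2| (mdist m.2 m'.2)).

Definition emark_dist (c c' : R) : R := `|ln c - ln c'|.

(* [emark] is only meaningful on arcs. *)
Record network (V : Type) := Network {
  arc : V -> V -> bool;
  mark : V -> vmark;
  emark : V -> V -> R;
  arc_finite : forall v, finite_set [set u | arc v u];
  emark_gt0 : forall v u, arc v u -> 0 < emark v u
}.

Section accessors.
Context (V : Type) (g : network V).

Definition vtype (v : V) : T := (mark g v).1.1.
Definition shock (v : V) : R := (mark g v).1.2.
Definition resp (v : V) : response R := (mark g v).2.

Definition out (v : V) : set V := [set u | arc g v u].

(* d_G^+(o, v) <= k *)
Definition within (o : V) (k : nat) : set V :=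
  [set v | exists p : seq V,
     [/\ path (arc g) o p, last o p = v & (size p <= k)%N]].

Definition reachable (o v : V) : Prop := exists k, within o k v.

Definition arc_within (o : V) (k : nat) (v u : V) : Prop :=
  arc g v u /\ exists2 j, (j < k)%N & within o j v.

End accessors.

Section iterates.
Context (V : choiceType) (g : network V).

Definition weight (v u : V) : R :=
  if arc g v u then emark g v u / \sum_(w \in out g v) emark g v w else 0.

Definition update (x : V -> R) (v : V) : R :=
  resp g v (\sum_(u \in out g v) weight v u * x u + shock g v).

Definition equilibrium (x : V -> R) : Prop := forall v, x v = update x v.

(* [sg = true] is the upper iteration (sign +), [sg = false] the lower one. *)
Fixpoint ext_iter (sg : bool) (k : nat) : V -> R :=
  if k is k'.+1 then update (ext_iter sg k')
  else fun v => if sg then bsup (resp g v) else 0.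

Definition gap (k : nat) (v : V) : R := ext_iter true k v - ext_iter false k v.

End iterates.

Record rooted := Rooted {
  rooted_vertex : Type;
  rooted_network : network rooted_vertex;
  root : rooted_vertex
}.

Local Notation rnet := rooted_network.

Definition rball (a : rooted) (r : nat) : set (rooted_vertex a) :=
  within (rnet a) (root a) r.
Definition rarc (a : rooted) (r : nat) (v u : rooted_vertex a) : Prop :=
  arc_within (rnet a) (root a) r v u.
Arguments rball : clear implicits.
Arguments rarc : clear implicits.

(* Isomorphisms of the unmarked rooted graphs underlying [a]_r and [b]_r. *)
Definition ball_iso (r : nat) (a b : rooted)
    (phi : rooted_vertex a -> rooted_vertex b) : Prop :=
  [/\ set_bij (rball a r) (rball b r) phi,
      phi (root a) = root b &
      forall v u, rball a r v -> rball a r u ->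
        rarc a r v u <-> rarc b r (phi v) (phi u)].

Definition mark_discrepancy (r : nat) (a b : rooted)
    (phi : rooted_vertex a -> rooted_vertex b) : R :=
  sup ([set 0] `|`
    [set Num.min 1 (vmark_dist (mark (rnet a) v) (mark (rnet b) (phi v)))
      | v in rball a r] `|`
    [set Num.min 1 (emark_dist (emark (rnet a) e.1 e.2)
                               (emark (rnet b) (phi e.1) (phi e.2)))
      | e in [set e | rarc a r e.1 e.2]]).

(* Discrepancies are at most 1, so that including 1 in the infimum only matters
   when there is no isomorphism. *)
Definition dist_at (r : nat) (a b : rooted) : R :=
  inf ([set 1] `|` [set mark_discrepancy r phi | phi in @ball_iso r a b]).

Definition dloc (a b : rooted) : R :=
  limn (series (fun r => 2^-1 ^+ r.+1 * dist_at r a b)).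

Lemma vmark_distxx m : vmark_dist m m = 0.
Proof. by rewrite /vmark_dist !mdistxx subrr normr0 !maxxx. Qed.

Lemma vmark_dist_ge0 m m' : 0 <= vmark_dist m m'.
Proof. by rewrite /vmark_dist le_max mdist_ge0. Qed.

Lemma vmark_dist_sym m m' : vmark_dist m m' = vmark_dist m' m.
Proof.
by rewrite /vmark_dist metric_sym distrC (metric_sym m.2).
Qed.

Lemma vmark_dist_triangle m' m m'' :
  vmark_dist m m'' <= vmark_dist m m' + vmark_dist m' m''.
Proof.
rewrite {1}/vmark_dist !ge_max; apply/and3P; split.
- rewrite (le_trans (metric_triangle _ m'.1.1 _))// lerD//.
    by rewrite /vmark_dist le_max lexx.
  by rewrite /vmark_dist le_max lexx.
- rewrite (le_trans (ler_distD m'.1.2 _ _))// lerD//.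
    by rewrite /vmark_dist !le_max lexx orbT.
  by rewrite /vmark_dist !le_max lexx orbT.
- rewrite (le_trans (metric_triangle _ m'.2 _))// lerD//.
    by rewrite /vmark_dist !le_max lexx !orbT.
  by rewrite /vmark_dist !le_max lexx !orbT.
Qed.

Lemma min1_triangle (x y z : R) : 0 <= y -> 0 <= z -> x <= y + z ->
  Num.min 1 x <= Num.min 1 y + Num.min 1 z.
Proof.
move=> y0 z0 xyz.
have [y1|y1] := leP 1 y.
  by rewrite ge_min ler_wpDr// le_min ler01.
have [z1|z1] := leP 1 z.
  by rewrite ge_min ler_wpDl.
by rewrite ge_min xyz orbT.
Qed.

Section discrepancy.
Variables (r : nat).

Lemma mark_discrepancy_ub a b (phi : rooted_vertex a -> rooted_vertex b) :
  [/\ 0 <= mark_discrepancy r phi, mark_discrepancy r phi <= 1,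
   forall v, rball a r v ->
     Num.min 1 (vmark_dist (mark (rnet a) v) (mark (rnet b) (phi v)))
       <= mark_discrepancy r phi &
   forall v u, rarc a r v u ->
     Num.min 1 (emark_dist (emark (rnet a) v u)
                           (emark (rnet b) (phi v) (phi u)))
       <= mark_discrepancy r phi].
Proof.
rewrite /mark_discrepancy; set S := (X in sup X).
have S1 : ubound S 1.
  move=> _ [[->|[v _ <-]]|[e _ <-]]; first exact: ler01.
  - by rewrite ge_min lexx.
  - by rewrite ge_min lexx.
have S0 : S 0 by left; left.
split; first by apply: ub_le_sup => //; exists 1.
- by apply: ge_sup => //; exists 0.
- by move=> v av; apply: ub_le_sup; [exists 1|left; right; exists v].
- by move=> v u avu; apply: ub_le_sup; [exists 1|right; exists (v, u)].
Qed.

Lemma mark_discrepancy_le a b (phi : rooted_vertex a -> rooted_vertex b) x :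
  0 <= x ->
  (forall v, rball a r v ->
     Num.min 1 (vmark_dist (mark (rnet a) v) (mark (rnet b) (phi v))) <= x) ->
  (forall v u, rarc a r v u ->
     Num.min 1 (emark_dist (emark (rnet a) v u)
                           (emark (rnet b) (phi v) (phi u))) <= x) ->
  mark_discrepancy r phi <= x.
Proof.
move=> x0 vx ex; apply: ge_sup; first by exists 0; left; left.
by move=> _ [[->//|[v av <-]]|[[v u]/= avu <-]]; [exact: vx | exact: ex].
Qed.

Let values a b : set R :=
  [set 1] `|` [set mark_discrepancy r phi | phi in @ball_iso r a b].

Let values_ge0 a b x : values a b x -> 0 <= x.
Proof.
move=> [->|[phi _ <-]]; first exact: ler01.
by have [] := mark_discrepancy_ub phi.
Qed.

Let values_has_inf a b : has_inf (values a b).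
Proof. by split; [exists 1; left|exists 0 => x /values_ge0]. Qed.

Lemma dist_at_ge0 a b : 0 <= dist_at r a b.
Proof.
by apply: lb_le_inf; [exists 1; left|move=> x /values_ge0].
Qed.

Lemma dist_at_le1 a b : dist_at r a b <= 1.
Proof. by apply: ge_inf; [have [] := values_has_inf a b|left]. Qed.

Lemma dist_atxx a : dist_at r a a = 0.
Proof.
apply/eqP; rewrite eq_le dist_at_ge0 andbT.
apply: (@le_trans _ _ (@mark_discrepancy r a a id)).
  apply: ge_inf; first by have [] := values_has_inf a a.
  by right; exists id => //; split => //; split => // v av; exists v.
apply: mark_discrepancy_le => // [v _|v u _].
  by rewrite vmark_distxx ge_min lexx orbT.
by rewrite /emark_dist subrr normr0 ge_min lexx orbT.
Qed.

Lemma within_root V (g : network V) o k : within g o k o.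
Proof. by exists [::]; split. Qed.

Lemma rarc_ball a v u : rarc a r v u -> rball a r v /\ rball a r u.
Proof.
move=> [vu [j jr [p [op lp sp]]]]; split.
  by exists p; split => //; rewrite (leq_trans sp)// ltnW.
exists (rcons p u); split; first by rewrite rcons_path op lp.
  by rewrite last_rcons.
by rewrite size_rcons (leq_trans _ jr).
Qed.

Let dist_at_sym_le a b : dist_at r a b <= dist_at r b a.
Proof.
apply: lb_le_inf; first by exists 1; left.
move=> _ [->|[phi [[phiE phiI phiS] phio phia] <-]]; first exact: dist_at_le1.
have [psi psiP] : exists psi : rooted_vertex a -> rooted_vertex b,
    forall v, rball a r v -> rball b r (psi v) /\ phi (psi v) = v.
  have /choice[psi psiP] : forall v, exists u, rball a r v ->
      rball b r u /\ phi u = v.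
    move=> v; have [av|nav] := pselect (rball a r v); last by exists (root b).
    by have [u bu uv] := phiS v av; exists u.
  by exists psi.
have phiK u : rball b r u -> psi (phi u) = u.
  move=> bu; have au : rball a r (phi u) by exact: phiE.
  have [bpu ppu] := psiP _ au.
  by apply: phiI => //; rewrite inE.
have psi_iso : ball_iso r psi.
  split.
  - split; first by move=> v /psiP[].
    + by move=> v w; rewrite !inE => /psiP[_ {2}<-] /psiP[_ {2}<-] ->.
    + by move=> u bu; exists (phi u); [exact: phiE | exact: phiK].
  - by rewrite -phio phiK//; exact: within_root.
  - move=> v u /psiP[bv vE] /psiP[bu uE].
    by rewrite -{1}vE -{1}uE; apply: iff_sym; exact: phia.
apply: (@le_trans _ _ (mark_discrepancy r psi)).
  apply: ge_inf; first by have [] := values_has_inf a b.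
  by right; exists psi.
have [m0 _ mv me] := mark_discrepancy_ub phi.
apply: mark_discrepancy_le => // [v /psiP[bv vE]|v u avu].
  by rewrite vmark_dist_sym -{2}vE; exact: mv.
have [/psiP[bv vE] /psiP[bu uE]] := rarc_ball avu.
rewrite /emark_dist distrC -{2}vE -{2}uE; apply: me.
by apply/phia => //; rewrite vE uE.
Qed.

Lemma dist_at_sym a b : dist_at r a b = dist_at r b a.
Proof. by apply/eqP; rewrite eq_le !dist_at_sym_le. Qed.

Lemma dist_at_triangle b a c :
  dist_at r a c <= dist_at r a b + dist_at r b c.
Proof.
have step x y : values a b x -> values b c y -> dist_at r a c <= x + y.
  move=> [->|[phi [[phiE phiI phiS] phio phia] <-]] => [hy|].
    rewrite (le_trans (dist_at_le1 _ _))// ler_wpDr//.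
    exact: values_ge0 hy.
  move=> [->|[psi [[psiE psiI psiS] psio psia] <-]].
    rewrite (le_trans (dist_at_le1 _ _))// ler_wpDl//.
    by have [] := mark_discrepancy_ub phi.
  have comp_iso : @ball_iso r a c (psi \o phi).
    split; last 2 first.
    - by rewrite /= phio psio.
    - move=> v u av au; rewrite (phia v u av au).
      by apply: psia; exact: phiE.
    exact: (set_bij_comp (And3 phiE phiI phiS) (And3 psiE psiI psiS)).
  apply: (@le_trans _ _ (@mark_discrepancy r a c (psi \o phi))).
    apply: ge_inf; first by have [] := values_has_inf a c.
    by right; exists (psi \o phi).
  have [m0 _ mv me] := mark_discrepancy_ub phi.
  have [n0 _ nv ne] := mark_discrepancy_ub psi.
  apply: mark_discrepancy_le => [|v av|v u avu]; first exact: addr_ge0.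
    apply: (le_trans _ (lerD (mv _ av) (nv _ (phiE _ av)))).
    by apply: min1_triangle; rewrite ?vmark_dist_ge0//;
      exact: vmark_dist_triangle.
  have [av au] := rarc_ball avu.
  have bvu : rarc b r (phi v) (phi u) by apply/phia.
  apply: (le_trans _ (lerD (me _ _ avu) (ne _ _ bvu))).
  by apply: min1_triangle; rewrite ?normr_ge0//; exact: ler_distD.
rewrite -lerBlDr; apply: lb_le_inf; first by exists 1; left.
move=> x abx; rewrite lerBlDr addrC -lerBlDr.
apply: lb_le_inf; first by exists 1; left.
by move=> y bcy; rewrite lerBlDr addrC; exact: step.
Qed.

End discrepancy.

Lemma dloc_cvg a b :
  cvgn (series (fun r => 2^-1 ^+ r.+1 * dist_at r a b)).
Proof.
apply: (@series_le_cvg _ _ (geometric (2^-1) (2^-1))).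
- by move=> n; rewrite mulr_ge0 ?exprn_ge0 ?dist_at_ge0.
- by move=> n; apply: mulr_ge0; rewrite ?exprn_ge0 ?invr_ge0.
- move=> n; rewrite /geometric/= -exprS ler_piMr ?exprn_ge0 ?invr_ge0//.
  exact: dist_at_le1.
- by apply: is_cvg_geometric_series; rewrite ger0_norm// invf_lt1// ltr1n.
Qed.

Lemma dlocxx a : dloc a a = 0.
Proof.
rewrite /dloc (_ : series _ = cst 0) ?lim_cst//.
by apply/funext => n; rewrite /series/= big1// => i _; rewrite dist_atxx mulr0.
Qed.

Lemma dloc_sym a b : dloc a b = dloc b a.
Proof.
by congr (limn (series _)); apply/funext => r; rewrite dist_at_sym.
Qed.

Lemma dloc_triangle b a c : dloc a c <= dloc a b + dloc b c.
Proof.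
rewrite /dloc -limD; [|exact: dloc_cvg|exact: dloc_cvg].
apply: ler_lim; first exact: dloc_cvg.
  by apply: is_cvgD; exact: dloc_cvg.
apply: nearW => n; rewrite /series/= !fctE -big_split/=; apply: ler_sum => i _.
by rewrite -mulrDr ler_wpM2l ?exprn_ge0// dist_at_triangle.
Qed.

Lemma dloc_ge0 a b : 0 <= dloc a b.
Proof.
apply: limr_ge; first exact: dloc_cvg.
by apply: nearW => n; apply: sumr_ge0 => i _;
  rewrite mulr_ge0 ?exprn_ge0 ?dist_at_ge0.
Qed.

End Networks.
Arguments network {R} T V.
Arguments rooted {R} T.

(* The forward component of the root is countable, so every class is represented
   by a network on the natural numbers. *)
Section Relabel.
Context (R : realType) (T : polishType R) (V : countType) (g : network T V).

Definition relabel_arc (a b : nat) : bool :=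
  if pickle_inv a is Some v then
    if pickle_inv b is Some u then arc g v u else false
  else false.

Definition relabel_emark (a b : nat) : R :=
  if pickle_inv a is Some v then
    if pickle_inv b is Some u then emark g v u else 1
  else 1.

Let relabel_arc_finite a : finite_set [set b | relabel_arc a b].
Proof.
rewrite /relabel_arc; case: pickle_inv => [v|]; last first.
  by rewrite (_ : [set _ | _] = set0)//; apply/seteqP; split.
apply: (sub_finite_set _ (finite_image pickle (arc_finite g v))) => b /=.
by have := @pickle_invK V b; case: pickle_inv => //= u <- vu; exists u.
Qed.

Let relabel_emark_gt0 a b : relabel_arc a b -> 0 < relabel_emark a b.
Proof.
rewrite /relabel_arc /relabel_emark; case: pickle_inv => // v.
by case: pickle_inv => // u; exact: emark_gt0.
Qed.

Definition relabel : network T nat :=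
  @Network R T nat relabel_arc (fun a => oapp (mark g) point (@pickle_inv V a))
    relabel_emark relabel_arc_finite relabel_emark_gt0.

Let within_relabel o r a : within relabel (pickle o) r a <->
  exists2 v, pickle v = a & within g o r v.
Proof.
have arcP v b : relabel_arc (pickle v) b <-> exists2 u, pickle u = b & arc g v u.
  rewrite /relabel_arc pickleK_inv; split.
    by have := @pickle_invK V b; case: pickle_inv => //= u <- vu; exists u.
  by move=> [u <- vu]; rewrite pickleK_inv.
split=> [[p [+ <- +]]|[v <- [p [op <- sp]]]].
  elim: p o r => [|b p IH] o r /=; first by exists o => //; exists [::].
  move=> /andP[/arcP[u <- ou] up]; case: r => // r pr.
  have [v vE [q [uq lq sq]]] := IH u r up pr.
  by exists v => //; exists (u :: q); split => //=; rewrite ou.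
exists (map pickle p); split; last by rewrite size_map.
  elim: p o {sp} op => //= u p IH o /andP[ou up].
  by rewrite IH// andbT; apply/arcP; exists u.
by rewrite last_map.
Qed.

Lemma dloc_relabel o : dloc (Rooted relabel (pickle o)) (Rooted g o) = 0.
Proof.
rewrite dloc_sym /dloc (_ : series _ = cst 0) ?lim_cst//.
apply/funext => n; rewrite /series/= big1// => r _.
apply/eqP; rewrite mulf_eq0; apply/orP; right.
rewrite eq_le dist_at_ge0 andbT.
set a := Rooted g o; set b := Rooted relabel (pickle o).
have iso : @ball_iso R T r a b pickle.
  split => //.
  - split.
    + by move=> v av; apply/within_relabel; exists v.
    + by move=> v u _ _ /(pcan_inj pickleK_inv).
    + by move=> c /within_relabel[v <- av]; exists v.
  - move=> v u av au; rewrite /rarc /arc_within/= /relabel_arc !pickleK_inv.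
    split=> -[vu [j jr jv]]; split=> //; exists j => //.
      by apply/within_relabel; exists v.
    by have /within_relabel[w /(pcan_inj pickleK_inv) <-] := jv.
apply: (@le_trans _ _ (@mark_discrepancy R T r a b pickle)).
  apply: ge_inf; last by right; exists pickle.
  exists 0 => _ [->|[phi _ <-]]; first exact: ler01.
  by have [] := mark_discrepancy_ub r phi.
apply: mark_discrepancy_le => // [v _|v u _].
  by rewrite /= pickleK_inv/= vmark_distxx ge_min lexx orbT.
rewrite /= /relabel_emark !pickleK_inv /emark_dist subrr normr0.
by rewrite ge_min lexx orbT.
Qed.

End Relabel.

Section RootedSpace.
Context (R : realType) (T : polishType R).

Definition rooted_nat : Type := (network T nat * nat)%type.

HB.instance Definition _ := gen_eqMixin rooted_nat.
HB.instance Definition _ := gen_choiceMixin rooted_nat.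

Definition dloc_nat (a b : rooted_nat) : R :=
  dloc (Rooted a.1 a.2) (Rooted b.1 b.2).

Definition dloc_null (a b : rooted_nat) : bool := dloc_nat a b == 0.

Lemma dloc_null_refl : reflexive dloc_null.
Proof. by move=> a; rewrite /dloc_null /dloc_nat dlocxx. Qed.

Lemma dloc_null_sym : symmetric dloc_null.
Proof. by move=> a b; rewrite /dloc_null /dloc_nat dloc_sym. Qed.

Lemma dloc_null_trans : transitive dloc_null.
Proof.
move=> b a c /eqP ab /eqP bc; rewrite /dloc_null eq_le dloc_ge0 andbT.
apply: (le_trans (dloc_triangle (Rooted b.1 b.2) _ _)).
by move: ab bc; rewrite /dloc_nat => -> ->; rewrite addr0.
Qed.

Canonical dloc_equiv :=
  EquivRel dloc_null dloc_null_refl dloc_null_sym dloc_null_trans.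

(* Isomorphic networks are at distance 0, so this is also the quotient of the
   set of isomorphism classes. *)
Definition rooted_space : Type := {eq_quot dloc_equiv}%qT.

HB.instance Definition _ := Choice.on rooted_space.

Definition rooted_class (V : countType) (g : network T V) (o : V) :
    rooted_space :=
  (\pi_({eq_quot dloc_equiv}) (relabel g, pickle o))%qT.

Definition rooted_dist (x y : rooted_space) : R :=
  dloc_nat (repr (x : {eq_quot dloc_equiv}%qT))
           (repr (y : {eq_quot dloc_equiv}%qT)).

Let rooted_distxx x : rooted_dist x x = 0.
Proof. exact: dlocxx. Qed.

Let rooted_dist_positivity x y : rooted_dist x y = 0 -> x = y.
Proof.
move=> xy0; rewrite -[x]reprK -[y]reprK; apply/eqmodP.
by rewrite /= /dloc_null; apply/eqP.
Qed.

Let rooted_dist_sym x y : rooted_dist x y = rooted_dist y x.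
Proof. exact: dloc_sym. Qed.

Let rooted_dist_triangle y x z :
  rooted_dist x z <= rooted_dist x y + rooted_dist y z.
Proof. exact: dloc_triangle. Qed.

HB.instance Definition _ := isMetric.Build R rooted_space rooted_distxx
  rooted_dist_positivity rooted_dist_sym rooted_dist_triangle.

Definition isolated_network : network T unit :=
  @Network R T unit (fun _ _ => false) (fun=> point) (fun _ _ => 1)
    (fun _ => finite_finset)
    (fun _ _ _ => ltr01).

HB.instance Definition _ :=
  isPointed.Build rooted_space (rooted_class isolated_network tt).

Let dloc_repr_class (V : countType) (g : network T V) o :
  dloc (Rooted (repr (rooted_class g o : {eq_quot dloc_equiv}%qT)).1
               (repr (rooted_class g o : {eq_quot dloc_equiv}%qT)).2)
       (Rooted g o) = 0.
Proof.
apply/eqP; rewrite eq_le dloc_ge0 andbT.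
rewrite (le_trans (dloc_triangle (Rooted (relabel g) (pickle o)) _ _))//.
rewrite dloc_relabel addr0 le_eqVlt; apply/orP; left.
suff: dloc_null (repr (rooted_class g o : {eq_quot dloc_equiv}%qT))
  (relabel g, pickle o) by [].
by have /eqmodP := reprK (rooted_class g o : {eq_quot dloc_equiv}%qT).
Qed.

Lemma mdist_rooted_class (V V' : countType) (g : network T V) o
    (g' : network T V') o' :
  mdist (rooted_class g o) (rooted_class g' o') =
  dloc (Rooted g o) (Rooted g' o').
Proof.
apply/eqP; rewrite eq_le; apply/andP; split.
  rewrite (le_trans (dloc_triangle (Rooted g o) _ _))//.
  rewrite [X in X + _](dloc_repr_class g o) add0r.
  rewrite (le_trans (dloc_triangle (Rooted g' o') _ _))//.
  by rewrite [X in _ + X]dloc_sym [X in _ + X](dloc_repr_class g' o') addr0.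
set a := repr (rooted_class g o : {eq_quot dloc_equiv}%qT).
set b := repr (rooted_class g' o' : {eq_quot dloc_equiv}%qT).
rewrite (le_trans (dloc_triangle (Rooted a.1 a.2) _ _))//.
rewrite dloc_sym (dloc_repr_class g o) add0r.
rewrite (le_trans (dloc_triangle (Rooted b.1 b.2) _ _))//.
by rewrite (dloc_repr_class g' o') addr0.
Qed.

End RootedSpace.
Arguments rooted_space {R} T.

Section RandomNetworks.
Context (R : realType) (T : polishType R).
Context {d : measure_display} {Om : measurableType d}.

Definition random_network V (G : Om -> network T V) : Prop :=
  [/\ forall v u, measurable [set w | arc (G w) v u],
      forall v, measurable_fun setT (fun w => vtype (G w) v : borel T),
      forall v, measurable_fun setT (fun w => shock (G w) v),
      forall v,
        measurable_fun setT (fun w => resp (G w) v : borel (response R)) &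
      forall v u, measurable_fun [set w | arc (G w) v u]
                                 (fun w => emark (G w) v u)].

Definition rooted_law (n : nat) (g : network T 'I_n.+1) :
    probability (borel (rooted_space T)) R :=
  empirical R (fun i => rooted_class g i : borel (rooted_space T)).

End RandomNetworks.

Definition cvg_in_prob (R : realType) (d : nat -> measure_display)
    (Om : forall n, measurableType (d n)) (P : forall n, probability (Om n) R)
    (Z : forall n, Om n -> R) (z : R) : Prop :=
  forall e : R, 0 < e ->
    (fun n => P n [set w | e <= `|Z n w - z|]) @ \oo --> 0%E.

Definition cvg_law_in_prob (R : realType) (d : nat -> measure_display)
    (Om : forall n, measurableType (d n)) (P : forall n, probability (Om n) R)
    (X : ptopologicalType) (nu : forall n, Om n -> probability (borel X) R)
    (mu : probability (borel X) R) : Prop :=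
  forall h : X -> R, continuous h -> (exists M, forall x, `|h x| <= M) ->
    cvg_in_prob P (fun n w => \int[nu n w]_x h x)%R (\int[mu]_x h x)%R.

Section Tree.
Context (R : realType) (T : polishType R).
Context {d : measure_display} {Om : measurableType d}.

(* Trees in Ulam-Harris coding: the root is the empty word and the children of
   a word [v] are [rcons v 0], ..., [rcons v (m - 1)].  Words outside the
   forward component of the root play no role. *)
Definition tree (g : network T (seq nat)) : Prop :=
  forall v, reachable g [::] v -> exists m : nat, forall u,
    arc g v u <-> exists2 i, (i < m)%N & u = rcons v i.

Variables (P : probability Om R) (G : Om -> network T (seq nat)).

Definition root_type_law : probability (borel T) R :=
  law P (fun w => vtype (G w) [::] : borel T).

(* [kappa t] is the law of the rooted tree given that the type of the root is
   [t]. *)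
Definition conditional_rooted_law
    (kappa : R.-pker (borel T) ~> (borel (rooted_space T))) : Prop :=
  forall (S : set (borel T)) (A : set (borel (rooted_space T))),
    measurable S -> measurable A ->
    P [set w | S (vtype (G w) [::]) /\ A (rooted_class (G w) [::])] =
    (\int[root_type_law]_(s in S) kappa s A)%E.

(* The sigma-algebra generated by the type of [v], the types of its children
   and the exposures of [v] to its children. *)
Definition family_info (v : seq nat) : set (set Om) :=
  <<s [set E |
    (exists2 S : set (borel T), measurable S &
      E = [set w | S (vtype (G w) v)]) \/
    (exists (i : nat) (S : set (borel T)) (D : set R),
      [/\ measurable S, measurable D &
       E = [set w | [/\ arc (G w) v (rcons v i),
                        S (vtype (G w) (rcons v i)) &
                        D (emark (G w) v (rcons v i))]]])] >>.

(* [rooted_class (G w) u] only depends on the forward component of [u]: it is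
   the subtree of descendants of [u]. *)
Definition branching
    (kappa : R.-pker (borel T) ~> (borel (rooted_space T))) : Prop :=
  forall (v : seq nat) (m : nat) (A : 'I_m -> set (borel (rooted_space T)))
         (E : set Om),
    (forall i, measurable (A i)) -> family_info v E ->
    let D := [set w | [/\ E w, reachable (G w) [::] v &
                forall i : nat, arc (G w) v (rcons v i) = (i < m)%N]] in
    P (D `&` [set w | forall i, A i (rooted_class (G w) (rcons v i))]) =
    (\int[P]_(w in D)
      (\prod_(i < m) fine (kappa (vtype (G w) (rcons v i)) (A i)))%:E)%E.

(* [Q] is a version of
   Q_W(s, A) = E[sum_u W_(o,u) 1_(tau_u \in A) | tau_o = s]. *)
Definition weight_kernel (Q : R.-ker (borel T) ~> (borel T)) : Prop :=
  forall S A : set (borel T), measurable S -> measurable A ->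
    (\int[P]_(w in [set w | S (vtype (G w) [::])])
      (\sum_(u \in out (G w) [::])
         weight (G w) [::] u * \1_A (vtype (G w) u))%:E)%E =
    (\int[root_type_law]_(s in S) Q s A)%E.

End Tree.

Section Operators.
Context (R : realType) {d : measure_display} {X : measurableType d}.

Definition kernel_op (Q : R.-ker X ~> X) (h : X -> R) (s : X) : R :=
  (\int[Q s]_t h t)%R.

Variable mu : probability X R.

(* Operators act on representatives. *)
Definition L1_operator (A : (X -> R) -> X -> R) : Prop :=
  [/\ forall h, h \in Lfun mu 1 -> A h \in Lfun mu 1,
      forall h h', h \in Lfun mu 1 -> h' \in Lfun mu 1 ->
        {ae mu, forall s, h s = h' s} -> {ae mu, forall s, A h s = A h' s},
      forall (a : R) h h', h \in Lfun mu 1 -> h' \in Lfun mu 1 ->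
        {ae mu, forall s, A (a \*o h \+ h') s = a * A h s + A h' s} &
      exists M : R, forall h, h \in Lfun mu 1 ->
        (\int[mu]_s `|A h s| <= M * \int[mu]_s `|h s|)%R].

Definition positive_operator (A : (X -> R) -> X -> R) : Prop :=
  forall h, h \in Lfun mu 1 -> {ae mu, forall s, 0 <= h s} ->
    {ae mu, forall s, 0 <= A h s}.

Definition kernel_op_well_defined (Q : R.-ker X ~> X) : Prop :=
  [/\ forall h, h \in Lfun mu 1 ->
        {ae mu, forall s, (Q s).-integrable setT (EFin \o h)},
      L1_operator (kernel_op Q) & positive_operator (kernel_op Q)].

(* (z - A) h = g on the complexification of L^1(mu), for h = h1 + i h2 and
   g = g1 + i g2. *)
Definition resolvent_eq (A : (X -> R) -> X -> R) (z : R[i])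
    (h1 h2 g1 g2 : X -> R) : Prop :=
  {ae mu, forall s,
    complex.Re z * h1 s - complex.Im z * h2 s - A h1 s = g1 s /\
    complex.Im z * h1 s + complex.Re z * h2 s - A h2 s = g2 s}.

Definition L1_spectrum (A : (X -> R) -> X -> R) : set R[i] :=
  [set z | ~ (forall g1 g2, g1 \in Lfun mu 1 -> g2 \in Lfun mu 1 ->
    exists h1 h2, [/\ h1 \in Lfun mu 1, h2 \in Lfun mu 1,
      resolvent_eq A z h1 h2 g1 g2 &
      forall h1' h2', h1' \in Lfun mu 1 -> h2' \in Lfun mu 1 ->
        resolvent_eq A z h1' h2' g1 g2 ->
        {ae mu, forall s, h1' s = h1 s /\ h2' s = h2 s}])].

Definition spectral_radius (A : (X -> R) -> X -> R) : \bar R :=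
  ereal_sup [set (Normc.normc z)%:E | z in L1_spectrum A].

End Operators.

Section Risk.
Context (R : realType).

Definition W1 (nu nu' : probability R R) : \bar R :=
  ereal_inf [set (\int[pi]_z `|z.1 - z.2|%:E)%E |
    pi in [set pi : probability (R * R)%type R |
      (forall A, measurable A -> pi (A `*` setT) = nu A) /\
      (forall A, measurable A -> pi (setT `*` A) = nu' A)]].

Context {d : measure_display} {Om : measurableType d}.
Variable P : probability Om R.

Definition atomless : Prop :=
  forall A, measurable A -> (0 < P A)%E ->
    exists B, [/\ measurable B, B `<=` A, (0 < P B)%E & (P B < P A)%E].

(* [rho] acts on representatives; law invariance makes it well defined on
   almost-sure classes. *)
Definition risk_measure (rho : (Om -> R) -> R) : Prop :=
  [/\ forall Z Z', Z \in Lfun P +oo%E -> Z' \in Lfun P +oo%E ->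
        (forall A, measurable A -> law P Z A = law P Z' A) -> rho Z = rho Z',
      forall Z Z', Z \in Lfun P +oo%E -> Z' \in Lfun P +oo%E ->
        {ae P, forall w, Z w <= Z' w} -> rho Z <= rho Z' &
      forall Z (c : R), Z \in Lfun P +oo%E ->
        rho (fun w => Z w + c) = rho Z + c].

Definition law_representation (rho : (Om -> R) -> R)
    (DD : set (probability R R)) (vrho : probability R R -> R) : Prop :=
  forall Z nu, Z \in Lfun P +oo%E -> DD nu ->
    (forall A, measurable A -> law P Z A = nu A) -> rho Z = vrho nu.

End Risk.

Section LossLaws.
Context (R : realType) (T : polishType R) (l : T -> R -> R).

Definition finite_loss_law n (g : network T 'I_n.+1) (x : 'I_n.+1 -> R) :
    probability R R :=
  empirical R (fun i => l (vtype g i) (x i)).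

Definition mean_gap n (g : network T 'I_n.+1) (k : nat) : R :=
  n.+1%:R^-1 * \sum_(i < n.+1) gap g k i.

Context {d : measure_display} {Om : measurableType d} (P : probability Om R).
Variable G : Om -> network T (seq nat).

Definition limit_loss_law (x : Om -> R) : probability R R :=
  law P (fun w => l (vtype (G w) [::]) (x w)).

Definition Gamma (Q : R.-ker (borel T) ~> (borel T)) (B : borel T -> R)
    (k : nat) : R :=
  (\int[root_type_law P G]_s iter k (kernel_op Q) B s)%R.

End LossLaws.

(* Main.v *)
Require Import Defs.
From HB Require Import structures.
From mathcomp Require Import all_boot all_order all_algebra.
From mathcomp Require Import all_classical all_reals all_analysis.
From mathcomp Require Import measurable_realfun ring lra.
(* so that arc and within are those of networks, not of paths and filters *)
Import Defs.

Set Implicit Arguments.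
Unset Strict Implicit.
Unset Printing Implicit Defensive.

Import Order.TTheory GRing.Theory Num.Theory.
Import numFieldNormedType.Exports.

Local Open Scope classical_set_scope.
Local Open Scope ring_scope.

(** The risk functional is Lipschitz for the Wasserstein distance, and losses
    are Lipschitz in the state, so everything reduces to coupling two loss
    laws and bounding the mean distance of the coupled states.

    On one network, the lower and upper iterates are ordered, monotone in the
    number of steps, and enclose every equilibrium as well as the limit of the
    iterates.  Coupling an equilibrium with an iterate vertex by vertex
    therefore costs at most the mean gap.  This gives the bound on finite
    networks at once, and on the limit the bound by the expected gap of the
    root.

    The expected gap is bounded by $\Gamma_k(B)$ by induction on $k$.  One
    update shrinks the gap of a vertex to at most the weighted average of the
    gaps of its children ([gapS_le]).  By the branching property, given the
    types and exposures around the root, the gap of a child of type $t$ has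
    the mean $m_k(t)$ of the root gap given that the root has type $t$
    ([branching_mean]), and averaging over the children given the type of the
    root is integration against the weight kernel
    ([integral_weight_kernel]).  Hence $m_{k+1} \le T_W m_k$ almost
    everywhere, while $m_0 = B$.  All identities are first known for
    indicators only; they are extended by the uniqueness of positive
    functionals with given values on indicators ([pfun_unique]).

    The last claim compares finite networks with the limit along the $k$-th
    upper iterate.  This iterate depends continuously on the rooted class,
    because it only involves the ball of radius $k$ around the root and each
    update is continuous in the marks ([ext_iter_dist]).  So weak convergence
    in probability applies to the gap, whose empirical mean converges to the
    expected gap, and to continuous functions of the loss.  A loss law is then
    recovered up to Wasserstein distance $\varepsilon$ from the masses of the
    cells of a fine partition of unity: a maximal coupling of the cell masses,
    spread inside the cells by a density with respect to the product law, is a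
    coupling of the two laws ([W1_partition_le]).  The remainder is the infimum
    over all meshes of the resulting bounds. *)

(** * Order properties of the iterates *)

Lemma ler_fsbig (R : realType) (I : choiceType) (A : set I) (F H : I -> R) :
  finite_set A -> (forall i, A i -> F i <= H i) ->
  \sum_(i \in A) F i <= \sum_(i \in A) H i.
Proof.
move=> finA FH; rewrite !fsbig_finite//= big_seq [leRHS]big_seq.
by apply: ler_sum => i; rewrite in_fset_set// inE => /FH.
Qed.

Lemma ler_norm_fsbig (R : realType) (I : choiceType) (A : set I) (F : I -> R) :
  finite_set A -> `|\sum_(i \in A) F i| <= \sum_(i \in A) `|F i|.
Proof. by move=> finA; rewrite !fsbig_finite//= ler_norm_sum. Qed.

Lemma fsbigB (R : realType) (I : choiceType) (A : set I) (F H : I -> R) :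
  finite_set A ->
  \sum_(i \in A) (F i - H i) = \sum_(i \in A) F i - \sum_(i \in A) H i.
Proof. by move=> finA; rewrite !fsbig_finite//= sumrB. Qed.

Section ResponseBounds.
Context (R : realType).
Implicit Types f g : response R.

Lemma response_has_ub f : has_ubound (range f).
Proof.
by have [[M fM] _ _ _] := responseP f; exists M => _ [z _ <-]; exact: fM.
Qed.

Lemma response_le_bsup f z : f z <= bsup f.
Proof. by apply: ub_le_sup; [exact: response_has_ub | exists z]. Qed.

Lemma response_ge0 f z : 0 <= f z.
Proof. by have [_ f0 _ _] := responseP f. Qed.

Lemma response_homo f : {homo f : z z' / z <= z'}.
Proof. by have [_ _ ? _] := responseP f. Qed.

Lemma response_lip f z z' : `|f z - f z'| <= `|z - z'|.
Proof. by have [_ _ _ ?] := responseP f. Qed.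

Lemma bsup_ge0 f : 0 <= bsup f.
Proof. exact: le_trans (response_ge0 f 0) (response_le_bsup f 0). Qed.

Lemma bsup_le f M : (forall z, f z <= M) -> bsup f <= M.
Proof. by move=> fM; apply: ge_sup; [exists (f 0), 0 | move=> _ [z _ <-]]. Qed.

Lemma bsup_dist f g : `|bsup f - bsup g| <= mdist f g.
Proof.
have le (h k : response R) : bsup h <= bsup k + mdist h k.
  apply: bsup_le => z; rewrite -lerBlDl (le_trans _ (response_dist_ub h k z))//.
  by rewrite (le_trans _ (ler_norm _))// lerB// response_le_bsup.
by rewrite ler_distl lerBlDr le metric_sym le.
Qed.

End ResponseBounds.

Section Monotonicity.
Context (R : realType) (T : polishType R) (V : choiceType) (g : network T V).
Implicit Types (v u : V) (x y : V -> R).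

Let out_sum v := \sum_(u \in out g v) emark g v u.

Lemma out_sum_gt0 v u : arc g v u -> 0 < out_sum v.
Proof.
move=> vu; have finv := arc_finite g v.
rewrite /out_sum (fsbigD1 u)//=.
apply: ltr_wpDr; last exact: emark_gt0.
by apply: fsumr_ge0 => w [/= vw _]; rewrite ltW// emark_gt0.
Qed.

Lemma weight_ge0 v u : 0 <= weight g v u.
Proof.
rewrite /weight; case: ifPn => // vu.
by rewrite divr_ge0// ltW// ?emark_gt0// (out_sum_gt0 vu).
Qed.

Lemma weight_sum_le1 v : \sum_(u \in out g v) weight g v u <= 1.
Proof.
have [[u vu]|nv] := pselect (exists u, arc g v u); last first.
  rewrite fsbig1 ?ler01// => u vu.
  by case: nv; exists u.
rewrite (eq_fsbigr (fun u => (out_sum v)^-1 * emark g v u)); last first.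
  by move=> w; rewrite inE /= /weight => ->; rewrite mulrC.
rewrite -mulr_fsumr mulVf// gt_eqF//; exact: out_sum_gt0 vu.
Qed.

Lemma update_ge0 x v : 0 <= update g x v.
Proof. exact: response_ge0. Qed.

Lemma update_le_bsup x v : update g x v <= bsup (resp g v).
Proof. exact: response_le_bsup. Qed.

Lemma update_mono x y v : (forall u, arc g v u -> x u <= y u) ->
  update g x v <= update g y v.
Proof.
move=> xy; apply: response_homo; rewrite lerD2r.
apply: ler_fsbig; first exact: arc_finite.
by move=> u vu; rewrite ler_wpM2l ?weight_ge0// xy.
Qed.

(** Responses are $1$-Lipschitz, so one update contracts ordered states into
    the weighted average of their gaps. *)
Lemma update_gap x y v : (forall u, arc g v u -> x u <= y u) ->
  update g y v - update g x v <=
  \sum_(u \in out g v) weight g v u * (y u - x u).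
Proof.
move=> xy; rewrite (le_trans (ler_norm _))// (le_trans (response_lip _ _ _))//.
rewrite opprD addrACA subrr addr0 -fsbigB; last exact: arc_finite.
rewrite (eq_fsbigr (fun u => weight g v u * (y u - x u))); last first.
  by move=> u _; rewrite mulrBr.
rewrite ger0_norm// fsumr_ge0// => u vu.
by rewrite mulr_ge0 ?weight_ge0// subr_ge0 xy.
Qed.

Lemma ext_iter_ge0 sg k v : 0 <= ext_iter g sg k v.
Proof.
case: k => [|k] /=; last exact: update_ge0.
by case: sg => //; exact: bsup_ge0.
Qed.

Lemma ext_iter_le_bsup sg k v : ext_iter g sg k v <= bsup (resp g v).
Proof.
case: k => [|k] /=; last exact: update_le_bsup.
by case: sg => //; exact: bsup_ge0.
Qed.

Lemma ext_iter_le k v : ext_iter g false k v <= ext_iter g true k v.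
Proof.
elim: k v => [|k IH] v; first exact: bsup_ge0.
by apply: update_mono => u _; exact: IH.
Qed.

Lemma ext_iter_lowerS k v : ext_iter g false k v <= ext_iter g false k.+1 v.
Proof.
elim: k v => [|k IH] v; first exact: update_ge0.
by apply: update_mono => u _; exact: IH.
Qed.

Lemma ext_iter_upperS k v : ext_iter g true k.+1 v <= ext_iter g true k v.
Proof.
elim: k v => [|k IH] v; first exact: update_le_bsup.
by apply: update_mono => u _; exact: IH.
Qed.

(** At step $0$ the bounds $0$ and $\mathfrak b(f_v)$ hold for any value of
    the response; monotone updates fix an equilibrium and preserve them. *)
Lemma equilibrium_between x k v : equilibrium g x ->
  ext_iter g false k v <= x v <= ext_iter g true k v.
Proof.
move=> ex; elim: k v => [|k IH] v; rewrite ex.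
  by rewrite update_ge0 update_le_bsup.
by apply/andP; split; apply: update_mono => u _; have /andP[] := IH u.
Qed.

(** The iterates approach a common limit monotonically from both sides, so the
    limit lies between them at every step. *)
Lemma limit_between (a : R) k v :
  (forall sg, ext_iter g sg j v @[j --> \oo] --> a) ->
  ext_iter g false k v <= a <= ext_iter g true k v.
Proof.
move=> alim; apply/andP; split.
- rewrite -(cvg_lim (@Rhausdorff R) (alim false)).
  apply: limr_ge; first by apply/cvg_ex; exists a; exact: alim.
  exists k => // j /= kj; rewrite -(subnK kj); elim: (j - k)%N => // i IH.
  by rewrite addSn (le_trans IH)// ext_iter_lowerS.
- rewrite -(cvg_lim (@Rhausdorff R) (alim true)).
  apply: limr_le; first by apply/cvg_ex; exists a; exact: alim.
  exists k => // j /= kj; rewrite -(subnK kj); elim: (j - k)%N => // i IH.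
  by rewrite addSn (le_trans _ IH)// ext_iter_upperS.
Qed.

Lemma between_dist sg k v (a : R) :
  ext_iter g false k v <= a <= ext_iter g true k v ->
  `|ext_iter g sg k v - a| <= gap g k v.
Proof.
move=> /andP[a0 a1]; case: sg; rewrite /gap.
  by rewrite ger0_norm ?subr_ge0// lerB.
by rewrite distrC ger0_norm ?subr_ge0// lerB.
Qed.

Lemma gap_ge0 k v : 0 <= gap g k v.
Proof. by rewrite subr_ge0 ext_iter_le. Qed.

Lemma gap_le_bsup k v : gap g k v <= bsup (resp g v).
Proof.
by rewrite lerBlDr ler_wpDr ?ext_iter_ge0// ext_iter_le_bsup.
Qed.

Lemma gap0 v : gap g 0 v = bsup (resp g v).
Proof. exact: subr0. Qed.

Lemma gapS_le k v :
  gap g k.+1 v <= \sum_(u \in out g v) weight g v u * gap g k u.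
Proof. by apply: update_gap => u _; exact: ext_iter_le. Qed.

End Monotonicity.

(** * Dependence of the iterates on the marks of a ball *)

Lemma ratio_le (R : realFieldType) (t c c' S S' : R) :
  0 < t -> 0 < c -> 0 < S -> 0 < S' -> c' <= t * c -> S <= t * S' ->
  c' / S' <= t ^+ 2 * (c / S).
Proof.
move=> t0 c0 S0 S'0 c'c SS'.
rewrite ler_pdivrMr// mulrA mulrAC ler_pdivlMr//.
have -> : t ^+ 2 * c * S' = (t * c) * (t * S') by ring.
by rewrite (le_trans (ler_wpM2r (ltW S0) c'c))// ler_wpM2l// mulr_ge0// ltW.
Qed.

(** The lower bound $c'/S' \ge t^{-2} c/S$ is turned into the same error as the
    upper one by $1 - s^{-1} \le s - 1$. *)
Lemma ratio_dist (R : realFieldType) (t c c' S S' : R) :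
  0 < t -> 0 < c -> 0 < c' -> 0 < S -> 0 < S' ->
  c <= t * c' -> c' <= t * c -> S <= t * S' -> S' <= t * S ->
  `|c / S - c' / S'| <= (t ^+ 2 - 1) * (c / S).
Proof.
move=> t0 c0 c'0 S0 S'0 cc' c'c SS' S'S.
have up := ratio_le t0 c0 S0 S'0 c'c SS'.
have lo := ratio_le t0 c'0 S'0 S0 cc' S'S.
have w0 : 0 < c / S by rewrite divr_gt0.
have w'0 : 0 < c' / S' by rewrite divr_gt0.
move: (c / S) (c' / S') up lo w0 w'0 => w w' up lo w0 w'0.
have s0 : 0 < t ^+ 2 by rewrite exprn_gt0.
move: (t ^+ 2) s0 up lo => s s0 up lo.
rewrite ler_distl; apply/andP; split; first by lra.
rewrite -(ler_pM2l s0); apply: (@le_trans _ _ (w + s * ((s - 1) * w))).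
  by rewrite -subr_ge0 (_ : w + s * ((s - 1) * w) - s * w = (s - 1) ^+ 2 * w); [rewrite mulr_ge0 ?sqr_ge0 ?ltW|ring].
by rewrite mulrDr lerD2r.
Qed.

Section BallIso.
Context (R : realType) (T : polishType R) (V V' : choiceType).
Variables (g : network T V) (o : V) (g' : network T V') (o' : V').
Variables (r : nat) (phi : V -> V').
Hypothesis iso : @ball_iso R T r (Rooted g o) (Rooted g' o') phi.

Lemma within_leq (U : Type) (h : network T U) p j k :
  (j <= k)%N -> within h p j `<=` within h p k.
Proof. by move=> jk v [q [hq qv qj]]; exists q; split=> //; exact: leq_trans jk. Qed.

Lemma within0 (U : Type) (h : network T U) p j : within h p j p.
Proof. by exists [::]. Qed.

Lemma within_arc (U : Type) (h : network T U) p j v u :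
  within h p j v -> arc h v u -> within h p j.+1 u.
Proof.
move=> [q [hq qv qj]] vu; exists (rcons q u); split.
- by rewrite rcons_path hq qv.
- by rewrite last_rcons.
- by rewrite size_rcons.
Qed.

Lemma within_last (U : Type) (h : network T U) p j v :
  within h p j.+1 v -> within h p j v \/ exists2 u, within h p j u & arc h u v.
Proof.
move=> [q [+ + +]]; case: (lastP q) => [_ /= <- _|{}q u].
  by left; exact: within0.
rewrite rcons_path last_rcons size_rcons => /andP[hq qu] <- qj.
by right; exists (last p q) => //; exists q.
Qed.

Lemma ball_iso_within j v : (j <= r)%N -> within g o j v ->
  within g' o' j (phi v).
Proof.
have [[phiE _ _] phio phia] := iso.
elim: j v => [|j IH] v jr.
  by move=> [[|u q] [//= _ <- _]]; have /= -> := phio; exact: within0.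
move=> ov; have [jv|[u ju uv]] := within_last ov.
  by apply: (within_leq (leqnSn j)); exact: IH (ltnW jr) jv.
apply: within_arc (IH u (ltnW jr) ju) _.
have uvr : @rarc R T (Rooted g o) r u v by split => //; exists j.
have [ru rv] := rarc_ball uvr.
by have [/(_ uvr)[]] := phia _ _ ru rv.
Qed.

(** An isomorphism of balls of radius $r$ only sees arcs that start at depth
    less than $r$, hence the strict inequality. *)
Lemma ball_iso_out j v : (j < r)%N -> within g o j v ->
  set_bij (out g v) (out g' (phi v)) phi.
Proof.
have [[phiE phiI phiS] phio phia] := iso.
move=> jr jv.
have arcr u : arc g v u -> @rarc R T (Rooted g o) r v u.
  by move=> vu; split => //; exists j.
split.
- move=> u vu; have [rv ru] := rarc_ball (arcr _ vu).
  by have [/(_ (arcr _ vu))[]] := phia _ _ rv ru.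
- move=> u w; rewrite !inE => /arcr/rarc_ball[_ ru] /arcr/rarc_ball[_ rw].
  by apply: phiI; rewrite inE.
- move=> u' vu'.
  have jv' := ball_iso_within (ltnW jr) jv.
  have ru' : within g' o' r u' by apply: (within_leq jr); exact: within_arc jv' vu'.
  have [u ru uu'] := phiS u' ru'; exists u => //.
  have rv : within g o r v by apply: within_leq jv; exact: ltnW.
  have vur : @rarc R T (Rooted g' o') r (phi v) (phi u).
    by split; [rewrite /= uu' | exists j].
  by have [_ /(_ vur)[]] := phia _ _ rv ru.
Qed.

Variable eta : R.
Hypothesis close_mark : forall v, within g o r v ->
  vmark_dist (mark g v) (mark g' (phi v)) <= eta.
Hypothesis close_emark : forall v u, arc_within g o r v u ->
  emark_dist (emark g v u) (emark g' (phi v) (phi u)) <= eta.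

Lemma close_type v : within g o r v ->
  mdist (vtype g v) (vtype g' (phi v)) <= eta.
Proof.
by move=> /close_mark; rewrite /vmark_dist !ge_max => /and3P[].
Qed.

Lemma close_shock v : within g o r v -> `|shock g v - shock g' (phi v)| <= eta.
Proof.
by move=> /close_mark; rewrite /vmark_dist !ge_max => /and3P[].
Qed.

Lemma close_resp v : within g o r v ->
  response_dist (resp g v) (resp g' (phi v)) <= eta.
Proof.
by move=> /close_mark; rewrite /vmark_dist !ge_max => /and3P[].
Qed.

Let t := expR eta.

Lemma emark_ratio (c c' : R) : 0 < c -> 0 < c' -> emark_dist c c' <= eta ->
  c <= t * c' /\ c' <= t * c.
Proof.
move=> c0 c'0; rewrite /emark_dist ler_distl => /andP[l1 l2].
have cE : c = expR (ln c) by rewrite lnK// posrE.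
have c'E : c' = expR (ln c') by rewrite lnK// posrE.
split.
  by rewrite [leLHS]cE [in leRHS]c'E /t -expRD ler_expR; lra.
by rewrite [leLHS]c'E [in leRHS]cE /t -expRD ler_expR; lra.
Qed.

Lemma out_sum_ratio j v : (j < r)%N -> within g o j v ->
  let S := \sum_(u \in out g v) emark g v u in
  let S' := \sum_(u \in out g' (phi v)) emark g' (phi v) u in
  S <= t * S' /\ S' <= t * S.
Proof.
move=> jr jv S S'; rewrite /S /S' (reindex_fsbig _ _ _ _ (ball_iso_out jr jv)).
rewrite !mulr_fsumr; have [phiE _ _] := ball_iso_out jr jv.
have ratio u : arc g v u -> emark g v u <= t * emark g' (phi v) (phi u) /\
    emark g' (phi v) (phi u) <= t * emark g v u.
  move=> vu; apply: emark_ratio; [exact: emark_gt0|exact/emark_gt0/phiE|].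
  by apply: close_emark; split => //; exists j.
by split; apply: ler_fsbig; try exact: arc_finite; move=> u /ratio[].
Qed.

(** Both an exposure and the total exposure of its source change by a factor
    between $e^{-\eta}$ and $e^{\eta}$, so a normalized weight changes by a
    factor between $e^{-2\eta}$ and $e^{2\eta}$. *)
Lemma weight_dist j v u : (j < r)%N -> within g o j v -> arc g v u ->
  `|weight g v u - weight g' (phi v) (phi u)| <= (t ^+ 2 - 1) * weight g v u.
Proof.
move=> jr jv vu; have [phiE _ _] := ball_iso_out jr jv.
have vu' : arc g' (phi v) (phi u) by exact: phiE.
have [cc' c'c] : emark g v u <= t * emark g' (phi v) (phi u) /\
    emark g' (phi v) (phi u) <= t * emark g v u.
  apply: emark_ratio; [exact: emark_gt0|exact: emark_gt0|].
  by apply: close_emark; split => //; exists j.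
have /= [SS' S'S] := out_sum_ratio jr jv.
rewrite /weight vu vu'.
have S0 := out_sum_gt0 vu; have S'0 := out_sum_gt0 vu'.
have := emark_gt0 vu; have := emark_gt0 vu'.
move: (emark g v u) (emark g' _ _) cc' c'c SS' S'S S0 S'0 => c c'.
move: (\sum_(_ \in _) _) (\sum_(_ \in _) _) => S S' cc' c'c SS' S'S S0 S'0 c'0 c0.
have t0 : 0 < t by exact: expR_gt0.
exact: ratio_dist.
Qed.


Variable M : R.
Hypothesis bsup_ball : forall v, within g o r v -> bsup (resp g v) <= M.

(** A perturbation of the marks by $\eta$ shifts each update by at most
    $2\eta$ through the shock and the response, and by at most
    $(e^{2\eta} - 1) M$ through the weights; the total weight being at most
    $1$, errors of the previous iterate are not amplified. *)
Lemma ext_iter_dist sg k j v : (j + k <= r)%N -> within g o j v ->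
  `|ext_iter g sg k v - ext_iter g' sg k (phi v)| <=
  eta + (2 * eta + (t ^+ 2 - 1) * M) *+ k.
Proof.
elim: k j v => [|k IH] j v jkr jv.
  rewrite addn0 in jkr; have rv : within g o r v by exact: within_leq jv.
  rewrite mulr0n addr0 /=; case: sg.
    exact: le_trans (bsup_dist _ _) (close_resp rv).
  by rewrite subrr normr0 (le_trans _ (close_shock rv)).
have jr : (j < r)%N by rewrite (leq_trans _ jkr)// addnS ltnS leq_addr.
have rv : within g o r v by apply: within_leq jv; exact: ltnW.
have [phiE _ _] := ball_iso_out jr jv.
have out_bij := ball_iso_out jr jv.
have fin := arc_finite g v.
set E := eta + _ *+ k in IH.
have E0 : 0 <= E.
  by apply: le_trans (IH j v _ jv); rewrite // (leq_trans _ jkr)// leq_add2l.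
rewrite mulrS (addrC _ (_ *+ k)) addrA -/E /= /update.
set z := (X in resp g v X); set z' := (X in resp g' _ X).
have zz' : `|z - z'| <= (t ^+ 2 - 1) * M + E + eta.
  rewrite /z /z' opprD addrACA (le_trans (ler_normD _ _))//.
  rewrite lerD ?close_shock//.
  rewrite (reindex_fsbig _ _ _ _ out_bij)/= -fsbigB//.
  rewrite (le_trans (ler_norm_fsbig _ _))//.
  apply: (@le_trans _ _ (\sum_(u \in out g v)
      (((t ^+ 2 - 1) * M) * weight g v u + E * weight g' (phi v) (phi u)))).
    apply: ler_fsbig => // u vu.
    have ju : within g o j.+1 u by exact: within_arc jv vu.
    have ru : within g o r u by exact: within_leq ju.
    have -> : weight g v u * ext_iter g sg k u -
        weight g' (phi v) (phi u) * ext_iter g' sg k (phi u) =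
      (weight g v u - weight g' (phi v) (phi u)) * ext_iter g sg k u +
      weight g' (phi v) (phi u) * (ext_iter g sg k u - ext_iter g' sg k (phi u)).
      by ring.
    rewrite (le_trans (ler_normD _ _))// !normrM lerD//; last first.
      rewrite mulrC (ger0_norm (weight_ge0 _ _ _)).
      rewrite ler_wpM2r ?weight_ge0//.
      by apply: IH ju; rewrite addSn -addnS.
    rewrite mulrAC ler_pM//; first exact: weight_dist jv vu.
    rewrite (ger0_norm (ext_iter_ge0 _ _ _ _)).
    exact: le_trans (ext_iter_le_bsup _ _ _ _) (bsup_ball ru).
  have c0 : 0 <= (t ^+ 2 - 1) * M.
    rewrite mulr_ge0//; last by rewrite (le_trans _ (bsup_ball rv))// bsup_ge0.
    have eta0 : 0 <= eta by exact: le_trans (close_shock rv).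
    by rewrite subr_ge0 exprn_ege1// /t -expR0 ler_expR.
  rewrite fsbig_split//= -!mulr_fsumr lerD//.
    by rewrite ler_piMr// weight_sum_le1.
  rewrite -(reindex_fsbig _ _ _ (weight g' (phi v)) out_bij).
  by rewrite ler_piMr// weight_sum_le1.
have -> : resp g v z - resp g' (phi v) z' =
  (resp g v z - resp g v z') + (resp g v z' - resp g' (phi v) z') by ring.
rewrite (le_trans (ler_normD _ _))//.
apply: (@le_trans _ _ ((t ^+ 2 - 1) * M + E + eta + eta)); last by lra.
rewrite lerD ?(le_trans (response_lip _ _ _))//.
exact: le_trans (response_dist_ub _ _ _) (close_resp rv).
Qed.

End BallIso.

Section LocalContinuity.
Context (R : realType) (T : polishType R).

Lemma within_finite (V : choiceType) (g : network T V) o k :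
  finite_set (within g o k).
Proof.
elim: k => [|k IH].
  apply: (sub_finite_set _ (finite_set1 o)) => v [[|u q] [//= _ <- _]].
have : finite_set (within g o k `|` \bigcup_(u in within g o k) out g u).
  rewrite finite_setU; split => //; apply: bigcup_finite => // u _.
  exact: arc_finite.
apply: sub_finite_set => v ov.
have [kv|[u ku uv]] := within_last ov; [by left|right].
by exists u.
Qed.

Lemma bsup_ball_bound (V : choiceType) (g : network T V) o k :
  exists M, forall v, within g o k v -> bsup (resp g v) <= M.
Proof.
have fin := within_finite g o k.
exists (\sum_(v \in within g o k) bsup (resp g v)) => v kv.
by rewrite (fsbigD1 v)//= lerDl fsumr_ge0// => u _; exact: bsup_ge0.
Qed.

(** The local distance is a series of nonnegative terms, so it dominates each of
    them. *)
Lemma dist_at_le_dloc r (a b : rooted T) :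
  dist_at r a b <= 2 ^+ r.+1 * dloc a b.
Proof.
rewrite -ler_pdivrMl ?exprn_gt0// -exprVn.
have nd : nondecreasing_seq (series (fun r => 2^-1 ^+ r.+1 * dist_at r a b)).
  apply/nondecreasing_seqP => n; rewrite /series/= big_nat_recr//= lerDl.
  by rewrite mulr_ge0 ?exprn_ge0 ?dist_at_ge0.
apply: (le_trans _ (nondecreasing_cvgn_le nd (@dloc_cvg _ _ a b) r.+1)).
rewrite /series/= big_nat_recr//= lerDr sumr_ge0// => i _.
by rewrite mulr_ge0 ?exprn_ge0 ?dist_at_ge0.
Qed.

(** Mark distances are truncated at $1$; below $1$ the truncation is
    invisible. *)
Lemma dist_at_lt_iso (V V' : choiceType) (g : network T V) o
    (g' : network T V') o' r eta : eta <= 1 ->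
  dist_at r (Rooted g o) (Rooted g' o') < eta ->
  exists phi : V -> V',
  [/\ @ball_iso R T r (Rooted g o) (Rooted g' o') phi,
      forall v, within g o r v ->
        vmark_dist (mark g v) (mark g' (phi v)) <= eta &
      forall v u, arc_within g o r v u ->
        emark_dist (emark g v u) (emark g' (phi v) (phi u)) <= eta].
Proof.
move=> eta1 /inf_lt; case; first by exists 1; left.
move=> x [->|[phi iso <-]] xeta; first by rewrite ltNge eta1 in xeta.
have [_ _ dv de] := mark_discrepancy_ub r phi.
have lt1 y : Num.min 1 y <= mark_discrepancy r phi -> y <= eta.
  move=> /le_lt_trans/(_ xeta); rewrite gt_min ltNge eta1/=; exact: ltW.
exists phi; split => // [v rv|v u rvu]; apply: lt1; [exact: dv|exact: de].
Qed.

(** The $k$-th iterate at the root only involves the ball of radius $k$, on which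
    responses have a common bound because the ball is finite. *)
Lemma local_approx (V : choiceType) (g : network T V) o sg k (e : R) : 0 < e ->
  exists2 dlt : R, 0 < dlt & forall (V' : choiceType) (g' : network T V') o',
    dloc (Rooted g o) (Rooted g' o') < dlt ->
    `|ext_iter g sg k o - ext_iter g' sg k o'| < e /\
    mdist (vtype g o) (vtype g' o') < e.
Proof.
move=> e0; have [M bM] := bsup_ball_bound g o k.
pose err (x : R) := x + (2 * x + (expR x ^+ 2 - 1) * M) *+ k.
have err0 : err 0 = 0.
  by rewrite /err mulr0 !add0r expR0 expr1n subrr mul0r mul0rn.
have cerr : err x @[x --> (0 : R)] --> err 0.
  apply: cvgD; first exact: cvg_id.
  apply: cvgMn; apply: cvgD.
    by apply: cvgM; [exact: cvg_cst | exact: cvg_id].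
  apply: cvgM; last exact: cvg_cst.
  apply: cvgB; last exact: cvg_cst.
  under eq_fun do rewrite expr2.
  by rewrite expr2; apply: cvgM; exact: continuous_expR.
have [eta [eta0 eta1 etae err_lt]] :
  exists eta, [/\ 0 < eta, eta <= 1, eta < e & err eta < e].
  have := cvgr_lt _ cerr; rewrite err0 => /(_ _ _ e0)/nbhs_ballP[x /= x0 xerr].
  exists (Num.min (x / 2) (Num.min 1 (e / 2))).
  set eta := Num.min _ _; have eta0 : 0 < eta.
    by rewrite /eta !lt_min !divr_gt0// ltr01.
  have [etax eta1 etae] : [/\ eta <= x / 2, eta <= 1 & eta <= e / 2].
    by split; rewrite /eta !ge_min lexx ?orbT.
  split => //; first by lra.
  by apply: xerr; rewrite /ball/= sub0r normrN gtr0_norm//; lra.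
exists (eta / 2 ^+ k.+1); first by rewrite divr_gt0 ?exprn_gt0.
move=> V' g' o' gg'.
have : dist_at k (Rooted g o) (Rooted g' o') < eta.
  apply: le_lt_trans (dist_at_le_dloc _ _ _) _.
  by rewrite mulrC -ltr_pdivlMr ?exprn_gt0.
move=> /(dist_at_lt_iso eta1)[phi [iso cv ce]].
have phio : phi o = o' by case: iso.
rewrite -phio; split; last first.
  by apply: le_lt_trans (close_type cv (within0 _ _ _)) etae.
apply: le_lt_trans err_lt.
exact: (ext_iter_dist iso cv ce bM _ (leqnn (0 + k)%N) (within0 _ _ _)).
Qed.

End LocalContinuity.

(** * Iterates as functions of the class and as random variables *)

Section MeasurableTools.
Context (R : realType) {d : measure_display} {Om : measurableType d}.

Lemma continuous_borel (X : ptopologicalType) (h : X -> R) :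
  continuous h -> measurable_fun setT (h : borel X -> R).
Proof.
move=> /continuousP ch; apply: (measurability _ (RGenOpens.measurableE R)).
move=> _ [_ [a [b ->] <-]]; rewrite setTI.
by apply: sub_sigma_algebra; exact/ch/interval_open.
Qed.

Lemma measurable_preimage d' (Y : measurableType d') (h : Om -> Y) (A : set Y) :
  measurable_fun setT h -> measurable A -> measurable [set w | A (h w)].
Proof. by move=> mh mA; rewrite -[X in measurable X]setTI; exact: mh. Qed.

(** A function of two variables that is measurable in the first and continuous
    in the second is jointly measurable: round the second variable down to a
    multiple of $1/n$, which leaves countably many sections to glue. *)
Lemma caratheodory_measurable (F : Om -> R -> R) (z : Om -> R) :
  (forall q, measurable_fun setT (F ^~ q)) -> (forall w, continuous (F w)) ->
  measurable_fun setT z -> measurable_fun setT (fun w => F w (z w)).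
Proof.
move=> mF cF mz.
pose zn (n : nat) w : R := (Num.floor (z w * n.+1%:R))%:~R / n.+1%:R.
apply: (measurable_fun_cvg (h := fun n w => F w (zn n w))) => [n|w _].
  move=> _ A mA; rewrite setTI.
  (* on the event that the rounded value is j / (n + 1), only the section of F
     at that value matters *)
  have -> : (fun w => F w (zn n w)) @^-1` A = \bigcup_(j : int)
      ([set w | `[j%:~R, (j + 1)%:~R[%classic (z w * n.+1%:R)] `&`
       [set w | A (F w (j%:~R / n.+1%:R))]).
    apply/seteqP; split => [w Aw|w [j _ [/= jw Aw]]].
      exists (Num.floor (z w * n.+1%:R)) => //; split => //=.
      by rewrite in_itv/= floor_itv.
    rewrite /zn; suff -> : Num.floor (z w * n.+1%:R) = j by [].
    by apply: floor_def; rewrite in_itv/= in jw.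
  apply: countable_bigcupT_measurable => // j.
  apply: measurableI.
    apply: measurable_preimage (measurable_itv _).
    by apply: measurable_funM => //; exact: measurable_cst.
  exact: measurable_preimage (mF _) mA.
apply: continuous_cvg; first exact: cF.
apply/cvgrPdist_lt => e e0; near=> n.
rewrite /zn -[X in X - _](mulfK (_ : n.+1%:R != 0 :> R))// -mulrBl normrM.
rewrite [X in _ * X]ger0_norm ?invr_ge0// ltr_pdivrMr//.
have /andP[f1 f2] := floor_itv (z w * n.+1%:R).
rewrite ger0_norm ?subr_ge0//.
apply: (@lt_trans _ _ 1); first by rewrite ltrBlDl -[1]/(1%:~R) -intrD.
rewrite -ltr_pdivrMl// mulr1 (@lt_le_trans _ _ n%:R)// ?ler_nat//.
near: n; exact: nbhs_infty_gtr.
Unshelve. all: by end_near. Qed.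

End MeasurableTools.

Lemma continuous_pair (R : realType) (S : topologicalType) (X : topologicalType)
    (l : S -> R -> R) (a : X -> S) (b : X -> R) (x : X) :
  continuous (fun p : S * R => l p.1 p.2) ->
  {for x, continuous a} -> {for x, continuous b} ->
  {for x, continuous (fun y => l (a y) (b y))}.
Proof.
move=> lc ca cb.
apply: (@continuous_cvg _ (S * R)%type R (nbhs x) _ (fun y => (a y, b y))
  (fun p => l p.1 p.2) (a x, b x)); first exact: lc.
exact: (@cvg_pair _ _ _ (nbhs x) (nbhs (a x)) (nbhs (b x)) _ _ _ _ _ ca cb).
Qed.

Section ClassFunctions.
Context (R : realType) (T : polishType R).
Implicit Types xi : rooted_space T.

Definition class_rep xi : rooted_nat T := repr (xi : {eq_quot dloc_equiv T}%qT).

Definition class_iter sg k xi : R :=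
  ext_iter (class_rep xi).1 sg k (class_rep xi).2.

Definition class_type xi : T := vtype (class_rep xi).1 (class_rep xi).2.

Lemma class_repK xi : rooted_class (class_rep xi).1 (class_rep xi).2 = xi.
Proof.
rewrite -[RHS]reprK; apply/eqmodP; rewrite /= /dloc_null /dloc_nat /=.
by apply/eqP; exact: dloc_relabel.
Qed.

Lemma class_iter_type_cvg xi sg k (e : R) : 0 < e ->
  exists2 dlt : R, 0 < dlt & forall (V : countType) (g : network T V) o,
    mdist xi (rooted_class g o) < dlt ->
    `|class_iter sg k xi - ext_iter g sg k o| < e /\
    mdist (class_type xi) (vtype g o) < e.
Proof.
move=> e0; have [dlt dlt0 H] :=
  local_approx (class_rep xi).1 (class_rep xi).2 sg k e0.
exists dlt => // V g o; rewrite -{1}(class_repK xi) mdist_rooted_class.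
exact: H.
Qed.

(** The iterates, and the type of the root, are unchanged on replacing a
    network by another one at distance $0$, hence are functions of the class. *)
Lemma class_iterE (V : countType) (g : network T V) o sg k :
  class_iter sg k (rooted_class g o) = ext_iter g sg k o.
Proof.
apply/eqP; rewrite -subr_eq0 -normr_le0; apply/ler_addgt0Pl => e e0.
have [dlt dlt0 H] := class_iter_type_cvg (rooted_class g o) sg k e0.
by have [|+ _] := H _ g o; [rewrite mdistxx | rewrite addr0 => /ltW].
Qed.

Lemma class_typeE (V : countType) (g : network T V) o :
  class_type (rooted_class g o) = vtype g o.
Proof.
apply/mdist_positivity/eqP; rewrite eq_le mdist_ge0 andbT.
apply/ler_addgt0Pl => e e0; rewrite addr0.
have [dlt dlt0 H] := class_iter_type_cvg (rooted_class g o) true 0 e0.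
by have [|_ /ltW] := H _ g o; first by rewrite mdistxx.
Qed.

Lemma class_iter_continuous sg k : continuous (class_iter sg k).
Proof.
move=> xi; apply/(@cvgrPdist_lt _ _ _ _ (nbhs_filter xi)) => e e0.
have [dlt dlt0 H] := class_iter_type_cvg xi sg k e0.
apply/nbhs_ballP; exists dlt => //= xi'; rewrite ballEmdist/=.
by rewrite -{1}(class_repK xi') => /H[].
Qed.

Lemma class_type_continuous : continuous class_type.
Proof.
move=> xi; apply/(@cvg_ballP _ _ _ _ (nbhs_filter xi)) => e e0.
have [dlt dlt0 H] := class_iter_type_cvg xi true 0 e0.
apply/nbhs_ballP; exists dlt => //= xi'; rewrite !ballEmdist/=.
by rewrite -{1}(class_repK xi') => /H[].
Qed.

Lemma class_loss_continuous (l : T -> R -> R) sg k :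
  continuous (fun p : T * R => l p.1 p.2) ->
  continuous (fun xi => l (class_type xi) (class_iter sg k xi)).
Proof.
move=> lc xi; apply: (continuous_pair lc).
  exact: class_type_continuous.
exact: class_iter_continuous.
Qed.

End ClassFunctions.

Section MeasurableIterates.
Context (R : realType) (T : polishType R).
Context {d : measure_display} {Om : measurableType d}.

Lemma measurable_loss (l : T -> R -> R) (t : Om -> T) (z : Om -> R) :
  continuous (fun p : T * R => l p.1 p.2) ->
  measurable_fun setT (t : Om -> borel T) -> measurable_fun setT z ->
  measurable_fun setT (fun w => l (t w) (z w)).
Proof.
move=> lc mt mz; apply: (caratheodory_measurable (F := fun w q => l (t w) q)).
- move=> q; apply: (@measurableT_comp _ _ _ _ _ _ (fun s : borel T => l s q)) => //.
  apply: continuous_borel => s; apply: (continuous_pair lc).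
    exact: cvg_id.
  exact: cvg_cst.
- move=> w q; apply: (continuous_pair lc); [exact: cvg_cst|exact: cvg_id].
- by [].
Qed.

Lemma measurable_response (f : Om -> response R) (z : Om -> R) :
  measurable_fun setT (f : Om -> borel (response R)) ->
  measurable_fun setT z -> measurable_fun setT (fun w => f w (z w)).
Proof.
move=> mf mz; apply: (caratheodory_measurable (F := fun w q => f w q)) => //.
- move=> q; apply: (@measurableT_comp _ _ _ _ _ _
    (fun h : borel (response R) => response_val h q)) => //.
  apply: continuous_borel => h; apply/(@cvgrPdist_lt _ _ _ _ (nbhs_filter h)) => e e0.
  apply/nbhs_ballP; exists e => //= h'; rewrite ballEmdist/=.
  exact: le_lt_trans (response_dist_ub _ _ _).
- move=> w q; apply/cvgrPdist_lt => e e0.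
  apply/nbhs_ballP; exists e => //= q'; rewrite /ball/=.
  exact: le_lt_trans (response_lip _ _ _).
Qed.

Lemma measurable_bsup (f : Om -> response R) :
  measurable_fun setT (f : Om -> borel (response R)) ->
  measurable_fun setT (fun w => bsup (f w)).
Proof.
move=> mf; apply: (@measurableT_comp _ _ _ _ _ _
    (fun h : borel (response R) => bsup h)) => //.
apply: continuous_borel => h; apply/(@cvgrPdist_lt _ _ _ _ (nbhs_filter h)) => e e0.
apply/nbhs_ballP; exists e => //= h'; rewrite ballEmdist/=.
exact: le_lt_trans (bsup_dist _ _).
Qed.

Context (V : countType) (G : Om -> network T V).
Hypothesis hG : random_network G.

(** Neighbourhoods are finite but random; summing along an enumeration of all
    vertices turns a neighbourhood sum into a limit of sums over fixed index
    sets. *)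
Lemma measurable_out_sum (v : V) (F : Om -> V -> R) :
  (forall u, measurable_fun setT (fun w => if arc (G w) v u then F w u else 0)) ->
  measurable_fun setT (fun w => \sum_(u \in out (G w) v) F w u).
Proof.
move=> mF.
pose a w i := oapp (fun u => if arc (G w) v u then F w u else 0) 0 (@pickle_inv V i).
apply: (measurable_fun_cvg (h := fun n w => \sum_(i < n) a w i)) => [n|w _].
  apply: measurable_sum => i; rewrite /a; case: pickle_inv => [u|] //=.
have finw := arc_finite (G w) v.
(* one bound for the indices of all out-neighbours *)
have [N NP] : exists N, forall u, arc (G w) v u -> (pickle u < N)%N.
  exists (\sum_(u \in out (G w) v) (pickle u).+1)%N => u vu.
  by rewrite (fsbigD1 u)//; exact: leq_addr.
apply: cvg_near_cst; exists N => // n /= Nn.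
rewrite (fsbig_ord _ _ (a w)).
rewrite -(fsbig_widen (pickle @` out (G w) v)).
- rewrite fsbig_image; last by move=> u u' _ _ /(pcan_inj pickleK_inv).
  by apply: eq_fsbigr => u; rewrite inE /= /a pickleK_inv/= => ->.
- by move=> _ [u vu <-]; rewrite /= (leq_trans _ Nn)// NP.
- move=> i [_ ni] /=; rewrite /a.
  case E : pickle_inv => [u|] //=; case: ifPn => // vu; case: ni.
  by exists u => //; have := @pickle_invK V i; rewrite E.
Qed.

Lemma measurable_arc v u (F : Om -> R) :
  measurable_fun [set w | arc (G w) v u] F ->
  measurable_fun setT (fun w => if arc (G w) v u then F w else 0).
Proof.
have [marc _ _ _ _] := hG; move=> mF.
have -> : (fun w => if arc (G w) v u then F w else 0) =
    F \_ [set w | arc (G w) v u].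
  by apply/funext => w; rewrite patchE mem_setE.
exact/(measurable_restrictT _ (marc v u)).
Qed.

Lemma measurable_weight v u : measurable_fun setT (fun w => weight (G w) v u).
Proof.
have [marc _ _ _ me] := hG.
apply: measurable_arc; apply: measurable_funM; first exact: me.
(* the inverse is a power with exponent -1, as total exposures are positive *)
apply: (@eq_measurable_fun _ _ _ _ _
    (fun w => (\sum_(z \in out (G w) v) emark (G w) v z) `^ (-1))).
  by move=> w; rewrite inE => vu; rewrite powR_inv1// ltW// (out_sum_gt0 vu).
apply: (@measurableT_comp _ _ _ _ _ _ (@powR R ^~ (-1))) => //.
apply: measurable_funS (measurable_out_sum _) => // z.
by apply: measurable_arc; exact: me.
Qed.

Lemma measurable_ext_iter sg k v :
  measurable_fun setT (fun w => ext_iter (G w) sg k v).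
Proof.
have [marc mt ms mr me] := hG.
elim: k v => [|k IH] v /=.
  by case: sg => //; exact: measurable_bsup.
apply: measurable_response => //; apply: measurable_funD => //.
apply: measurable_out_sum => u; apply: measurable_arc.
apply: measurable_funS (measurable_funM (measurable_weight v u) (IH u)) => //.
Qed.

Lemma measurable_gap k v : measurable_fun setT (fun w => gap (G w) k v).
Proof. by apply: measurable_funB; exact: measurable_ext_iter. Qed.

End MeasurableIterates.

(** * Positive functionals and their values on indicators *)

Section PositiveFunctionals.
Import HBNNSimple.
Context (R : realType).
Local Open Scope ereal_scope.

Definition nneg_mfun d (Y : measurableType d) (f : Y -> \bar R) : Prop :=
  measurable_fun setT f /\ forall y, 0 <= f y.

(** The properties shared by all integrals against fixed measures, mixtures of
    measures and densities. *)
Record positive_functional d (Y : measurableType d) (L : (Y -> \bar R) -> \bar R)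
    : Prop := PositiveFunctional {
  pfun_ge0 : forall f, nneg_mfun f -> 0 <= L f;
  pfun_le : forall f g, nneg_mfun f -> nneg_mfun g -> (forall y, f y <= g y) ->
    L f <= L g;
  pfunD : forall f g, nneg_mfun f -> nneg_mfun g -> L (f \+ g) = L f + L g;
  pfunZ : forall (k : R) f, (0 <= k)%R -> nneg_mfun f ->
    L (fun y => k%:E * f y) = k%:E * L f;
  pfun_cvg : forall (f : (Y -> \bar R)^nat) g, (forall n, nneg_mfun (f n)) ->
    (forall y, nondecreasing_seq (f ^~ y)) ->
    (forall y, f ^~ y @ \oo --> g y) -> L (f n) @[n --> \oo] --> L g
}.

Lemma nneg_mfun_cvg d (Y : measurableType d) (f : (Y -> \bar R)^nat) g :
  (forall n, nneg_mfun (f n)) -> (forall y, f ^~ y @ \oo --> g y) -> nneg_mfun g.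
Proof.
move=> fn fg; split.
  by apply: (emeasurable_fun_cvg f) => [n|y _]; [have [] := fn n | exact: fg].
move=> y; rewrite -(cvg_lim _ (fg y))//; apply: lime_ge.
  by apply/cvg_ex; exists (g y); exact: fg.
by apply: nearW => n; have [_ ->] := fn n.
Qed.

Lemma nneg_mfun_EFin d (Y : measurableType d) (h : Y -> R) :
  measurable_fun setT h -> (forall y, (0 <= h y)%R) -> nneg_mfun (EFin \o h).
Proof.
by move=> mh h0; split => [|y]; [exact/measurable_EFinP | rewrite /= lee_fin].
Qed.

Lemma nneg_mfun_indic d (Y : measurableType d) (A : set Y) : measurable A ->
  nneg_mfun (EFin \o \1_A : Y -> \bar R).
Proof.
by move=> mA; apply: nneg_mfun_EFin => [|y]; [exact: measurable_indic | rewrite indicE].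
Qed.

Lemma nneg_mfunZ d (Y : measurableType d) (f : Y -> \bar R) (k : R) :
  (0 <= k)%R -> nneg_mfun f -> nneg_mfun (fun y => k%:E * f y).
Proof.
move=> k0 [mf f0]; split; first exact: emeasurable_funM.
by move=> y; rewrite mule_ge0// lee_fin.
Qed.

Lemma nneg_mfunD d (Y : measurableType d) (f g : Y -> \bar R) :
  nneg_mfun f -> nneg_mfun g -> nneg_mfun (f \+ g).
Proof.
move=> [mf f0] [mg g0]; split; first exact: emeasurable_funD.
by move=> y; rewrite adde_ge0.
Qed.

Lemma nneg_mfun_comp d d' (X : measurableType d) (Y : measurableType d')
    (h : X -> Y) (f : Y -> \bar R) :
  measurable_fun setT h -> nneg_mfun f -> nneg_mfun (f \o h).
Proof.
by move=> mh [mf f0]; split => [|x]; [exact: measurableT_comp | exact: f0].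
Qed.

Lemma pfun_scaled_eval d (Y : measurableType d) (a : R) (y : Y) : (0 <= a)%R ->
  positive_functional (fun u => a%:E * u y).
Proof.
move=> a0; split => [f [_ f0]|f g _ _ fg|f g [_ f0] [_ g0]|k f k0 [_ f0]|f g fn ndf fg] /=.
- by rewrite mule_ge0// lee_fin.
- by rewrite lee_wpmul2l// lee_fin.
- by rewrite ge0_muleDr.
- by rewrite muleCA.
- by apply: cvgeZl => //; exact: fg.
Qed.

Lemma pfun_eval d (Y : measurableType d) (y : Y) :
  positive_functional (fun u : Y -> \bar R => u y).
Proof.
have -> : (fun u : Y -> \bar R => u y) = (fun u => 1%:E * u y).
  by apply/funext => u; rewrite mul1e.
exact: pfun_scaled_eval.
Qed.

(** Mixtures of positive functionals; with evaluations and other mixtures as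
    components, this produces every functional to be compared. *)
Lemma pfun_integral d d' (X : measurableType d) (Y : measurableType d')
    (m : {measure set X -> \bar R}) (D : set X)
    (K : X -> (Y -> \bar R) -> \bar R) : measurable D ->
  (forall x, positive_functional (K x)) ->
  (forall u, nneg_mfun u -> measurable_fun setT (K ^~ u)) ->
  positive_functional (fun u => \int[m]_(x in D) K x u).
Proof.
move=> mD hK mK.
have K0 u : nneg_mfun u -> forall x, D x -> 0 <= K x u.
  by move=> un x _; exact: pfun_ge0.
have mKD u : nneg_mfun u -> measurable_fun D (K ^~ u).
  by move=> un; apply: measurable_funTS; exact: mK.
split => [f fn|f g fn gn fg|f g fn gn|k f k0 fn|f g fn ndf fg].
- by apply: integral_ge0 => x Dx; exact: K0.
- apply: ge0_le_integral => //; [exact: K0|exact: mKD|exact: mKD|].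
  by move=> x _; apply: pfun_le.
- rewrite -ge0_integralD//; [|exact: K0|exact: mKD|exact: K0|exact: mKD].
  by apply: eq_integral => x _; exact: pfunD.
- rewrite -ge0_integralZl_EFin//; [|exact: K0|exact: mKD].
  by apply: eq_integral => x _; exact: pfunZ.
- have gn := nneg_mfun_cvg fn fg.
  have -> : \int[m]_(x in D) K x g =
      \int[m]_(x in D) limn (fun n => K x (f n)).
    apply: eq_integral => x _; apply/esym/cvg_lim => //.
    exact: (pfun_cvg (hK x)).
  apply: cvg_monotone_convergence => //.
  + by move=> n; apply: mKD.
  + by move=> n x Dx; apply: K0.
  + move=> x Dx i j ij; apply: (pfun_le (hK x)) => // y; exact: ndf.
Qed.

(** Simple functions are positive combinations of indicators, and every
    nonnegative measurable function is an increasing limit of simple ones. *)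
Lemma pfun_unique d (Y : measurableType d) (L1 L2 : (Y -> \bar R) -> \bar R) :
  positive_functional L1 -> positive_functional L2 ->
  (forall A, measurable A -> L1 (EFin \o \1_A) = L2 (EFin \o \1_A)) ->
  forall f, nneg_mfun f -> L1 f = L2 f.
Proof.
move=> h1 h2 h12 f [mf f0].
have comb (I : eqType) (s : seq I) (r : I -> R) (A : I -> set Y) :
    (forall i, i \in s -> (0 <= r i)%R) -> (forall i, measurable (A i)) ->
    let h := fun y => (\sum_(i <- s) r i * \1_(A i) y)%R%:E in
    nneg_mfun h /\ L1 h = L2 h.
  move=> + mA; elim: s => [|i s IH] rs /=.
    have n0 : nneg_mfun (fun y : Y => (\sum_(i <- [::]) r i * \1_(A i) y)%R%:E).
      by under eq_fun do rewrite big_nil; split => //; exact: measurable_cst.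
    split => //; have z L : positive_functional L ->
        L (fun y : Y => (\sum_(i <- [::]) r i * \1_(A i) y)%R%:E) = 0.
      move=> hL; have := pfunZ hL (lexx 0%R) n0; rewrite mul0e => <-.
      by congr L; apply/funext => y; rewrite big_nil mul0e.
    by rewrite !z.
  have [nh eh] := IH (fun j js => rs j (mem_behead (s := i :: s) js)).
  have ri : (0 <= r i)%R by apply: rs; rewrite inE eqxx.
  have -> : (fun y => (\sum_(j <- i :: s) r j * \1_(A j) y)%R%:E) =
    (fun y => (r i)%:E * (EFin \o \1_(A i)) y) \+
    (fun y => (\sum_(j <- s) r j * \1_(A j) y)%R%:E).
    by apply/funext => y; rewrite big_cons EFinD EFinM.
  have ni := nneg_mfunZ ri (nneg_mfun_indic (mA i)).
  split; first exact: nneg_mfunD.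
  rewrite !pfunD// eh; congr (_ + _).
  by rewrite (pfunZ h1 ri (nneg_mfun_indic (mA i))) (pfunZ h2 ri (nneg_mfun_indic (mA i))) h12.
pose g (n : nat) := EFin \o (nnsfun_approx measurableT mf n : Y -> R).
have gP n : nneg_mfun (g n) /\ L1 (g n) = L2 (g n).
  set h := nnsfun_approx measurableT mf n.
  have hE : g n = fun y => (\sum_(r <- finmap.enum_fset (fset_set (range h))) r * \1_(h @^-1` [set r]) y)%R%:E.
    by apply/funext => y; rewrite /g /= fimfunE fsbig_finite//.
  rewrite hE; apply: (comb _ _ id (fun r => h @^-1` [set r])) => [r|r].
    by rewrite in_fset_set// inE => -[y _ <-].
  by rewrite -[X in measurable X]setTI; apply: measurable_funP.
have ng n : nneg_mfun (g n) by have [] := gP n.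
have ndg y : nondecreasing_seq (g ^~ y).
  by move=> i j ij; rewrite lee_fin; apply/lefP/nd_nnsfun_approx.
have gf y : g ^~ y @ \oo --> f y by apply: cvg_nnsfun_approx.
rewrite -(cvg_lim _ (pfun_cvg h1 ng ndg gf))//.
rewrite -(cvg_lim _ (pfun_cvg h2 ng ndg gf))//.
by congr (limn _); apply/funext => n; have [] := gP n.
Qed.

End PositiveFunctionals.

(** * Laws, couplings and densities *)

Section LawIntegrals.
Context (R : realType).
Local Open Scope ereal_scope.

Lemma lawE d d' (X : measurableType d) (Y : measurableType d')
    (P : probability X R) (h : X -> Y) A : measurable_fun setT h ->
  law P h A = P (h @^-1` A).
Proof. by move=> mh; rewrite /law; case: pselect => // -[]; rewrite inE. Qed.

Lemma integral_law d d' (X : measurableType d) (Y : measurableType d')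
    (P : probability X R) (h : X -> Y) (f : Y -> \bar R) :
  measurable_fun setT h -> nneg_mfun f ->
  \int[law P h]_y f y = \int[P]_x f (h x).
Proof.
move=> mh [mf f0]; rewrite /law; case: pselect => [mh'|[]]; last by rewrite inE.
by rewrite ge0_integral_distribution.
Qed.

Lemma integral_empirical d (Y : measurableType d) n (x : 'I_n.+1 -> Y)
    (f : Y -> \bar R) : nneg_mfun f ->
  \int[empirical R x]_y f y =
  ((n.+1%:R^-1)%R)%:E * \sum_(i < n.+1) f (x i).
Proof.
move=> [mf f0].
have c0 : (0 <= n.+1%:R^-1 :> R)%R by rewrite invr_ge0.
pose c := NngNum c0.
pose m := mscale c
  (msum (fun i => \d_(x (inord i)) : {measure set Y -> \bar R}) n.+1).
transitivity (\int[m]_y f y).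
  apply: eq_measure_integral => A mA _.
  rewrite /empirical /m /mscale/= /msum; congr (_ * _).
  by apply: eq_bigr => i _; rewrite inord_val.
rewrite ge0_integral_mscale// ge0_integral_measure_sum//; congr (_ * _).
apply: eq_bigr => i _; rewrite integral_dirac// inord_val.
by rewrite diracT mul1e.
Qed.

Lemma nneg_mfun_dist : nneg_mfun (fun z : R * R => `|z.1 - z.2|%:E).
Proof.
split; last by move=> z; rewrite lee_fin.
apply/measurable_EFinP; apply: measurableT_comp => //.
by apply: measurable_funB; [exact: measurable_fst | exact: measurable_snd].
Qed.

Lemma W1_law_le d (X : measurableType d) (P : probability X R) (a b : X -> R) :
  measurable_fun setT a -> measurable_fun setT b ->
  W1 (law P a) (law P b) <= \int[P]_x `|a x - b x|%:E.
Proof.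
move=> ma mb; have mab := measurable_fun_pair ma mb.
apply: ereal_inf_lbound; exists (law P (fun x => (a x, b x))).
  split=> A mA; rewrite !lawE//; congr (P _);
    by apply/seteqP; split => x //= [].
by rewrite integral_law//; exact: nneg_mfun_dist.
Qed.

Lemma W1_empirical_le n (a b : 'I_n.+1 -> R) :
  W1 (empirical R a) (empirical R b) <=
  (n.+1%:R^-1 * \sum_(i < n.+1) `|a i - b i|)%R%:E.
Proof.
apply: ereal_inf_lbound; exists (empirical R (fun i => (a i, b i))).
  split=> A mA; rewrite /empirical; congr (_ * _);
    by apply: eq_bigr => i _; rewrite !diracE in_setX in_setT ?andbT.
rewrite integral_empirical; last exact: nneg_mfun_dist.
by rewrite sumEFin -EFinM.
Qed.

End LawIntegrals.

Section DiscreteCoupling.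
Context (R : realType) (N : nat) (p q : 'I_N -> R).
Hypotheses (p0 : forall i, 0 <= p i) (q0 : forall i, 0 <= q i).
Hypotheses (p1 : \sum_i p i = 1) (q1 : \sum_i q i = 1).

Let m i := Num.min (p i) (q i).
Let r := 1 - \sum_i m i.

(** The maximal coupling: the common mass $\min(p_i, q_i)$ stays put, and the
    two remainders, of equal mass $r$, are coupled independently. *)
Definition maximal_coupling i j : R :=
  (if i == j then m i else 0) + r^-1 * ((p i - m i) * (q j - m j)).

Let mp i : m i <= p i. Proof. by rewrite ge_min lexx. Qed.
Let mq i : m i <= q i. Proof. by rewrite ge_min lexx orbT. Qed.
Let m0 i : 0 <= m i. Proof. by rewrite le_min p0 q0. Qed.
Let rp : \sum_i (p i - m i) = r. Proof. by rewrite sumrB p1. Qed.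
Let rq : \sum_i (q i - m i) = r. Proof. by rewrite sumrB q1. Qed.
Let r0 : 0 <= r.
Proof. by rewrite -rp sumr_ge0// => i _; rewrite subr_ge0. Qed.

Lemma maximal_coupling_ge0 i j : 0 <= maximal_coupling i j.
Proof.
apply: addr_ge0; first by case: ifP.
by apply: mulr_ge0; rewrite ?invr_ge0//; apply: mulr_ge0; rewrite subr_ge0.
Qed.

Lemma maximal_coupling_row i : \sum_j maximal_coupling i j = p i.
Proof.
rewrite big_split/= -big_mkcond/=.
have -> : \sum_j r^-1 * ((p i - m i) * (q j - m j)) = r^-1 * ((p i - m i) * r).
  by rewrite -rq !mulr_sumr.
rewrite (eq_bigl (fun j => j == i)); last by move=> j; rewrite eq_sym.
rewrite big_pred1_eq; have [r_eq0|r_neq0] := eqVneq r 0.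
  rewrite r_eq0 !mulr0 addr0; apply/eqP; rewrite eq_sym -subr_eq0.
  have /psumr_eq0P : \sum_i (p i - m i) = 0 by rewrite rp.
  by move=> -> // j _; rewrite subr_ge0.
by rewrite mulrCA mulVf// mulr1 addrCA subrr addr0.
Qed.

Lemma maximal_coupling_col j : \sum_i maximal_coupling i j = q j.
Proof.
rewrite big_split/= -big_mkcond/=.
have -> : \sum_i r^-1 * ((p i - m i) * (q j - m j)) = r^-1 * (r * (q j - m j)).
  by rewrite -rp mulr_suml mulr_sumr.
rewrite big_pred1_eq; have [r_eq0|r_neq0] := eqVneq r 0.
  rewrite r_eq0 mul0r mulr0 addr0; apply/eqP; rewrite eq_sym -subr_eq0.
  have /psumr_eq0P : \sum_i (q i - m i) = 0 by rewrite rq.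
  by move=> -> // i _; rewrite subr_ge0.
by rewrite mulrA mulVf// mul1r addrCA subrr addr0.
Qed.

(** The diagonal keeps at least the common mass, and $p_i - \min(p_i, q_i)$ is
    at most $|p_i - q_i|$. *)
Lemma maximal_coupling_offdiag :
  \sum_i \sum_(j | j != i) maximal_coupling i j <= \sum_i `|p i - q i|.
Proof.
have -> : \sum_i \sum_(j | j != i) maximal_coupling i j =
    \sum_i (p i - maximal_coupling i i).
  apply: eq_bigr => i _; rewrite -(maximal_coupling_row i) [in RHS](bigD1 i)//=.
  by rewrite addrAC subrr add0r.
apply: ler_sum => i _; rewrite lerBlDr.
apply: (@le_trans _ _ (`|p i - q i| + m i)).
  rewrite /m; case: (leP (p i) (q i)) => _; first by rewrite lerDr.
  by rewrite -lerBlDr ler_norm.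
rewrite lerD2l /maximal_coupling eqxx lerDl.
by apply: mulr_ge0; rewrite ?invr_ge0//; apply: mulr_ge0; rewrite subr_ge0.
Qed.

End DiscreteCoupling.

Section Density.
Context {d} {X : measurableType d} {R : realType}.
Variables (mu : {measure set X -> \bar R}) (K : X -> \bar R).
Hypothesis Kn : nneg_mfun K.

(** The proof that [K] is a density is an argument, so that the measure
    structure can be attached to the function of sets. *)
Definition density of nneg_mfun K := fun A => (\int[mu]_(x in A) K x)%E.

Let density0 : density Kn set0 = 0%E. Proof. exact: integral_set0. Qed.
Let density_ge0 A : (0 <= density Kn A)%E.
Proof. by apply: integral_ge0 => x _; have [_] := Kn. Qed.
Let density_sigma_additive : semi_sigma_additive (density Kn).
Proof.
by have [mK K0] := Kn; exact: semi_sigma_additive_nng_induced.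
Qed.

HB.instance Definition _ := isMeasure.Build _ _ _ (density Kn)
  density0 density_ge0 density_sigma_additive.

End Density.

(** * Coupling two laws through a partition *)

Section Gluing.
Context (R : realType) (nu nu' : probability R R).
Variables (N : nat) (h : 'I_N -> R -> R).
Hypotheses (mh : forall i, measurable_fun setT (h i))
           (h0 : forall i x, 0 <= h i x)
           (h1 : forall x, \sum_i h i x = 1).

Lemma part_le1 i x : h i x <= 1.
Proof. by rewrite -(h1 x) (bigD1 i)//= lerDl sumr_ge0. Qed.

Lemma nneg_mfun_part i : nneg_mfun (EFin \o h i).
Proof. exact: nneg_mfun_EFin. Qed.

Lemma integral_one (m : probability R R) : (\int[m]_x (1%:E : \bar R) = 1%:E)%E.
Proof. by rewrite integral_cst// mul1e; exact: probability_setT. Qed.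

Definition part_mass (m : probability R R) i : R := fine (\int[m]_x (h i x)%:E).

Lemma part_massE (m : probability R R) i :
  (\int[m]_x (h i x)%:E)%E = (part_mass m i)%:E.
Proof.
have [mhi h0i] := nneg_mfun_part i.
rewrite fineK// ge0_fin_numE; last by apply: integral_ge0 => x _; rewrite lee_fin.
apply: (@le_lt_trans _ _ (\int[m]_x (1%:E : \bar R))%E); last first.
  by rewrite integral_one ltry.
by apply: ge0_le_integral => // x _; rewrite lee_fin ?part_le1.
Qed.

Lemma part_mass_ge0 m i : 0 <= part_mass m i.
Proof. by apply: fine_ge0; apply: integral_ge0 => x _; rewrite lee_fin. Qed.

Lemma part_mass_sum (m : probability R R) : \sum_i part_mass m i = 1.
Proof.
apply: EFin_inj; rewrite -sumEFin.
rewrite (eq_bigr (fun i => \int[m]_x (h i x)%:E)%E); last first.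
  by move=> i _; rewrite part_massE.
rewrite -ge0_integral_sum//; last 2 first.
- by move=> i; have [] := nneg_mfun_part i.
- by move=> i x _; rewrite lee_fin.
rewrite (eq_integral (fun=> 1%:E)); last first.
  by move=> x _; rewrite sumEFin h1.
exact: integral_one.
Qed.

Definition cell_mass (m : probability R R) (A : set R) i : R :=
  fine (\int[m]_x ((h i x)%:E * (\1_A x)%:E))%E.

Lemma nneg_mfun_cell A i : measurable A ->
  nneg_mfun (fun x => (h i x)%:E * (\1_A x)%:E)%E.
Proof.
move=> mA; have [m1 p1] := nneg_mfun_part i; have [m2 p2] := nneg_mfun_indic R mA.
by split => [|x]; [exact: emeasurable_funM | rewrite mule_ge0// lee_fin].
Qed.

Section CellMass.
Variables (m : probability R R) (A : set R).
Hypothesis mA : measurable A.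

Let cell_le i :
  (\int[m]_x ((h i x)%:E * (\1_A x)%:E) <= (part_mass m i)%:E)%E.
Proof.
rewrite -part_massE; have [m1 p1] := nneg_mfun_part i; have [m2 p2] := nneg_mfun_cell i mA.
apply: ge0_le_integral => // x _.
by rewrite -EFinM lee_fin ler_piMr// indicE.
Qed.

Lemma cell_massE i :
  (\int[m]_x ((h i x)%:E * (\1_A x)%:E) = (cell_mass m A i)%:E)%E.
Proof.
rewrite fineK// ge0_fin_numE; first exact: le_lt_trans (cell_le i) (ltry _).
by apply: integral_ge0 => x _; have [_] := nneg_mfun_cell i mA.
Qed.

Lemma cell_mass_eq0 i : part_mass m i = 0 -> cell_mass m A i = 0.
Proof.
move=> pi0; apply/eqP; rewrite eq_le -!lee_fin -!cell_massE; apply/andP; split.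
  by rewrite (le_trans (cell_le i))// pi0.
by apply: integral_ge0 => x _; have [_] := nneg_mfun_cell i mA.
Qed.

Lemma cell_mass_sum : (\sum_i cell_mass m A i)%:E = m A.
Proof.
rewrite -sumEFin.
rewrite (eq_bigr (fun i => \int[m]_x ((h i x)%:E * (\1_A x)%:E))%E); last first.
  by move=> i _; rewrite cell_massE.
rewrite -ge0_integral_sum//; last 2 first.
- by move=> i; have [] := nneg_mfun_cell i mA.
- by move=> i x _; have [_] := nneg_mfun_cell i mA.
transitivity (\int[m]_x (\1_A x)%:E)%E; last by rewrite integral_indic// setIT.
apply: eq_integral => x _; rewrite -ge0_sume_distrl; last first.
  by move=> i _; rewrite lee_fin.
by rewrite sumEFin h1 mul1e.
Qed.

End CellMass.

Lemma cell_mass_setT m i : cell_mass m setT i = part_mass m i.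
Proof.
congr fine; apply: eq_integral => x _.
by rewrite indicE in_setT mule1.
Qed.

Lemma integral_prod_split (f g : R -> \bar R) : nneg_mfun f -> nneg_mfun g ->
  (\int[nu \x nu']_z (f z.1 * g z.2) =
   \int[nu]_x f x * \int[nu']_y g y)%E.
Proof.
move=> [mf f0] [mg g0].
rewrite fubini_tonelli1; last 2 first.
- by apply: emeasurable_funM; apply: measurableT_comp.
- by move=> z; rewrite mule_ge0.
rewrite /fubini_F /= muleC.
rewrite -ge0_integralZl//; last exact: integral_ge0.
by apply: eq_integral => x _; rewrite ge0_integralZl// muleC.
Qed.

Let p := part_mass nu.
Let q := part_mass nu'.
Let c := maximal_coupling p q.
(* the density of the coupling with respect to the product law: the coupled mass
   of two cells, spread over them in proportion to both laws *)
Let M (u : 'I_N * 'I_N) := c u.1 u.2 / (p u.1 * q u.2).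
Let k (u : 'I_N * 'I_N) (z : R * R) := h u.1 z.1 * h u.2 z.2.

Let c0 i j : 0 <= c i j.
Proof.
exact: (maximal_coupling_ge0 (part_mass_ge0 nu) (part_mass_ge0 nu')
  (part_mass_sum nu)).
Qed.

Let row i : \sum_j c i j = p i.
Proof. exact: maximal_coupling_row (part_mass_sum nu) (part_mass_sum nu') i. Qed.

Let col j : \sum_i c i j = q j.
Proof. exact: maximal_coupling_col (part_mass_sum nu) (part_mass_sum nu') j. Qed.

Let M0 u : 0 <= M u.
Proof.
by rewrite divr_ge0// mulr_ge0// part_mass_ge0.
Qed.

Let c_le_p i j : c i j <= p i.
Proof.
rewrite -(row i).
by rewrite (bigD1 j)//= lerDl sumr_ge0.
Qed.

Let c_le_q i j : c i j <= q j.
Proof.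
rewrite -(col j).
by rewrite (bigD1 i)//= lerDl sumr_ge0.
Qed.

Let Mpq i j : M (i, j) * (p i * q j) = c i j.
Proof.
rewrite /M /=; have [pq0|pq_neq0] := eqVneq (p i * q j) 0; last exact: divfK.
rewrite pq0 mulr0; apply/esym/eqP; rewrite eq_le c0 andbT.
by move/eqP: pq0; rewrite mulf_eq0 => /orP[]/eqP <-.
Qed.

Let Mrow i : p i != 0 -> \sum_j M (i, j) * q j = 1.
Proof.
move=> pi0; apply: (mulfI pi0); rewrite mulr1 mulr_sumr.
rewrite -[RHS](row i).
by apply: eq_bigr => j _; rewrite mulrCA Mpq.
Qed.

Let Mcol j : q j != 0 -> \sum_i M (i, j) * p i = 1.
Proof.
move=> qj0; apply: (mulfI qj0); rewrite mulr1 mulr_sumr.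
rewrite -[RHS](col j).
by apply: eq_bigr => i _; rewrite mulrCA (mulrC (q j)) Mpq.
Qed.

Let K (z : R * R) : \bar R := (\sum_u M u * k u z)%:E.

Let k0 u z : 0 <= k u z. Proof. by rewrite mulr_ge0. Qed.

Let mk u : measurable_fun setT (k u).
Proof. by apply: measurable_funM; apply: measurableT_comp. Qed.

Let Kn : nneg_mfun K.
Proof.
split => [|z]; last by rewrite lee_fin sumr_ge0// => u _; rewrite mulr_ge0.
by apply/measurable_EFinP; apply: measurable_sum => u; apply: measurable_funM.
Qed.

(** Expanding the density reduces an integral against it to the integrals of
    the pairs of cells. *)
Let integral_K (f : R * R -> \bar R) : nneg_mfun f ->
  (\int[nu \x nu']_z (K z * f z) =
   \sum_u (M u)%:E * \int[nu \x nu']_z ((k u z)%:E * f z))%E.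
Proof.
move=> [mf f0].
have mkf u : measurable_fun setT (fun z => (k u z)%:E * f z)%E.
  by apply: emeasurable_funM => //; exact/measurable_EFinP.
have kf0 u z : (0 <= (k u z)%:E * f z)%E by rewrite mule_ge0// lee_fin.
under [RHS]eq_bigr => u _ do rewrite -ge0_integralZl_EFin//.
rewrite -ge0_integral_sum//.
- apply: eq_integral => z _; rewrite /K -sumEFin ge0_sume_distrl.
    by apply: eq_bigr => u _; rewrite EFinM muleA.
  by move=> u _; rewrite lee_fin mulr_ge0.
- by move=> u; exact: emeasurable_funM.
- by move=> u z _; rewrite mule_ge0// lee_fin.
Qed.

Let integral_density (f : R * R -> \bar R) : nneg_mfun f ->
  (\int[density (nu \x nu')%E Kn]_z f z = \int[nu \x nu']_z (K z * f z))%E.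
Proof.
move=> fn; have [mK K0] := Kn.
have Kfin z : K z = (\sum_u M u * k u z)%:E by [].
apply: (@pfun_unique R _ _ (fun f => \int[density (nu \x nu')%E Kn]_z f z)%E
  (fun f => \int[nu \x nu']_z (K z * f z))%E) => //.
- have := @pfun_integral R _ _ _ _ (density (nu \x nu')%E Kn) setT
    (fun z u => 1%:E * u z)%E measurableT.
  have -> : (fun u => \int[density (nu \x nu')%E Kn]_x (1%:E * u x))%E =
            (fun u => \int[density (nu \x nu')%E Kn]_x u x)%E.
    by apply/funext => u; under eq_integral do rewrite mul1e.
  apply => [z|u [mu _]]; first exact: pfun_scaled_eval.
  by under eq_fun do rewrite mul1e.
- apply: pfun_integral => // [z|u [mu _]]; last exact: emeasurable_funM.
  by apply: pfun_scaled_eval; rewrite -lee_fin; exact: K0.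
- move=> A mA; transitivity (\int[nu \x nu']_(z in A) K z)%E.
    by rewrite integral_indic// setIT.
  rewrite integral_mkcond; apply: eq_integral => z _; rewrite patchE /= indicE.
  by case: (z \in A); rewrite ?mule1 ?mule0.
Qed.

Let density_rect A B : measurable A -> measurable B ->
  density (nu \x nu')%E Kn (A `*` B) =
  (\sum_i \sum_j M (i, j) * (cell_mass nu A i * cell_mass nu' B j))%:E.
Proof.
move=> mA mB.
transitivity (\int[nu \x nu']_z (K z * ((\1_A z.1)%:E * (\1_B z.2)%:E)))%E.
  rewrite -[LHS]/(\int[nu \x nu']_(z in A `*` B) K z)%E integral_mkcond.
  apply: eq_integral => z _; rewrite patchE !indicE in_setX.
  by case: (z.1 \in A); case: (z.2 \in B); rewrite ?(mule1, mule0, mul0e).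
rewrite integral_K; last first.
  have [m1 p1] := nneg_mfun_indic R mA; have [m2 p2] := nneg_mfun_indic R mB.
  split => [|z]; last by rewrite mule_ge0// lee_fin.
  apply: emeasurable_funM.
    by apply: (measurableT_comp m1); exact: measurable_fst.
  by apply: (measurableT_comp m2); exact: measurable_snd.
rewrite pair_bigA -sumEFin; apply: eq_bigr => -[i j] _ /=.
rewrite [RHS]EFinM; congr (_ * _)%E; rewrite EFinM -!cell_massE//.
rewrite -integral_prod_split; [|exact: nneg_mfun_cell|exact: nneg_mfun_cell].
by apply: eq_integral => z _; rewrite /k EFinM muleACA.
Qed.

Let density_marg1 A : measurable A ->
  density (nu \x nu')%E Kn (A `*` setT) = nu A.
Proof.
move=> mA; rewrite density_rect// -(cell_mass_sum nu mA); congr EFin.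
apply: eq_bigr => i _.
under eq_bigr do rewrite cell_mass_setT mulrCA; rewrite -mulr_sumr.
have [pi0|pi_neq0] := eqVneq (p i) 0; last by rewrite Mrow// mulr1.
by rewrite cell_mass_eq0// mul0r.
Qed.

Let density_marg2 A : measurable A ->
  density (nu \x nu')%E Kn (setT `*` A) = nu' A.
Proof.
move=> mA; rewrite density_rect// -(cell_mass_sum nu' mA); congr EFin.
rewrite exchange_big/=; apply: eq_bigr => j _.
under eq_bigr do rewrite cell_mass_setT mulrA mulrC; rewrite -mulr_sumr.
have [qj0|qj_neq0] := eqVneq (q j) 0; last by rewrite Mcol// mulr1.
by rewrite cell_mass_eq0// mul0r.
Qed.

Variables (S : set R) (eps D : R).
Hypotheses (mS : measurable S) (nuS : nu S = 1%E) (nuS' : nu' S = 1%E).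
Hypotheses (eps0 : 0 <= eps) (D0 : 0 <= D).
Hypothesis diam : forall x y, S x -> S y -> `|x - y| <= D.
Hypothesis part_diam : forall i x y, S x -> S y -> h i x != 0 -> h i y != 0 ->
  `|x - y| <= eps.

Let ae_S : {ae (nu \x nu')%E, forall z, S z.1 /\ S z.2}.
Proof.
exists (~` (S `*` S)); split.
- by apply: measurableC; exact: measurableX.
- rewrite probability_setC; last exact: measurableX.
  transitivity (1 - 1 : \bar R)%E; last by rewrite subee.
  congr (1 - _)%E; transitivity (nu S * nu' S)%E; first exact: product_measure1E.
  by rewrite nuS nuS' mule1.
- by [].
Qed.

Let cost u : (\int[nu \x nu']_z ((k u z)%:E * `|z.1 - z.2|%:E) <=
  ((if u.2 == u.1 then eps else D) * (p u.1 * q u.2))%:E)%E.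
Proof.
have Du : 0 <= if u.2 == u.1 then eps else D by case: ifP.
have [md d0] := nneg_mfun_dist R.
have mku : measurable_fun setT (EFin \o k u) by exact/measurable_EFinP.
apply: (@le_trans _ _ (\int[nu \x nu']_z
    ((if u.2 == u.1 then eps else D)%:E * (k u z)%:E))%E).
  apply: ae_ge0_le_integral => //.
  - by move=> z _; rewrite mule_ge0// lee_fin.
  - exact: emeasurable_funM.
  - by move=> z _; rewrite mule_ge0// lee_fin.
  - exact: emeasurable_funM.
  - apply: filterS ae_S => z [S1 S2] _; rewrite -!EFinM lee_fin mulrC.
    have [kz0|kz_neq0] := eqVneq (k u z) 0; first by rewrite kz0 !mulr0.
    rewrite ler_wpM2r//; case: eqP => u12; last exact: diam.
    move: kz_neq0; rewrite /k mulf_eq0 negb_or u12 => /andP[]; exact: part_diam.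
rewrite ge0_integralZl_EFin//; last by move=> z _; rewrite lee_fin.
rewrite EFinM lee_wpmul2l// ?lee_fin//.
have -> : (p u.1 * q u.2)%:E =
  ((\int[nu]_x (h u.1 x)%:E) * (\int[nu']_x (h u.2 x)%:E))%E.
  by rewrite !part_massE.
by rewrite -integral_prod_split; [|exact: nneg_mfun_part|exact: nneg_mfun_part].
Qed.

(** If both laws live on $S$ and are cut into cells of diameter at most
    $\varepsilon$, moving mass only within cells costs at most $\varepsilon$;
    the mass that has to change cell is bounded by the total difference of the
    cell masses, and travels at most the diameter of $S$. *)
Lemma W1_partition_le :
  (W1 nu nu' <=
   (eps + D * \sum_i `|part_mass nu i - part_mass nu' i|)%:E)%E.
Proof.
(* a probability, since its first marginal is *)
have pi1 : density (nu \x nu')%E Kn setT = 1%E.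
  by rewrite -setXTT density_marg1// probability_setT.
pose pi := HB.pack_for (probability (R * R)%type R) (density (nu \x nu')%E Kn)
  (Measure_isProbability.Build _ _ _ (density (nu \x nu')%E Kn) pi1).
apply: (@le_trans _ _ (\int[pi]_z `|z.1 - z.2|%:E)%E).
  apply: ereal_inf_lbound; exists pi => //.
rewrite [leLHS](integral_density (nneg_mfun_dist R)) (integral_K (nneg_mfun_dist R)).
apply: (@le_trans _ _ (\sum_(u : 'I_N * 'I_N)
    (M u * ((if u.2 == u.1 then eps else D) * (p u.1 * q u.2)))%:E)%E).
  by apply: lee_sum => u _; rewrite [leRHS]EFinM lee_wpmul2l// lee_fin.
rewrite sumEFin lee_fin.
have -> : \sum_(u : 'I_N * 'I_N)
    M u * ((if u.2 == u.1 then eps else D) * (p u.1 * q u.2)) =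
    \sum_i \sum_j (if j == i then eps else D) * c i j.
  by rewrite pair_bigA/=; apply: eq_bigr => -[i j] _ /=; rewrite mulrCA Mpq.
have -> : \sum_i \sum_j (if j == i then eps else D) * c i j =
    eps * \sum_i c i i + D * \sum_i \sum_(j | j != i) c i j.
  rewrite !mulr_sumr -big_split/=; apply: eq_bigr => i _.
  rewrite (bigD1 i)//= eqxx; congr (_ + _); rewrite mulr_sumr.
  by apply: eq_bigr => j /negbTE ->.
rewrite lerD// ?ler_piMr//.
  rewrite -(part_mass_sum nu); apply: ler_sum => i _; exact: c_le_p.
rewrite ler_wpM2l//.
exact: maximal_coupling_offdiag (part_mass_sum nu) (part_mass_sum nu').
Qed.

End Gluing.

(** * Partitions of unity and convergence to zero in probability *)

Section PartitionOfUnity.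
Context (R : realType).

Definition clip (a b x : R) : R := Num.max a (Num.min b x).

Lemma clip_continuous a b : continuous (clip a b).
Proof.
move=> x; apply: continuous_max; first exact: cvg_cst.
by apply: continuous_min; [exact: cvg_cst | exact: cvg_id].
Qed.

Lemma clip_homo a b : {homo clip a b : x y / x <= y}.
Proof.
move=> x y xy; rewrite /clip ge_max le_max lexx/= le_max le_min !ge_min lexx xy.
by rewrite !orbT.
Qed.

(** Differences of consecutive ramps of slope $2/\varepsilon$, shifted by one
    mesh each, telescope to $1$ and vanish off two adjacent meshes.  The
    variable is first clipped to the interval, so that the sum is $1$ on the
    whole line. *)
Lemma partition_of_unity (ka kb eps : R) : 0 < eps ->
  exists (N : nat) (h : 'I_N -> R -> R),
  [/\ forall i, continuous (h i), forall i x, 0 <= h i x,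
      forall x, \sum_i h i x = 1 &
      forall i x y, ka <= x <= kb -> ka <= y <= kb ->
        h i x != 0 -> h i y != 0 -> `|x - y| <= eps].
Proof.
move=> eps0; pose dl := eps / 2; have dl0 : 0 < dl by rewrite divr_gt0.
pose u x := clip 0 (Num.max 0 (kb - ka)) (x - ka) / dl.
pose s (j : nat) x := clip 0 1 (u x - j%:R + 1).
have cu : continuous u.
  move=> x; apply: cvgM; last exact: cvg_cst.
  apply: (@continuous_comp _ _ _ (fun x => x - ka) (clip 0 (Num.max 0 (kb - ka)))).
    by apply: cvgB; [exact: cvg_id | exact: cvg_cst].
  exact: clip_continuous.
have cs j : continuous (s j).
  move=> x; apply: (@continuous_comp _ _ _ (fun x => u x - j%:R + 1) (clip 0 1)).
    by apply: cvgD; [apply: cvgB; [exact: cu | exact: cvg_cst] | exact: cvg_cst].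
  exact: clip_continuous.
have u0 x : 0 <= u x by rewrite divr_ge0 ?(ltW dl0)// /clip le_max lexx.
pose n := Num.bound (Num.max 0 (kb - ka) / dl).
have un x : u x <= n%:R.
  apply: (@le_trans _ _ (Num.max 0 (kb - ka) / dl)).
    rewrite ler_wpM2r// ?invr_ge0 ?(ltW dl0)// /clip ge_max le_max lexx/=.
    by rewrite ge_min lexx.
  by rewrite ltW// archi_boundP// divr_ge0 ?(ltW dl0)// le_max lexx.
exists n.+1, (fun j x => s j x - s j.+1 x); split.
- by move=> i x; apply: cvgB; exact: cs.
- move=> i x; rewrite subr_ge0; apply: clip_homo.
  by rewrite lerD2r lerB// ler_nat leqnSn.
- move=> x; rewrite -(big_mkord xpredT (fun j => s j x - s j.+1 x)).
  under eq_bigr do rewrite -opprB.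
  rewrite sumrN telescope_sumr// opprB /s /clip.
  have := u0 x; have := un x; rewrite -natr1; move: (u x) (n%:R : R) => a b h1 h2.
  rewrite subr0 (min_idPl _); last by lra.
  rewrite (max_idPr _) ?ler01// (min_idPr _); last by lra.
  by rewrite (max_idPl _) ?subr0//; lra.
- move=> i x y xK yK hx hy.
  have uE z : ka <= z <= kb -> u z * dl = z - ka.
    move=> /andP[az zb]; rewrite /u divfK ?gt_eqF// /clip.
    rewrite (max_idPr (_ : 0 <= kb - ka)); last by lra.
    by rewrite (min_idPr _) ?(max_idPr _)//; lra.
  have bnd z : s i z - s i.+1 z != 0 -> i%:R - 1 <= u z <= i%:R + 1.
    rewrite /s /clip -natr1; move: (u z) (i%:R : R) => a b.
    apply: contraNT; rewrite negb_and -!ltNge => /orP[ab|ab].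
      rewrite (min_idPr _); last by lra.
      rewrite (max_idPl _); last by lra.
      rewrite (min_idPr _); last by lra.
      by rewrite (max_idPl _) ?subrr//; lra.
    rewrite (min_idPl _); last by lra.
    by rewrite (min_idPl _) ?subrr//; lra.
  have /andP[x1 x2] := bnd _ hx; have /andP[y1 y2] := bnd _ hy.
  have -> : x - y = (u x - u y) * dl by rewrite mulrBl !uE//; lra.
  have u2 : `|u x - u y| <= 2 by rewrite ler_distl; apply/andP; split; lra.
  rewrite normrM (gtr0_norm dl0) (le_trans (ler_wpM2r (ltW dl0) u2))//.
  by rewrite /dl; lra.
Qed.

End PartitionOfUnity.

Section ConvergenceInProbability.
Context (R : realType) (d : nat -> measure_display)
  (Om : forall n, measurableType (d n)) (P : forall n, probability (Om n) R).

(** Measurability is part of the notion: without it the probabilities of the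
    deviations carry no information. *)
Definition null_in_prob (Z : forall n, Om n -> R) : Prop :=
  (forall n, measurable_fun setT (Z n)) /\ cvg_in_prob P Z 0.

Let meas_ge n (Z : Om n -> R) (e : R) : measurable_fun setT Z ->
  measurable [set w | e <= `|Z w|].
Proof.
move=> mZ; have -> : [set w | e <= `|Z w|] =
    (fun w => `|Z w|) @^-1` `[e, +oo[%classic.
  by apply/seteqP; split => w /=; rewrite in_itv/= andbT.
rewrite -[X in measurable X]setTI.
by apply: (measurableT_comp (@normr_measurable R setT) mZ) => //.
Qed.

Let null_cvg (Z : forall n, Om n -> R) (e : R) : null_in_prob Z -> 0 < e ->
  (fun n => P n [set w | e <= `|Z n w|]) @ \oo --> 0%E.
Proof. 
move=> [_ Z0] e0; have := Z0 e e0.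
by under eq_fun do under eq_set do rewrite subr0.
Qed.

(** Convergence in probability to $0$ only requires, at each scale, a bound by
    a sequence that is known to vanish. *)
Lemma null_in_prob_le (Z : forall n, Om n -> R) :
  (forall n, measurable_fun setT (Z n)) ->
  (forall e : R, 0 < e -> exists2 Y, null_in_prob Y &
     exists2 e' : R, 0 < e' & forall n w, e <= `|Z n w| -> e' <= `|Y n w|) ->
  null_in_prob Z.
Proof.
move=> mZ H; split => // e e0; have [Y nY [e' e'0 ZY]] := H e e0.
have := null_cvg nY e'0; apply: (@squeeze_cvge _ _ _ _ (cst 0%E)); last exact: cvg_cst.
apply: nearW => n; apply/andP; split; first exact: measure_ge0.
apply: le_measure; rewrite ?inE.
- by under eq_set do rewrite subr0; exact: meas_ge.
- by apply: meas_ge; have [] := nY.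
- by move=> w /=; rewrite subr0 => /ZY.
Qed.

Lemma null_in_probD (Y Z : forall n, Om n -> R) :
  null_in_prob Y -> null_in_prob Z -> null_in_prob (fun n w => Y n w + Z n w).
Proof.
move=> nY nZ; have [mY _] := nY; have [mZ _] := nZ.
split => [n|e e0]; first exact: measurable_funD.
have e20 : 0 < e / 2 by rewrite divr_gt0.
have := cvgeD (a := 0%E) (b := 0%E) isT (null_cvg nY e20) (null_cvg nZ e20).
rewrite adde0 => /(_ eventually_filter) YZ0.
apply: (@squeeze_cvge _ _ _ _ (cst 0%E) _ _ _ 0%E (cvg_cst _) YZ0).
apply: nearW => n; apply/andP; split; first exact: measure_ge0.
apply: (@le_trans _ _ (P n ([set w | e / 2 <= `|Y n w|] `|`
    [set w | e / 2 <= `|Z n w|]))); last first.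
  by apply: measureU2; exact: meas_ge.
apply: le_measure; rewrite ?inE.
- by under eq_set do rewrite subr0; apply: meas_ge; exact: measurable_funD.
- by apply: measurableU; exact: meas_ge.
- move=> w /=; rewrite subr0 => YZ; apply/orP; rewrite -implyNb -ltNge.
  apply/implyP => Ylt; have := le_trans YZ (ler_normD _ _); lra.
Qed.

Lemma null_in_probZ (c : R) (Z : forall n, Om n -> R) :
  null_in_prob Z -> null_in_prob (fun n w => c * `|Z n w|).
Proof.
move=> nZ; have [mZ _] := nZ; apply: null_in_prob_le => [n|e e0].
  apply: measurable_funM; first exact: measurable_cst.
  exact: measurableT_comp.
exists Z => //; exists (e / (`|c| + 1)); first by rewrite divr_gt0// ltr_wpDl.
move=> n w; rewrite normrM normr_id ler_pdivrMr ?ltr_wpDl// => /le_trans; apply.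
by rewrite mulrC ler_wpM2l// lerDl.
Qed.

Lemma null_in_prob0 : null_in_prob (fun n w => 0).
Proof.
split => [n|e e0]; first exact: measurable_cst.
rewrite (_ : (fun _ => _) = cst 0%E); first exact: cvg_cst.
apply/funext => n; rewrite (_ : [set _ | _] = set0) ?measure0//.
by apply/seteqP; split => w //=; rewrite subrr normr0 leNgt e0.
Qed.

Lemma null_in_prob_sum (I : Type) (s : seq I) (Z : I -> forall n, Om n -> R) :
  (forall i, null_in_prob (Z i)) ->
  null_in_prob (fun n w => \sum_(i <- s) Z i n w).
Proof.
move=> nZ; elim: s => [|i s IH].
  have -> : (fun (n : nat) (w : Om n) => \sum_(i <- [::]) Z i n w) = (fun n w => 0).
    by apply/functional_extensionality_dep => n; apply/funext => w; rewrite big_nil.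
  exact: null_in_prob0.
have -> : (fun (n : nat) (w : Om n) => \sum_(j <- i :: s) Z j n w) =
    (fun n w => Z i n w + \sum_(j <- s) Z j n w).
  by apply/functional_extensionality_dep => n; apply/funext => w; rewrite big_cons.
exact: null_in_probD.
Qed.

Lemma null_in_prob_shift (Z : forall n, Om n -> R) (z : R) :
  (forall n, measurable_fun setT (Z n)) -> cvg_in_prob P Z z ->
  null_in_prob (fun n w => Z n w - z).
Proof.
move=> mZ Zz; split => [n|e e0]; first by apply: measurable_funB.
by have := Zz e e0; under eq_fun do under eq_set do rewrite -[_ - z]subr0.
Qed.

End ConvergenceInProbability.

(** * Subtrees of the children of the root *)

Section Offspring.
Context (R : realType) (T : polishType R).
Context {d : measure_display} {Om : measurableType d}.
Variables (P : probability Om R) (G : Om -> network T (seq nat)).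
Hypothesis hG : random_network G.
Variable kappa : R.-pker (borel T) ~> (borel (rooted_space T)).
Hypothesis hbranch : branching P G kappa.

Let child (i : nat) : seq nat := [:: i].
Let tau v w : borel T := vtype (G w) v.

(** In Ulam-Harris coding, a root with $m$ children has exactly the children
    $0, \dots, m - 1$. *)
Definition offspring_eq (m : nat) : set Om :=
  [set w | forall i : nat, arc (G w) [::] [:: i] = (i < m)%N].

Lemma measurable_offspring_eq m : measurable (offspring_eq m).
Proof.
have [marc _ _ _ _] := hG.
have -> : offspring_eq m = \bigcap_i
    (if (i < m)%N then [set w | arc (G w) [::] [:: i]]
     else ~` [set w | arc (G w) [::] [:: i]]).
  apply/seteqP; split => [w H i _|w H i].
    by have := H i; case: ifP => _ /= ->.
  by have := H i I; case: ifP => _ //= /negP/negbTE.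
apply: bigcapT_measurable => i; case: ifP => _; first exact: marc.
by apply: measurableC; exact: marc.
Qed.

Lemma trivIset_offspring_eq : trivIset setT offspring_eq.
Proof.
apply/trivIsetP => i j _ _ ij; apply/seteqP; split => // w [/= wi wj].
wlog ltij : i j ij wi wj / (i < j)%N.
  move=> H; move: (ij); rewrite neq_ltn => /orP[]; first exact: H.
  by apply: H; rewrite // eq_sym.
by have := wi i; rewrite wj ltij ltnn.
Qed.

Lemma tree_offspring w : tree (G w) -> exists m, offspring_eq m w.
Proof.
move=> /(_ [::]) []; first by exists 0, [::].
move=> m H; exists m => i; apply/idP/idP.
  by move=> /H[j jm [->]].
by move=> im; apply/H; exists i.
Qed.

(** The generator of [family_info] at the root: named, it makes the smaller
    sigma-algebra a measurable space of its own, on which measurability and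
    approximation by simple functions make sense. *)
Let gen : set (set Om) := [set E |
    (exists2 S : set (borel T), measurable S &
      E = [set w | S (vtype (G w) [::])]) \/
    (exists (i : nat) (S : set (borel T)) (D : set R),
      [/\ measurable S, measurable D &
       E = [set w | [/\ arc (G w) [::] [:: i],
                        S (vtype (G w) [:: i]) &
                        D (emark (G w) [::] [:: i])]]])].
Let Y := g_sigma_algebraType gen.

Let gen_measurable : gen `<=` @measurable _ Om.
Proof.
have [marc mt _ _ me] := hG.
move=> _ [[S mS ->]|[i [S [D [mS mD ->]]]]].
  exact: measurable_preimage (mt [::]) mS.
have -> : [set w | [/\ arc (G w) [::] [:: i], S (vtype (G w) [:: i]) &
      D (emark (G w) [::] [:: i])]] =
    ([set w | arc (G w) [::] [:: i]] `&`
     (fun w => emark (G w) [::] [:: i]) @^-1` D) `&`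
    [set w | S (vtype (G w) [:: i])].
  by apply/seteqP; split => [w []|w [[]]].
apply: measurableI; last exact: measurable_preimage (mt [:: i]) mS.
by apply: me => //; exact: marc.
Qed.

Let info_measurable (E : set Y) : measurable E -> @measurable _ Om E.
Proof.
by apply: smallest_sub; [exact: sigma_algebra_measurable|exact: gen_measurable].
Qed.

Let measurable_info d' (Z : measurableType d') (h : Y -> Z) :
  measurable_fun setT h -> measurable_fun setT (h : Om -> Z).
Proof.
by move=> mh _ A mA; apply: info_measurable; apply: mh.
Qed.

Let info_arc i : measurable ([set w | arc (G w) [::] [:: i]] : set Y).
Proof.
apply: sub_sigma_algebra; right; exists i, setT, setT; split => //.
by apply/seteqP; split => w //= [].
Qed.

Let info_emark i : measurable_fun setT
  ((fun w => if arc (G w) [::] [:: i] then emark (G w) [::] [:: i] else 0) : Y -> R).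
Proof.
have -> : (fun w => if arc (G w) [::] [:: i] then emark (G w) [::] [:: i] else 0) =
    (fun w => emark (G w) [::] [:: i]) \_ [set w | arc (G w) [::] [:: i]].
  by apply/funext => w; rewrite patchE mem_setE.
apply/(measurable_restrictT _ (info_arc i)) => _ A mA.
apply: sub_sigma_algebra; right; exists i, setT, A; split => //.
by apply/seteqP; split => w //= [].
Qed.

Let info_type S : measurable S -> measurable ([set w | S (tau [::] w)] : set Y).
Proof. by move=> mS; apply: sub_sigma_algebra; left; exists S. Qed.

Variable phi : rooted_space T -> R.
Hypothesis mphi : measurable_fun setT (phi : borel (rooted_space T) -> R).
Variable M : R.
Hypotheses (phi0 : forall x, 0 <= phi x) (phiM : forall x, phi x <= M).
Let zeta i w := phi (rooted_class (G w) [:: i]).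
Hypothesis mzeta : forall u, measurable_fun setT (fun w => phi (rooted_class (G w) u)).

(** A real number, because $\varphi$ is bounded and the kernel is Markov. *)
Definition cond_mean (t : borel T) : R := fine (\int[kappa t]_x (phi x)%:E)%E.

Let nneg_mfun_phi : nneg_mfun (EFin \o phi : borel (rooted_space T) -> \bar R).
Proof. exact: nneg_mfun_EFin. Qed.

Lemma cond_meanE t : (\int[kappa t]_x (phi x)%:E = (cond_mean t)%:E)%E.
Proof.
rewrite fineK// ge0_fin_numE; last by apply: integral_ge0 => x _; rewrite lee_fin.
apply: (@le_lt_trans _ _ (\int[kappa t]_x (M%:E : \bar R))%E); last first.
  by rewrite integral_cst// prob_kernel mule1 ltry.
have [m1 p1] := nneg_mfun_phi.
by apply: ge0_le_integral => // x _; rewrite lee_fin ?phi0 ?phiM.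
Qed.

Lemma cond_mean_ge0 t : 0 <= cond_mean t.
Proof. by apply: fine_ge0; apply: integral_ge0 => x _; rewrite lee_fin. Qed.

Lemma measurable_kernel_integral (u : borel (rooted_space T) -> \bar R) :
  nneg_mfun u -> measurable_fun setT (fun t => \int[kappa t]_x u x)%E.
Proof.
move=> [mu u0]; apply: measurable_fun_integral_kernel => // U mU.
exact: measurable_kernel.
Qed.

Lemma measurable_cond_mean : measurable_fun setT cond_mean.
Proof.
apply/measurable_EFinP.
have -> : EFin \o cond_mean = fun t => (\int[kappa t]_x (phi x)%:E)%E.
  by apply/funext => t; rewrite /= cond_meanE.
exact: measurable_kernel_integral nneg_mfun_phi.
Qed.

(** Leaving all other subtrees unconstrained turns their factors into $1$. *)
Let branch_child m (i : 'I_m) (A : set (borel (rooted_space T))) (E : set Om) :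
  measurable A -> family_info G [::] E ->
  P ((E `&` offspring_eq m) `&` [set w | A (rooted_class (G w) [:: i : nat])]) =
  (\int[P]_(w in E `&` offspring_eq m) kappa (tau [:: i : nat] w) A)%E.
Proof.
move=> mA hE.
have := hbranch (A := fun j : 'I_m => if j == i then A else setT) _ hE.
have -> : [set w | [/\ E w, reachable (G w) [::] [::] &
    forall i : nat, arc (G w) [::] (rcons [::] i) = (i < m)%N]] =
    E `&` offspring_eq m.
  by apply/seteqP; split => [w []|w []] // Ew wm; split => //; exists 0, [::].
rewrite /= => H; rewrite (_ : [set w | A _] = [set w | forall j : 'I_m,
    (if j == i then A else setT) (rooted_class (G w) [:: j : nat])]).
  rewrite H => [|j]; last by case: ifP.
  apply: eq_integral => w _; rewrite (bigD1 i)//= eqxx big1 => [|j /negbTE ->].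
    rewrite mulr1 fineK// ge0_fin_numE//; apply: (@le_lt_trans _ _ 1%E).
      have <- : kappa (tau [:: i : nat] w) setT = 1%E by exact: prob_kernel.
      by apply: le_measure; rewrite ?inE.
    by rewrite ltry.
  by rewrite prob_kernel.
apply/seteqP; split => [w wA j|w /(_ i)]; last by rewrite eqxx.
by case: ifP => // /eqP ->.
Qed.


Let mtau v : measurable_fun setT (tau v : Om -> borel T).
Proof. by have [_ mt _ _ _] := hG; exact: mt. Qed.

Let info_measurable' (E : set Om) : family_info G [::] E -> measurable E.
Proof. exact: info_measurable. Qed.

(** The subtree of a child enters only through the value of $\varphi$, which
    is a random variable even where the class of the subtree is not known to
    be one; the branching property is applied to its level sets. *)
Let branch_phi m (i : 'I_m) (E : set Om) : family_info G [::] E ->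
  (\int[P]_(w in E `&` offspring_eq m) (zeta i w)%:E =
   \int[P]_(w in E `&` offspring_eq m) (cond_mean (tau [:: i : nat] w))%:E)%E.
Proof.
move=> hE; set D := E `&` _.
have mD : measurable D.
  by apply: measurableI; [exact: info_measurable'|exact: measurable_offspring_eq].
pose L1 (u : R -> \bar R) := (\int[P]_(w in D) u (zeta i w))%E.
pose L2 (u : R -> \bar R) :=
  (\int[P]_(w in D) \int[kappa (tau [:: i : nat] w)]_x u (phi x))%E.
have p1 : positive_functional L1.
  apply: (pfun_integral P (K := fun w u => u (zeta i w))) => //.
    by move=> w; exact: pfun_eval.
  by move=> u [mu _]; exact: measurableT_comp mu (mzeta _).
have p2 : positive_functional L2.
  apply: (pfun_integral P
    (K := fun w u => \int[kappa (tau [:: i : nat] w)]_x u (phi x))%E) => //.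
    move=> w; apply: (pfun_integral (kappa (tau [:: i : nat] w)) (K := fun x u => u (phi x))) => //.
      by move=> x; exact: pfun_eval.
    by move=> u [mu _]; exact: measurableT_comp.
  move=> u un; apply: (@measurableT_comp _ _ _ _ _ _
    (fun t => \int[kappa t]_x u (phi x))%E) => //.
  by apply: measurable_kernel_integral; exact: (nneg_mfun_comp mphi un).
pose pos := fun y : R => (Num.max 0 y)%:E.
have npos : nneg_mfun pos.
  split => [|y]; last by rewrite lee_fin le_max lexx.
  by apply/measurable_EFinP; apply: measurable_maxr.
have posE x : pos (phi x) = (phi x)%:E by rewrite /pos (max_idPr _).
transitivity (L1 pos); first by apply: eq_integral => w _; rewrite posE.
transitivity (L2 pos); last first.
  apply: eq_integral => w _; rewrite -cond_meanE.
  by apply: eq_integral => x _; rewrite posE.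
apply: pfun_unique => // C mC.
have mphiC : measurable (phi @^-1` C : set (borel (rooted_space T))).
  by rewrite -[X in measurable X]setTI; exact: mphi.
transitivity (P (D `&` [set w | (phi @^-1` C) (rooted_class (G w) [:: i : nat])])).
  rewrite /L1 (_ : D `&` _ = (zeta i @^-1` C) `&` D); last by rewrite setIC.
  rewrite -integral_indic//; last by rewrite -[X in measurable X]setTI; exact: mzeta.
rewrite branch_child//; apply: eq_integral => w _.
by rewrite -[RHS]/(\int[kappa _]_x (\1_(phi @^-1` C) x)%:E)%E integral_indic// setIT.
Qed.

(** Extension from the events of the family to its random variables. *)
Let branch_info m (i : 'I_m) (h : Y -> \bar R) : nneg_mfun h ->
  (\int[P]_(w in offspring_eq m) ((zeta i w)%:E * h w) =
   \int[P]_(w in offspring_eq m) ((cond_mean (tau [:: i : nat] w))%:E * h w))%E.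
Proof.
move=> hn.
have pf (a : Om -> R) : measurable_fun setT a -> (forall w, 0 <= a w) ->
    positive_functional (fun u : Y -> \bar R =>
      \int[P]_(w in offspring_eq m) ((a w)%:E * u w))%E.
  move=> ma a0; apply: (pfun_integral P (K := fun w (u : Y -> \bar R) => (a w)%:E * u w)%E).
  - exact: measurable_offspring_eq.
  - by move=> w; exact: (@pfun_scaled_eval R _ Y).
  - move=> u [mu _]; apply: emeasurable_funM; first exact/measurable_EFinP.
    exact: measurable_info.
apply: (@pfun_unique R _ _ (fun u : Y -> \bar R =>
    \int[P]_(w in offspring_eq m) ((zeta i w)%:E * u w))%E
  (fun u : Y -> \bar R => \int[P]_(w in offspring_eq m)
    ((cond_mean (tau [:: i : nat] w))%:E * u w))%E _ _ _ h hn).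
- by apply: (pf (zeta i)) => [|w]; [exact: mzeta | exact: phi0].
- apply: (pf (fun w => cond_mean (tau [:: i : nat] w))).
    exact: measurableT_comp measurable_cond_mean (mtau _).
  by move=> w; exact: cond_mean_ge0.
- move=> E mE; have restrict (a : Om -> R) :
      (\int[P]_(w in offspring_eq m) ((a w)%:E * (EFin \o \1_E) w) =
       \int[P]_(w in E `&` offspring_eq m) (a w)%:E)%E.
    rewrite setIC integral_mkcondr; apply: eq_integral => w _.
    by rewrite patchE /= indicE; case: (w \in E); rewrite ?mule1 ?mule0.
  by rewrite (restrict (zeta i)) (restrict (fun w => cond_mean (tau [:: i : nat] w))) branch_phi.
Qed.

Lemma offspring_sum m w (F : seq nat -> R) : offspring_eq m w ->
  tree (G w) ->
  \sum_(u \in out (G w) [::]) F u = \sum_(i < m) F [:: i : nat].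
Proof.
move=> wm tw; have outE : out (G w) [::] = child @` `I_m.
  have [|m' H] := tw [::]; first by exists 0, [::].
  apply/seteqP; split => [u /= ou|_ [i im <-]]; last by rewrite /out /= wm.
  have [i im' uE] := (H u).1 ou; exists i => //.
  by rewrite /= -wm; move: ou; rewrite uE.
rewrite outE (fsbig_image _ child) => [|i j _ _ []//].
by rewrite (fsbig_ord _ _ (fun i => F (child i))).
Qed.

(** On the event of $m$ children this is the weight of child $i$, cut to a set
    of root types, but written so that it is visibly a function of the types and
    exposures of the family.  The power with exponent $-1$ is an inverse. *)
Let info_weight m (S : set (borel T)) i (w : Y) : R :=
  \1_[set w | S (tau [::] w)] w *
  ((if arc (G w) [::] [:: i] then emark (G w) [::] [:: i] else 0) *
   (\sum_(j < m) if arc (G w) [::] [:: j : nat] then emark (G w) [::] [:: j : nat]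
                 else 0) `^ (-1)).

Let nneg_mfun_info_weight m S i : measurable S ->
  nneg_mfun (fun w : Y => (info_weight m S i w)%:E).
Proof.
move=> mS; split => [|w]; last first.
  rewrite lee_fin mulr_ge0//; apply: mulr_ge0; last exact: powR_ge0.
  by case: ifPn => // wi; rewrite ltW// emark_gt0.
apply/measurable_EFinP; apply: measurable_funM.
  by apply: measurable_indic; exact: info_type.
apply: measurable_funM => //.
apply: (@measurableT_comp _ _ _ _ _ _ (@powR R ^~ (-1))) => //.
by apply: measurable_sum => j; exact: info_emark.
Qed.

Let info_weightE m (S : set (borel T)) w (i : 'I_m) :
  offspring_eq m w -> tree (G w) ->
  S (tau [::] w) -> info_weight m S i w = weight (G w) [::] [:: i : nat].
Proof.
move=> wm tw Sw; rewrite /info_weight indicE mem_set//= mul1r /weight.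
have arci (j : 'I_m) : arc (G w) [::] [:: j : nat] by rewrite wm.
rewrite arci; congr (_ * _); rewrite powR_inv1; last first.
  by apply: sumr_ge0 => j _; rewrite arci ltW// emark_gt0.
congr (_^-1); rewrite (offspring_sum _ wm tw).
by apply: eq_bigr => j _; rewrite arci.
Qed.

Let family_integral m (S : set (borel T)) (A : seq nat -> Om -> R) :
  measurable S -> {ae P, forall w, tree (G w)} ->
  (forall u, measurable_fun setT (A u)) -> (forall u w, 0 <= A u w) ->
  (\int[P]_(w in offspring_eq m `&` [set w | S (tau [::] w)])
     (\sum_(u \in out (G w) [::]) weight (G w) [::] u * A u w)%:E =
   \sum_(i < m) \int[P]_(w in offspring_eq m)
     ((A [:: i : nat] w)%:E * (info_weight m S i w)%:E))%E.
Proof.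
move=> mS treeG mA A0.
have mD : measurable [set w | S (tau [::] w)] by exact: measurable_preimage (mtau _) mS.
have mh (i : 'I_m) : measurable_fun setT
    (fun w : Om => (A [:: i : nat] w)%:E * (info_weight m S i w)%:E)%E.
  apply: emeasurable_funM; first exact/measurable_EFinP.
  by apply: measurable_info; have [] := nneg_mfun_info_weight m i mS.
have h0 (i : 'I_m) w : (0 <= (A [:: i : nat] w)%:E * (info_weight m S i w)%:E)%E.
  apply: mule_ge0; first by rewrite lee_fin.
  by have [_ h] := nneg_mfun_info_weight m i mS; exact: h.
have msum : measurable_fun setT (fun w =>
    \sum_(u \in out (G w) [::]) weight (G w) [::] u * A u w).
  apply: measurable_out_sum => u; apply: (measurable_arc hG).
  apply: measurable_funS (measurable_funM (measurable_weight hG [::] u) (mA u)) => //.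
have sum0 w : 0 <= \sum_(u \in out (G w) [::]) weight (G w) [::] u * A u w.
  by apply: fsumr_ge0 => u _; rewrite mulr_ge0// weight_ge0.
rewrite -ge0_integral_sum//; last 2 first.
- exact: measurable_offspring_eq.
- by move=> i; apply: measurable_funTS.
rewrite integral_mkcondr; apply: ge0_ae_eq_integral.
- exact: measurable_offspring_eq.
- apply/(measurable_restrict _ mD); first exact: measurable_offspring_eq.
  by apply: measurable_funTS; exact/measurable_EFinP.
- by apply: measurable_funTS; apply: emeasurable_sum.
- by move=> w _; rewrite patchE; case: ifP => // _; rewrite lee_fin sum0.
- by move=> w _; apply: sume_ge0.
- apply: filterS treeG => w tw wm; rewrite patchE; case: ifPn.
    rewrite inE /= => Sw; rewrite (offspring_sum _ wm tw) -sumEFin.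
    by apply: eq_bigr => i _; rewrite (info_weightE i wm tw Sw) mulrC EFinM.
  rewrite notin_setE /= => nSw; rewrite big1// => i _.
  by rewrite /info_weight indicE memNset//= mul0r mule0.
Qed.

Let integral_families (f : Om -> R) (S : set (borel T)) :
  measurable S -> {ae P, forall w, tree (G w)} ->
  measurable_fun setT f -> (forall w, 0 <= f w) ->
  (\int[P]_(w in [set w | S (tau [::] w)]) (f w)%:E =
   \sum_(m <oo) \int[P]_(w in offspring_eq m `&` [set w | S (tau [::] w)]) (f w)%:E)%E.
Proof.
move=> mS treeG mf f0.
have mD : measurable [set w | S (tau [::] w)] by exact: measurable_preimage (mtau _) mS.
have mO m := measurable_offspring_eq m.
pose N := ~` \bigcup_m offspring_eq m.
have mN : measurable N by apply: measurableC; exact: bigcupT_measurable.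
have N0 : P N = 0%E.
  apply: (measure_negligible mN); apply: negligibleS treeG => w nw /= tw.
  by apply: nw; have [m wm] := tree_offspring tw; exists m.
rewrite (ge0_negligible_integral mN mD _ _ N0) => [||w _]; last by rewrite lee_fin.
  rewrite setDE setCK setI_bigcupr ge0_integral_bigcup//=.
  - by apply: eq_eseriesr => m _; rewrite setIC.
  - by move=> m; apply: measurableI.
  - by apply: measurable_funTS; exact/measurable_EFinP.
  - by move=> w _; rewrite lee_fin.
  - by apply: trivIset_setIl; exact: trivIset_offspring_eq.
by apply: measurable_funTS; exact/measurable_EFinP.
Qed.

(** Conditionally on the types of the children and their exposures, which
    determine the weights, the value of $\varphi$ on a child subtree averages
    to its conditional mean at the type of the child. *)
Lemma branching_mean (S : set (borel T)) : measurable S ->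
  {ae P, forall w, tree (G w)} ->
  (\int[P]_(w in [set w | S (tau [::] w)])
     (\sum_(u \in out (G w) [::]) weight (G w) [::] u * phi (rooted_class (G w) u))%:E =
   \int[P]_(w in [set w | S (tau [::] w)])
     (\sum_(u \in out (G w) [::]) weight (G w) [::] u * cond_mean (tau u w))%:E)%E.
Proof.
move=> mS treeG.
have mcm u : measurable_fun setT (fun w => cond_mean (tau u w)).
  exact: measurableT_comp measurable_cond_mean (mtau u).
have msum (A : seq nat -> Om -> R) : (forall u, measurable_fun setT (A u)) ->
    measurable_fun setT (fun w =>
    \sum_(u \in out (G w) [::]) weight (G w) [::] u * A u w).
  move=> mA; apply: measurable_out_sum => u; apply: (measurable_arc hG).
  apply: measurable_funS (measurable_funM (measurable_weight hG [::] u) (mA u)) => //.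
have sum0 (A : seq nat -> Om -> R) : (forall u w, 0 <= A u w) -> forall w,
    0 <= \sum_(u \in out (G w) [::]) weight (G w) [::] u * A u w.
  by move=> A0 w; apply: fsumr_ge0 => u _; rewrite mulr_ge0// weight_ge0.
pose A1 u w := phi (rooted_class (G w) u); pose A2 u w := cond_mean (tau u w).
have A10 u w : 0 <= A1 u w by exact: phi0.
have A20 u w : 0 <= A2 u w by exact: cond_mean_ge0.
rewrite (integral_families mS treeG (msum A1 mzeta) (sum0 A1 A10)).
rewrite (integral_families mS treeG (msum A2 mcm) (sum0 A2 A20)).
apply: eq_eseriesr => m _.
rewrite (family_integral m mS treeG mzeta A10) (family_integral m mS treeG mcm A20).
by apply: eq_bigr => i _; apply: (branch_info i); exact: nneg_mfun_info_weight.
Qed.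

End Offspring.

(** * The recursion for the expected gap *)

(** Where $b < a$, the assumed inequality forces equality of the integrals on
    every subset, hence $a = b$ almost everywhere there, which leaves a null
    set. *)
Lemma ae_le_integral (R : realType) d (X : measurableType d)
    (m : {measure set X -> \bar R}) (a : X -> \bar R) (b : X -> R) :
  nneg_mfun a -> m.-integrable setT (EFin \o b) -> (forall s, 0 <= b s) ->
  (forall S, measurable S ->
     (\int[m]_(s in S) a s <= \int[m]_(s in S) (b s)%:E)%E) ->
  {ae m, forall s, (a s <= (b s)%:E)%E}.
Proof.
move=> [ma a0] ib b0 ab.
have mb : measurable_fun setT (EFin \o b) by exact: measurable_int ib.
pose D := [set s | ((b s)%:E < a s)%E].
have mD : measurable D.
  by rewrite -[D]setTI; exact: (emeasurable_fun_lt measurableT mb ma).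
have eqab : ae_eq m D (EFin \o b) a.
  apply: integral_ae_eq => //.
  - exact: integrableS ib.
  - exact: measurable_funTS.
  - move=> E ED mE; apply/eqP; rewrite eq_le; apply/andP; split; last exact: ab.
    apply: ge0_le_integral => //.
    + by move=> s _; rewrite lee_fin.
    + exact: measurable_funTS.
    + exact: measurable_funTS.
    + by move=> s /ED; rewrite /D /=; exact: ltW.
have : m.-negligible D.
  apply: negligibleS eqab => s Ds /= H.
  by have := H Ds; move: Ds; rewrite /D /= => + e; rewrite e ltxx.
move=> nD; apply: negligibleS nD => s /= nab.
by rewrite /D /= ltNge; apply/negP.
Qed.

Section RootLaw.
Context (R : realType) (T : polishType R).
Context {d : measure_display} {Om : measurableType d}.
Variables (P : probability Om R) (G : Om -> network T (seq nat)).
Hypothesis hG : random_network G.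
Hypothesis hclass : measurable_fun setT
  (fun w => rooted_class (G w) [::] : borel (rooted_space T)).
Hypothesis treeG : {ae P, forall w, tree (G w)}.

Local Notation mu := (root_type_law P G).
Let tau v w : borel T := vtype (G w) v.

Let mtau v : measurable_fun setT (tau v : Om -> borel T).
Proof. by have [_ mt _ _ _] := hG; exact: mt. Qed.

Lemma integral_root_type (S : set (borel T)) (f : borel T -> \bar R) :
  measurable S -> nneg_mfun f ->
  (\int[mu]_(s in S) f s = \int[P]_(w in [set w | S (tau [::] w)]) f (tau [::] w))%E.
Proof.
move=> mS [mf f0]; rewrite integral_mkcond [RHS]integral_mkcond.
transitivity (\int[P]_w (f \_ S) (tau [::] w))%E.
  apply: integral_law; first exact: mtau.
  split => [|s]; last by rewrite patchE; case: ifP.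
  by apply/(measurable_restrictT _ mS); exact: measurable_funTS.
by apply: eq_integral => w _; rewrite !patchE; congr (if _ then _ else _).
Qed.

Lemma integral_cond_mean (kappa : R.-pker (borel T) ~> (borel (rooted_space T)))
    (phi : rooted_space T -> R) (M : R) (S : set (borel T)) :
  conditional_rooted_law P G kappa ->
  measurable_fun setT (phi : borel (rooted_space T) -> R) ->
  (forall x, 0 <= phi x) -> (forall x, phi x <= M) -> measurable S ->
  (\int[mu]_(s in S) (cond_mean kappa phi s)%:E =
   \int[P]_(w in [set w | S (tau [::] w)]) (phi (rooted_class (G w) [::]))%:E)%E.
Proof.
move=> hkappa mphi phi0 phiM mS.
have mD : measurable [set w | S (tau [::] w)] by exact: measurable_preimage (mtau _) mS.
pose xi w : borel (rooted_space T) := rooted_class (G w) [::].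
pose L1 (u : borel (rooted_space T) -> \bar R) :=
  (\int[P]_(w in [set w | S (tau [::] w)]) u (xi w))%E.
pose L2 (u : borel (rooted_space T) -> \bar R) :=
  (\int[mu]_(s in S) \int[kappa s]_x u x)%E.
have p1 : positive_functional L1.
  apply: (pfun_integral P (K := fun w u => u (xi w))) => //.
    by move=> w; exact: pfun_eval.
  by move=> u [mu' _]; exact: measurableT_comp mu' hclass.
have p2 : positive_functional L2.
  apply: (pfun_integral mu (K := fun s u => \int[kappa s]_x u x)%E) => //.
    move=> s; apply: (pfun_integral (kappa s) (K := fun x u => u x)) => //.
      by move=> x; exact: pfun_eval.
    by move=> u [].
  by move=> u un; exact: measurable_kernel_integral.
have nphi : nneg_mfun (EFin \o phi : borel (rooted_space T) -> \bar R).
  exact: nneg_mfun_EFin.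
transitivity (L2 (EFin \o phi)).
  by apply: eq_integral => s _; rewrite -(cond_meanE _ mphi phi0 phiM).
rewrite -[RHS]/(L1 (EFin \o phi)); apply/esym.
apply: (pfun_unique p1 p2) nphi => A mA; rewrite /L1 /L2 /=.
transitivity (P [set w | S (vtype (G w) [::]) /\ A (rooted_class (G w) [::])]).
  rewrite -[LHS]/(\int[P]_(w in _) (\1_(xi @^-1` A) w)%:E)%E integral_indic//.
    by congr (P _); apply/seteqP; split => w /= [].
  by rewrite -[X in measurable X]setTI; exact: hclass.
rewrite hkappa//; apply: eq_integral => s _.
by rewrite integral_indic// setIT.
Qed.

(** A series over all possible children avoids the random number of terms; the
    terms beyond the last child have weight $0$. *)
Lemma weight_child_series w (F : seq nat -> R) : tree (G w) ->
  (\sum_(i <oo) (weight (G w) [::] [:: i])%:E * (F [:: i])%:E =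
   (\sum_(u \in out (G w) [::]) weight (G w) [::] u * F u)%:E)%E.
Proof.
move=> tw; have [m wm] := tree_offspring tw.
rewrite (offspring_sum _ wm tw) -sumEFin.
apply: lim_near_cst => //; exists m => // n /= mn.
rewrite (big_cat_nat (n := m))//= [X in (_ + X)%E](_ : _ = 0)%E.
  by rewrite adde0 big_mkord; apply: eq_bigr => i _; rewrite EFinM.
rewrite big_nat_cond big1// => i /andP[/andP[mi _] _].
by rewrite /weight wm ltnNge mi/= mul0e.
Qed.

(** The family of $(\tau_u, W_{ou})$ over the children $u$ defines a random
    measure on types; averaging it given $\tau_o$ is what the kernel does. *)
Lemma integral_weight_kernel (Q : R.-ker (borel T) ~> (borel T))
    (g : borel T -> R) (S : set (borel T)) :
  weight_kernel P G Q -> measurable_fun setT g -> (forall t, 0 <= g t) ->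
  measurable S ->
  (\int[mu]_(s in S) \int[Q s]_t (g t)%:E =
   \int[P]_(w in [set w | S (tau [::] w)])
     (\sum_(u \in out (G w) [::]) weight (G w) [::] u * g (tau u w))%:E)%E.
Proof.
move=> hQ mg g0 mS.
have mD : measurable [set w | S (tau [::] w)] by exact: measurable_preimage (mtau _) mS.
pose K w (u : borel T -> \bar R) :=
  (\int[@counting nat R]_i ((weight (G w) [::] [:: i])%:E * u (tau [:: i] w)))%E.
have nW w (u : borel T -> \bar R) i : nneg_mfun u ->
    (0 <= (weight (G w) [::] [:: i])%:E * u (tau [:: i] w))%E.
  by move=> [_ u0]; rewrite mule_ge0// lee_fin weight_ge0.
have KE w u : nneg_mfun u -> K w u =
    (\sum_(i <oo) (weight (G w) [::] [:: i])%:E * u (tau [:: i] w))%E.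
  by move=> un; rewrite /K ge0_integral_count// => i; exact: nW.
have mK u : nneg_mfun u -> measurable_fun setT (K ^~ u).
  move=> un; have [mu' u0] := un.
  under eq_fun do rewrite KE//.
  apply: ge0_emeasurable_sum => [i w _ _|i _]; first exact: nW.
  apply: emeasurable_funM; first exact/measurable_EFinP/measurable_weight.
  exact: measurableT_comp mu' (mtau _).
pose L1 u := (\int[P]_(w in [set w | S (tau [::] w)]) K w u)%E.
pose L2 (u : borel T -> \bar R) := (\int[mu]_(s in S) \int[Q s]_t u t)%E.
have p1 : positive_functional L1.
  apply: (pfun_integral P (K := K)) => // w.
  apply: (pfun_integral (@counting nat R) (K := fun i (u : borel T -> \bar R) =>
    (weight (G w) [::] [:: i])%:E * u (tau [:: i] w))%E) => //.
  by move=> i; apply: pfun_scaled_eval; exact: weight_ge0.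
have p2 : positive_functional L2.
  apply: (pfun_integral mu (K := fun s u => \int[Q s]_x u x)%E) => //.
    move=> s; apply: (pfun_integral (Q s) (K := fun x u => u x)) => //.
      by move=> x; exact: pfun_eval.
    by move=> u [].
  move=> u [mu' u0]; apply: measurable_fun_integral_kernel => // U mU.
  exact: measurable_kernel.
have L1E (h : borel T -> R) : measurable_fun setT h -> (forall t, 0 <= h t) ->
    L1 (EFin \o h) = (\int[P]_(w in [set w | S (tau [::] w)])
     (\sum_(u \in out (G w) [::]) weight (G w) [::] u * h (tau u w))%:E)%E.
  move=> mh h0.
  have nh : nneg_mfun (EFin \o h : borel T -> \bar R).
    exact: nneg_mfun_EFin.
  apply: ge0_ae_eq_integral => //.
  - by apply: measurable_funTS; exact: mK.
  - apply: measurable_funTS; apply/measurable_EFinP.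
    apply: measurable_out_sum => u; apply: (measurable_arc hG).
    apply: measurable_funS (measurable_funM (measurable_weight hG [::] u) _) => //.
    exact: measurableT_comp mh (mtau u).
  - by move=> w _; rewrite KE//; apply: nneseries_ge0 => i _ _; exact: nW.
  - move=> w _; rewrite lee_fin; apply: fsumr_ge0 => u _.
    by rewrite mulr_ge0// weight_ge0.
  - apply: filterS treeG => w tw _; rewrite KE//.
    exact: (weight_child_series (fun u => h (tau u w)) tw).
have ng : nneg_mfun (EFin \o g : borel T -> \bar R).
  exact: nneg_mfun_EFin.
rewrite -L1E// -[LHS]/(L2 (EFin \o g)); apply/esym.
apply: (pfun_unique p1 p2) ng => A mA.
rewrite L1E; [|exact: measurable_indic|by move=> t; rewrite indicE].
transitivity (\int[mu]_(s in S) Q s A)%E; first exact: hQ.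
by apply: eq_integral => s _; rewrite integral_indic// setIT.
Qed.

End RootLaw.

Section GapRecursion.
Context (R : realType) (T : polishType R).
Context {d : measure_display} {Om : measurableType d}.
Variables (P : probability Om R) (G : Om -> network T (seq nat)).
Hypothesis hG : random_network G.
Hypothesis hclass : measurable_fun setT
  (fun w => rooted_class (G w) [::] : borel (rooted_space T)).
Hypothesis treeG : {ae P, forall w, tree (G w)}.
Variable Bs : R.
Hypothesis hBs : {ae P, forall w, forall v, reachable (G w) [::] v ->
  bsup (resp (G w) v) <= Bs}.
Variable f : T -> response R.
Hypothesis hf : {ae P, forall w, forall v, reachable (G w) [::] v ->
  resp (G w) v = f (vtype (G w) v)}.
Variable kappa : R.-pker (borel T) ~> (borel (rooted_space T)).
Hypothesis hkappa : conditional_rooted_law P G kappa.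
Hypothesis hbranch : branching P G kappa.
Variable B : borel T -> R.
Hypothesis hB : forall t, B t = bsup (f t).
Local Notation mu := (root_type_law P G).
Hypothesis hB_L1 : B \in Lfun mu 1.
Variable Q : R.-ker (borel T) ~> (borel T).
Hypothesis hQ : weight_kernel P G Q.
Hypothesis hTW : kernel_op_well_defined mu Q.

Let tau v w : borel T := vtype (G w) v.
Let mtau v : measurable_fun setT (tau v : Om -> borel T).
Proof. by have [_ mt _ _ _] := hG; exact: mt. Qed.

Let M := Num.max 0 Bs.

(** The cap is almost surely invisible, and makes the gap a bounded function on
    the whole space of classes. *)
Definition capped_gap k (x : rooted_space T) : R :=
  Num.min (Num.max 0 Bs) (class_iter true k x - class_iter false k x).
Let psi := capped_gap.

Let psiE k (V : countType) (g : network T V) o :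
  psi k (rooted_class g o) = Num.min M (gap g k o).
Proof. by rewrite /psi /capped_gap !class_iterE. Qed.

Lemma capped_gap_continuous k : continuous (capped_gap k).
Proof.
move=> x; apply: (@continuous_comp _ _ _
  (fun x => class_iter true k x - class_iter false k x) (Num.min (Num.max 0 Bs)) x).
  apply: (@cvgB _ _ _ (nbhs x)); exact: (@class_iter_continuous _ _ _ k x).
by apply: continuous_min; [exact: cvg_cst | exact: cvg_id].
Qed.

Lemma capped_gap_ge0 k x : 0 <= capped_gap k x.
Proof.
rewrite /capped_gap le_min le_max lexx/=.
by rewrite -(class_repK x) !class_iterE; exact: gap_ge0.
Qed.

Lemma capped_gap_le k x : capped_gap k x <= Num.max 0 Bs.
Proof. by rewrite ge_min lexx. Qed.

Lemma capped_gapE k (V : countType) (g : network T V) o :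
  bsup (resp g o) <= Bs -> capped_gap k (rooted_class g o) = gap g k o.
Proof.
move=> gB; rewrite [LHS]psiE (min_idPr _)// /M le_max.
by rewrite (le_trans (gap_le_bsup _ _ _) gB) orbT.
Qed.

Let mpsi k : measurable_fun setT (psi k : borel (rooted_space T) -> R).
Proof. by apply: continuous_borel; exact: capped_gap_continuous. Qed.

Let mpsi_class k u : measurable_fun setT (fun w => psi k (rooted_class (G w) u)).
Proof.
under eq_fun do rewrite psiE.
apply: measurable_minr; first exact: measurable_cst.
exact: measurable_gap.
Qed.

Let m k (t : borel T) : R := cond_mean kappa (psi k) t.

Let m0 k t : 0 <= m k t.
Proof. by apply: cond_mean_ge0; exact: capped_gap_ge0. Qed.

Let mm k : measurable_fun setT (m k).
Proof.
exact: (measurable_cond_mean kappa (mpsi k) (capped_gap_ge0 k) (capped_gap_le k)).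
Qed.

Let nm k : nneg_mfun (fun t => (m k t)%:E).
Proof. by split => [|t]; [exact/measurable_EFinP | rewrite lee_fin]. Qed.

Let integral_m k (S : set (borel T)) : measurable S ->
  (\int[mu]_(s in S) (m k s)%:E =
   \int[P]_(w in [set w | S (tau [::] w)]) (psi k (rooted_class (G w) [::]))%:E)%E.
Proof.
exact: (integral_cond_mean hG hclass hkappa (mpsi k) (capped_gap_ge0 k)
  (capped_gap_le k)).
Qed.

(** One step of the iteration, seen at the level of types: the gap of the root
    is at most the weighted average of the gaps of its children, and these have
    conditional means given by the root's own law at their types. *)
Let integral_mS k (S : set (borel T)) : measurable S ->
  (\int[mu]_(s in S) (m k.+1 s)%:E <=
   \int[mu]_(s in S) \int[Q s]_t (m k t)%:E)%E.
Proof.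
move=> mS; rewrite integral_m//.
rewrite (integral_weight_kernel hG treeG hQ (mm k) (m0 k) mS).
rewrite -(branching_mean hG hbranch (mpsi k) (capped_gap_ge0 k) (capped_gap_le k)
  (mpsi_class k) mS treeG).
have mD : measurable [set w | S (tau [::] w)] by exact: measurable_preimage (mtau _) mS.
apply: ae_ge0_le_integral => //.
- by move=> w _; rewrite lee_fin; exact: capped_gap_ge0.
- by apply: measurable_funTS; apply/measurable_EFinP; exact: mpsi_class.
- move=> w _; rewrite lee_fin; apply: fsumr_ge0 => u _.
  by rewrite mulr_ge0 ?weight_ge0 ?capped_gap_ge0.
- apply: measurable_funTS; apply/measurable_EFinP.
  apply: measurable_out_sum => u; apply: (measurable_arc hG).
  by apply: measurable_funS (measurable_funM (measurable_weight hG [::] u) (mpsi_class k u)).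
- apply: filterS hBs => w wB _; rewrite lee_fin [X in X <= _]psiE.
  apply: (@le_trans _ _ (gap (G w) k.+1 [::])); first by rewrite ge_min lexx orbT.
  apply: (le_trans (gapS_le _ _ _)); apply: ler_fsbig; first exact: arc_finite.
  move=> u ou; rewrite -[psi k _]/(capped_gap k _) capped_gapE//.
  apply: wB; exists 1%N.
  by exists [:: u]; split => //=; rewrite andbT.
Qed.

Let H k := iter k (kernel_op Q) B.

Let H_L1 k : H k \in Lfun mu 1.
Proof. by have [_ [HL _ _ _] _] := hTW; elim: k => //= k IH; exact: HL. Qed.

Let iH k : mu.-integrable setT (EFin \o H k).
Proof. by apply/Lfun1_integrable; exact: H_L1. Qed.

Let H0 k t : 0 <= H k t.
Proof.
elim: k t => [|k IH] t /=; first by rewrite /H /= hB bsup_ge0.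
by apply: fine_ge0; apply: integral_ge0 => s _; rewrite lee_fin IH.
Qed.

Let mH k : measurable_fun setT (H k).
Proof.
apply/measurable_EFinP; apply: measurable_int.
by apply/Lfun1_integrable; exact: H_L1.
Qed.

Let nH k : nneg_mfun (fun t => (H k t)%:E).
Proof.
split => [|t]; last by rewrite lee_fin; exact: H0.
by apply/measurable_EFinP; exact: mH.
Qed.

(** The kernel operator respects almost everywhere equality, and the indicator
    of a null set equals $0$ almost everywhere. *)
Let null_kernel (N : set (borel T)) : measurable N -> mu N = 0%E ->
  {ae mu, forall s, Q s N = 0%E}.
Proof.
move=> mN N0; have [Hint [_ Hae _ _] _] := hTW.
have iN : \1_N \in Lfun mu 1.
  by apply/Lfun1_integrable; exact: integrable_indic.
have i0 : (cst 0 : borel T -> R) \in Lfun mu 1 by exact: Lfun_cst.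
have N_ae : {ae mu, forall s, \1_N s = (cst 0 : borel T -> R) s}.
  exists N; split => // s /= nz; apply: contrapT => nN; apply: nz.
  by rewrite indicE memNset.
have QN s : (\int[Q s]_t (EFin \o \1_N) t)%E = Q s N.
  by rewrite integral_indic// setIT.
apply: filterS2 (Hae _ _ iN i0 N_ae) (Hint _ iN) => s.
rewrite /kernel_op /Rintegral [X in fine X](QN s) integral0 => Q0 is1.
by rewrite -[LHS]fineK ?Q0// -QN; exact: integrable_fin_num.
Qed.

(** The comparison at step $k$ holds off a null set of types, which almost no
    measure $Q(s, \cdot)$ charges. *)
Let m_le_H k : {ae mu, forall s, ((m k s)%:E <= (H k s)%:E)%E}.
Proof.
have [Hint _ _] := hTW.
elim: k => [|k IH].
  apply: (ae_le_integral (nm 0) (iH 0) (H0 0)) => S mS.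
  rewrite integral_m// (integral_root_type _ hG mS (nH 0)).
  have mD : measurable [set w | S (tau [::] w)] by exact: measurable_preimage (mtau _) mS.
  apply: ae_ge0_le_integral => //.
  - by move=> w _; rewrite lee_fin; exact: capped_gap_ge0.
  - by apply: measurable_funTS; apply/measurable_EFinP; exact: mpsi_class.
  - by move=> w _; rewrite lee_fin; exact: H0.
  - apply: measurable_funTS; apply/measurable_EFinP.
    exact: measurableT_comp (mH 0%N) (mtau _).
  - apply: filterS hf => w wf _; rewrite lee_fin [X in X <= _]psiE gap0 wf; last first.
      by exists 0%N, [::].
    by rewrite /H /= hB ge_min lexx orbT.
apply: (ae_le_integral (nm k.+1) (iH k.+1) (H0 k.+1)) => S mS.
apply: (le_trans (integral_mS k mS)).
have [N [mN N0 subN]] := IH.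
apply: ae_ge0_le_integral => //.
- by move=> s _; apply: integral_ge0 => t _; rewrite lee_fin.
- apply: measurable_funTS; have [mm1 mm2] := nm k.
  by apply: measurable_fun_integral_kernel => // U mU; exact: measurable_kernel.
- by move=> s _; rewrite lee_fin; exact: H0.
- by apply: measurable_funTS; apply/measurable_EFinP; exact: mH.
- apply: filterS2 (null_kernel mN N0) (Hint _ (H_L1 k)) => s sN iHs _.
  have -> : (H k.+1 s)%:E = (\int[Q s]_t (H k t)%:E)%E.
    by rewrite /H /= /kernel_op /Rintegral fineK//; apply: integrable_fin_num.
  apply: ae_ge0_le_integral => //.
  + by move=> t _; rewrite lee_fin.
  + by apply: measurable_funTS; have [] := nm k.
  + by move=> t _; rewrite lee_fin H0.
  + by apply: measurable_funTS; apply/measurable_EFinP; exact: mH.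
  + by exists N; split => // t /= nt; apply: subN => /= h; apply: nt.
Qed.

(** The expected gap after $k$ steps is governed by the $k$-th iterate of the
    type operator. *)
Lemma expected_gap_le k :
  (\int[P]_w (gap (G w) k [::])%:E <= (Gamma P G Q B k)%:E)%E.
Proof.
have -> : (\int[P]_w (gap (G w) k [::])%:E =
    \int[P]_w (psi k (rooted_class (G w) [::]))%:E)%E.
  apply: ge0_ae_eq_integral => //.
  - by apply/measurable_EFinP; exact: measurable_gap.
  - by apply/measurable_EFinP; exact: mpsi_class.
  - by move=> w _; rewrite lee_fin gap_ge0.
  - by move=> w _; rewrite lee_fin; exact: capped_gap_ge0.
  - apply: filterS hBs => w wB _; rewrite -[psi k _]/(capped_gap k _) capped_gapE//.
    by apply: wB; exists 0%N, [::].
have := integral_m k (measurableT : measurable (setT : set (borel T))).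
have -> : [set w | (setT : set (borel T)) (tau [::] w)] = setT by apply/seteqP.
move=> <-; rewrite /Gamma -/(H k).
have -> : (\int[mu]_s H k s)%:E = (\int[mu]_s (H k s)%:E)%E.
  rewrite /Rintegral fineK//; apply: integrable_fin_num => //.
  by apply/Lfun1_integrable; exact: H_L1.
apply: ae_ge0_le_integral => //.
- by move=> t _; rewrite lee_fin.
- by have [] := nm k.
- by move=> t _; rewrite lee_fin H0.
- by apply/measurable_EFinP; exact: mH.
- by apply: filterS (m_le_H k) => s h _.
Qed.

End GapRecursion.

(** * Tests of the empirical rooted laws *)

Section EmpiricalTests.
Context (R : realType) (T : polishType R).

Lemma nneg_mfun_continuous (X : ptopologicalType) (h : X -> R) : continuous h ->
  (forall x, 0 <= h x) -> nneg_mfun (EFin \o h : borel X -> \bar R).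
Proof.
by move=> ch h0; apply: nneg_mfun_EFin => //; exact: continuous_borel.
Qed.

Lemma Rintegral_rooted_law n (g : network T 'I_n.+1) (h : rooted_space T -> R) :
  continuous h -> (forall x, 0 <= h x) ->
  (\int[rooted_law g]_x h x)%R =
  n.+1%:R^-1 * \sum_(i < n.+1) h (rooted_class g i).
Proof.
move=> ch h0; rewrite /Rintegral /rooted_law.
by rewrite (integral_empirical _ (nneg_mfun_continuous ch h0)) sumEFin -EFinM.
Qed.

Variables (d : nat -> measure_display) (Om : forall n, measurableType (d n))
  (P : forall n, probability (Om n) R)
  (G : forall n, Om n -> network T 'I_n.+1)
  (PP : probability (borel (rooted_space T)) R).
Arguments G : clear implicits.
Hypothesis hB1 : cvg_law_in_prob P (fun n w => rooted_law (G n w)) PP.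

Lemma null_in_prob_test (h : rooted_space T -> R) (M : R) : continuous h ->
  (forall x, 0 <= h x <= M) ->
  (forall n i, measurable_fun setT (fun w => h (rooted_class (G n w) i))) ->
  null_in_prob P (fun n w =>
    (\int[rooted_law (G n w)]_x h x - \int[PP]_x h x)%R).
Proof.
move=> ch hM mh; have h0 x : 0 <= h x by have /andP[] := hM x.
apply: null_in_prob_shift.
  move=> n; under eq_fun do rewrite Rintegral_rooted_law//.
  apply: measurable_funM; first exact: measurable_cst.
  by apply: measurable_sum => i; exact: mh.
apply: hB1 => //; exists M => x.
by rewrite ger0_norm//; have /andP[] := hM x.
Qed.

End EmpiricalTests.

(** For a given precision, one index $m$ with $a_m$ small enough suffices. *)
Lemma null_in_prob_inf (R : realType) (d : nat -> measure_display)
    (Om : forall n, measurableType (d n)) (P : forall n, probability (Om n) R)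
    (a : R^nat) (Y : nat -> forall n, Om n -> R) :
  (forall m, 0 <= a m) -> a @ \oo --> (0 : R) ->
  (forall m, null_in_prob P (Y m)) ->
  null_in_prob P (fun n w => infs (fun m => a m + `|Y m n w|) 0).
Proof.
move=> a0 acvg nY.
have lb n w : has_lbound (range (fun m => a m + `|Y m n w|)).
  by exists 0 => _ [m _ <-]; rewrite addr_ge0.
have infE n w m : infs (fun m => a m + `|Y m n w|) 0 <= a m + `|Y m n w|.
  apply: ge_inf; last by exists m.
  by have [x H] := lb n w; exists x => _ [j _ <-]; apply: H; exists j.
have inf0 n w : 0 <= infs (fun m => a m + `|Y m n w|) 0.
  apply: lb_le_inf; first by exists (a 0 + `|Y 0 n w|); exists 0%N.
  by move=> _ [j _ <-]; rewrite addr_ge0.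
apply: null_in_prob_le => [n|e e0].
  apply: (measurable_fun_infs (h := fun m w => a m + `|Y m n w|)) => [w _|m].
    exact: lb.
  apply: measurable_funD; first exact: measurable_cst.
  by apply: measurableT_comp => //; have [] := nY m.
have e20 : 0 < e / 2 by rewrite divr_gt0.
have /cvgr_lt/(_ _ e20)[m _ /(_ m (leqnn m)) /= am] := acvg.
exists (Y m) => //; exists (e / 2) => // n w.
rewrite ger0_norm// => /le_trans/(_ (infE n w m)); lra.
Qed.

(** * Distances between loss laws *)

Section LossBounds.
Context (R : realType) (T : polishType R).
Variables (Bs Lipl : R) (l : T -> R -> R).
Hypothesis hl_cont : continuous (fun p : T * R => l p.1 p.2).
Hypothesis hl_lip : forall t (z z' : R), 0 <= z <= Bs -> 0 <= z' <= Bs ->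
  `|l t z - l t z'| <= Lipl * `|z - z'|.
Hypothesis hLipl : 0 <= Lipl.

Lemma loss_gap (V : choiceType) (g : network T V) v sg k (x : R) :
  bsup (resp g v) <= Bs ->
  ext_iter g false k v <= x <= ext_iter g true k v ->
  `|l (vtype g v) (ext_iter g sg k v) - l (vtype g v) x| <= Lipl * gap g k v.
Proof.
move=> gB xb; have xB : 0 <= x <= Bs.
  have /andP[x1 x2] := xb.
  rewrite (le_trans (ext_iter_ge0 _ _ _ _) x1)/= (le_trans x2)//.
  exact: le_trans (ext_iter_le_bsup _ _ _ _) gB.
have yB : 0 <= ext_iter g sg k v <= Bs.
  by rewrite ext_iter_ge0 (le_trans (ext_iter_le_bsup _ _ _ _) gB).
by rewrite (le_trans (hl_lip _ yB xB))// ler_wpM2l// between_dist.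
Qed.

(** Couple the two empirical laws by the vertex at which they are evaluated. *)
Lemma W1_finite_loss n (g : network T 'I_n.+1) (x : 'I_n.+1 -> R) sg k :
  (forall i, bsup (resp g i) <= Bs) -> equilibrium g x ->
  (W1 (finite_loss_law l g x) (finite_loss_law l g (ext_iter g sg k))
   <= (Lipl * mean_gap g k)%:E)%E.
Proof.
move=> gB ex; apply: le_trans (W1_empirical_le _ _) _.
rewrite lee_fin /mean_gap mulrCA ler_wpM2l ?invr_ge0// mulr_sumr.
apply: ler_sum => i _; rewrite distrC; apply: loss_gap => //.
exact: equilibrium_between.
Qed.

Context {d : measure_display} {Om : measurableType d}.
Variables (P : probability Om R) (G : Om -> network T (seq nat)).
Hypothesis hG : random_network G.
Hypothesis hBs : {ae P, forall w, forall v, reachable (G w) [::] v ->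
  bsup (resp (G w) v) <= Bs}.

Lemma measurable_iter_loss (V : countType) d' (Om' : measurableType d')
    (H : Om' -> network T V) v sg k : random_network H ->
  measurable_fun setT (fun w => l (vtype (H w) v) (ext_iter (H w) sg k v)).
Proof.
move=> hH; apply: measurable_loss => //; last exact: measurable_ext_iter.
by have [_ mt _ _ _] := hH; exact: mt.
Qed.

(** Couple the two laws by evaluating both states on the same random network. *)
Lemma W1_limit_loss (xo : Om -> R) sg k (c : R) :
  measurable_fun setT xo ->
  {ae P, forall w, forall sg, ext_iter (G w) sg k [::] @[k --> \oo] --> xo w} ->
  (\int[P]_w (gap (G w) k [::])%:E <= c%:E)%E ->
  (W1 (limit_loss_law l P G (fun w => ext_iter (G w) sg k [::]))
      (limit_loss_law l P G xo) <= (Lipl * c)%:E)%E.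
Proof.
move=> mxo hxo gapc.
have mt : measurable_fun setT (fun w => vtype (G w) [::] : borel T).
  by have [_ mt _ _ _] := hG; exact: mt.
have ml := measurable_iter_loss [::] sg k hG.
have mlo : measurable_fun setT (fun w => l (vtype (G w) [::]) (xo w)).
  exact: measurable_loss.
have mg : measurable_fun setT (fun w => (gap (G w) k [::])%:E).
  by apply/measurable_EFinP; exact: measurable_gap.
apply: (le_trans (W1_law_le P ml mlo)).
rewrite EFinM; apply: (@le_trans _ _
    (Lipl%:E * \int[P]_w (gap (G w) k [::])%:E)%E); last first.
  by rewrite lee_wpmul2l// lee_fin.
rewrite -ge0_integralZl_EFin//; last by move=> w _; rewrite lee_fin gap_ge0.
apply: ae_ge0_le_integral => //.
- by apply/measurable_EFinP; apply: measurableT_comp => //; exact: measurable_funB.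
- by move=> w _; rewrite mule_ge0// lee_fin gap_ge0.
- exact: emeasurable_funM.
- apply: filterS2 hBs hxo => w wB wx _; rewrite -EFinM lee_fin.
  apply: loss_gap; first by apply: wB; exists 0%N, [::].
  exact: limit_between.
Qed.

End LossBounds.

Lemma integral_limit_class (R : realType) (T : polishType R)
    (dl : measure_display) (Oml : measurableType dl) (Pl : probability Oml R)
    (Gl : Oml -> network T (seq nat))
    (PP : probability (borel (rooted_space T)) R) (h : rooted_space T -> R) :
  measurable_fun setT
    (fun w => rooted_class (Gl w) [::] : borel (rooted_space T)) ->
  (forall A, measurable A -> PP A = law Pl
     (fun w => rooted_class (Gl w) [::] : borel (rooted_space T)) A) ->
  continuous h -> (forall x, 0 <= h x) ->
  (\int[PP]_x (h x)%:E = \int[Pl]_w (h (rooted_class (Gl w) [::]))%:E)%E.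
Proof.
move=> mcl hPP ch h0.
rewrite -(integral_law Pl mcl (nneg_mfun_continuous ch h0)).
by apply: eq_measure_integral => A mA _; exact: hPP.
Qed.

(** Weak convergence in probability of the rooted laws gives convergence in
    probability of the cell masses of the loss laws, for continuous cells; with
    finer and finer cells, these masses control the Wasserstein distance. *)
Lemma loss_law_null (R : realType) (T : polishType R)
  (d : nat -> measure_display) (Om : forall n, measurableType (d n))
  (P : forall n, probability (Om n) R)
  (G : forall n, Om n -> network T 'I_n.+1)
  (hG : forall n, random_network (@G n))
  (dl : measure_display) (Oml : measurableType dl) (Pl : probability Oml R)
  (Gl : Oml -> network T (seq nat))
  (hGl : random_network Gl)
  (hGl_class : measurable_fun setT
     (fun w => rooted_class (Gl w) [::] : borel (rooted_space T)))
  (PP : probability (borel (rooted_space T)) R)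
  (hPP : forall A, measurable A -> PP A = law Pl
     (fun w => rooted_class (Gl w) [::] : borel (rooted_space T)) A)
  (hB1 : cvg_law_in_prob P (fun n w => rooted_law (@G n w)) PP)
  (l : T -> R -> R) (hl_cont : continuous (fun p : T * R => l p.1 p.2))
  (ka kb : R) sg k (eps : R) : 0 < eps ->
  exists2 Y : forall n, Om n -> R, null_in_prob P Y &
    forall n w,
    let nu := finite_loss_law l (@G n w) (ext_iter (@G n w) sg k) in
    let nu' := limit_loss_law l Pl Gl (fun w => ext_iter (Gl w) sg k [::]) in
    nu `[ka, kb]%classic = 1%E -> nu' `[ka, kb]%classic = 1%E ->
    (W1 nu nu' <= (eps + Y n w)%:E)%E.
Proof.
move=> eps0; have [N [h [hc h0 h1 hd]]] := partition_of_unity ka kb eps0.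
pose ls (x : rooted_space T) := l (class_type x) (class_iter sg k x).
have lsE (V : countType) (g : network T V) o :
    ls (rooted_class g o) = l (vtype g o) (ext_iter g sg k o).
  by rewrite /ls class_typeE class_iterE.
pose t j x := h j (ls x).
have tc j : continuous (t j).
  move=> x; apply: (@continuous_comp _ _ _ ls (h j)); last exact: hc.
  exact: class_loss_continuous.
have t0 j x : 0 <= t j x by exact: h0.
have t1 j x : 0 <= t j x <= 1 by rewrite t0/=; exact: part_le1.
have mh j : measurable_fun setT (h j) by apply: continuous_measurable_fun; exact: hc.
pose Dl j n (w : Om n) := (\int[rooted_law (@G n w)]_x t j x - \int[PP]_x t j x)%R.
have nDl j : null_in_prob P (Dl j).
  apply: (null_in_prob_test hB1 (tc j) (t1 j)) => n i.
  under eq_fun do rewrite /t lsE.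
  exact: measurableT_comp (mh j) (measurable_iter_loss hl_cont i sg k (hG n)).
exists (fun n w => \sum_(j < N) `|kb - ka| * `|Dl j n w|).
  by apply: null_in_prob_sum => j; apply: null_in_probZ.
move=> n w nu nu' nuS nuS'.
have S1 x : `[ka, kb]%classic x -> ka <= x <= kb by rewrite /= in_itv.
have W := W1_partition_le mh h0 h1 (measurable_itv `[ka, kb]) nuS nuS' (ltW eps0)
  (normr_ge0 (kb - ka)).
apply: (le_trans (W _ _)).
- move=> x y /S1/andP[x1 x2] /S1/andP[y1 y2].
  by rewrite (ger0_norm (_ : 0 <= kb - ka)) ?ler_distl; last lra; apply/andP; split; lra.
- by move=> i x y /S1 x12 /S1 y12; exact: hd.
rewrite lee_fin lerD2l mulr_sumr; apply: ler_sum => j _.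
rewrite le_eqVlt; apply/orP; left; apply/eqP; congr (_ * `|_ - _|).
  rewrite Rintegral_rooted_law// /part_mass.
  have [n1 n2] := nneg_mfun_part mh h0 j.
  rewrite (integral_empirical (fun i => l (vtype (@G n w) i) (ext_iter (@G n w) sg k i))
    (nneg_mfun_part mh h0 j)) sumEFin -EFinM.
  by congr (_ * _); apply: eq_bigr => i _; rewrite /t lsE.
rewrite /part_mass; congr fine.
rewrite (integral_law Pl (measurable_iter_loss hl_cont [::] sg k hGl)
  (nneg_mfun_part mh h0 j)).
rewrite (integral_limit_class hGl_class hPP (tc j) (t0 j)).
by apply: eq_integral => w' _; rewrite /= /t lsE.
Qed.

(** * Comparison of risks *)

(* The n-th finite network has vertex set 'I_n.+1, so that sizes start at 1.
   Responses are bounded, nonnegative, nondecreasing and 1-Lipschitz by the type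
   of marks.  [true] and [false] are the signs + and -. *)
Theorem theorem5p8 (R : realType) (T : polishType R)
  (d : nat -> measure_display) (Om : forall n, measurableType (d n))
  (P : forall n, probability (Om n) R)
  (G : forall n, Om n -> network T 'I_n.+1)
  (hG : forall n, random_network (G n))
  (dl : measure_display) (Oml : measurableType dl) (Pl : probability Oml R)
  (Gl : Oml -> network T (seq nat))
  (hGl : random_network Gl)
  (hGl_class : measurable_fun setT
     (fun w => rooted_class (Gl w) [::] : borel (rooted_space T)))
  (PP : probability (borel (rooted_space T)) R)
  (hPP : forall A, measurable A -> PP A = law Pl
     (fun w => rooted_class (Gl w) [::] : borel (rooted_space T)) A)
  (hB1 : cvg_law_in_prob P (fun n w => rooted_law (G n w)) PP)
  (hB3 : {ae Pl, forall w, gap (Gl w) k [::] @[k --> \oo] --> (0 : R)})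
  (Bs : R)
  (hBs : forall n, {ae P n, forall w, forall i, bsup (resp (G n w) i) <= Bs})
  (hBsl : {ae Pl, forall w, forall v, reachable (Gl w) [::] v ->
     bsup (resp (Gl w) v) <= Bs})
  (l : T -> R -> R)
  (hl_cont : continuous (fun p : T * R => l p.1 p.2))
  (hl_bnd : exists M : R, forall t (z : R), 0 <= z <= Bs -> `|l t z| <= M)
  (ka kb : R)
  (hK : forall t (z : R), 0 <= z <= Bs -> ka <= l t z <= kb)
  (xo : Oml -> R) (hxo_meas : measurable_fun setT xo)
  (hxo : {ae Pl, forall w, forall sg,
     ext_iter (Gl w) sg k [::] @[k --> \oo] --> xo w})
  (xs : forall n, Om n -> 'I_n.+1 -> R)
  (hxs_meas : forall n i, measurable_fun setT (fun w => xs n w i))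
  (hxs : forall n, {ae P n, forall w, equilibrium (G n w) (xs n w)})
  (Lipl : R) (hLipl : 0 <= Lipl)
  (hl_lip : forall t (z z' : R), 0 <= z <= Bs -> 0 <= z' <= Bs ->
     `|l t z - l t z'| <= Lipl * `|z - z'|)
  (d0 : measure_display) (Om0 : measurableType d0) (P0 : probability Om0 R)
  (hP0 : atomless P0)
  (rho : (Om0 -> R) -> R) (hrho : risk_measure P0 rho)
  (DD : set (probability R R))
  (hDD : forall nu, DD nu -> nu `[ka, kb]%classic = 1%E)
  (vrho : probability R R -> R) (hvrho : law_representation P0 rho DD vrho)
  (hDDn : forall n, {ae P n, forall w,
     DD (finite_loss_law l (G n w) (xs n w)) /\
     forall sg k, DD (finite_loss_law l (G n w) (ext_iter (G n w) sg k))})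
  (hDDl : DD (limit_loss_law l Pl Gl xo) /\
     forall sg k, DD (limit_loss_law l Pl Gl
       (fun w => ext_iter (Gl w) sg k [::])))
  (Lrho : R) (hLrho : 0 <= Lrho)
  (hvrho_lip : forall nu nu', DD nu -> DD nu' ->
     (`|vrho nu - vrho nu'|%:E <= Lrho%:E * W1 nu nu')%E)
  (htree : {ae Pl, forall w, tree (Gl w)})
  (f : T -> response R)
  (hf_meas : measurable_fun setT (f : borel T -> borel (response R)))
  (hf : {ae Pl, forall w, forall v, reachable (Gl w) [::] v ->
     resp (Gl w) v = f (vtype (Gl w) v)})
  (kappa : R.-pker (borel T) ~> (borel (rooted_space T)))
  (hkappa : conditional_rooted_law Pl Gl kappa)
  (hbranch : branching Pl Gl kappa)
  (B : borel T -> R) (hB : forall t, B t = bsup (f t))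
  (hB_L1 : B \in Lfun (root_type_law Pl Gl) 1)
  (Q : R.-ker (borel T) ~> (borel T)) (hQ : weight_kernel Pl Gl Q)
  (hTW : kernel_op_well_defined (root_type_law Pl Gl) Q)
  (hr1 : (spectral_radius (root_type_law Pl Gl) (kernel_op Q) < 1)%E) :
  [/\ forall n, {ae P n, forall w, forall (sg : bool) (k : nat),
        `|vrho (finite_loss_law l (G n w) (xs n w)) -
          vrho (finite_loss_law l (G n w) (ext_iter (G n w) sg k))|
        <= Lrho * Lipl * mean_gap (G n w) k},
      forall (sg : bool) (k : nat),
        `|vrho (limit_loss_law l Pl Gl (fun w => ext_iter (Gl w) sg k [::])) -
          vrho (limit_loss_law l Pl Gl xo)|
        <= Lrho * Lipl * Gamma Pl Gl Q B k &
      forall k : nat, exists Z : forall n, Om n -> R,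
        [/\ forall n, measurable_fun setT (Z n),
            cvg_in_prob P Z 0 &
            forall n, {ae P n, forall w,
              `|vrho (finite_loss_law l (G n w) (xs n w)) -
                vrho (limit_loss_law l Pl Gl xo)|
              <= 2 * Lrho * Lipl * Gamma Pl Gl Q B k + Z n w}]].
Proof.
have gap_le k : (\int[Pl]_w (gap (Gl w) k [::])%:E <= (Gamma Pl Gl Q B k)%:E)%E.
  exact: (expected_gap_le hGl hGl_class htree hBsl hf hkappa hbranch hB hB_L1 hQ hTW).
have scale (a c : R) (W : \bar R) : (a%:E <= Lrho%:E * W)%E -> (W <= c%:E)%E ->
    a <= Lrho * c.
  move=> aW Wc; rewrite -lee_fin EFinM (le_trans aW)// lee_wpmul2l// lee_fin//.
have fin n : {ae P n, forall w, forall (sg : bool) (k : nat),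
    `|vrho (finite_loss_law l (G n w) (xs n w)) -
      vrho (finite_loss_law l (G n w) (ext_iter (G n w) sg k))|
    <= Lrho * Lipl * mean_gap (G n w) k}.
  apply: filterS3 (hBs n) (hxs n) (hDDn n) => w wB wx [D1 D2] sg k.
  rewrite -mulrA; apply: (scale _ _ _ (hvrho_lip _ _ D1 (D2 sg k))).
  exact: (W1_finite_loss hl_lip hLipl).
have lim sg k : `|vrho (limit_loss_law l Pl Gl (fun w => ext_iter (Gl w) sg k [::])) -
      vrho (limit_loss_law l Pl Gl xo)| <= Lrho * Lipl * Gamma Pl Gl Q B k.
  have [D1 D2] := hDDl; rewrite -mulrA; apply: (scale _ _ _ (hvrho_lip _ _ (D2 sg k) D1)).
  exact: (W1_limit_loss hl_cont hl_lip hLipl hGl hBsl).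
split => // k.
(* one coupling bound for each mesh 1 / (m + 1) *)
have hstep m : exists Y : forall n, Om n -> R, null_in_prob P Y /\
    forall n w,
    let nu := finite_loss_law l (G n w) (ext_iter (G n w) true k) in
    let nu' := limit_loss_law l Pl Gl (fun w => ext_iter (Gl w) true k [::]) in
    nu `[ka, kb]%classic = 1%E -> nu' `[ka, kb]%classic = 1%E ->
    (W1 nu nu' <= (m.+1%:R^-1 + Y n w)%:E)%E.
  have m0 : 0 < (m.+1%:R^-1 : R) by rewrite invr_gt0.
  have [Y nY WY] := loss_law_null hG hGl hGl_class hPP hB1 hl_cont ka kb true k m0.
  by exists Y.
have /choice[Y YP] := hstep.
pose D n w : R := (\int[rooted_law (G n w)]_x capped_gap Bs k x -
                   \int[PP]_x capped_gap Bs k x)%R.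
have cgE n w i : capped_gap Bs k (rooted_class (G n w) i) =
    Num.min (Num.max 0 Bs) (gap (G n w) k i).
  by rewrite /capped_gap !class_iterE.
have cg0 := @capped_gap_ge0 R T Bs k.
have cgc := @capped_gap_continuous R T Bs k.
have nD : null_in_prob P D.
  apply: (null_in_prob_test hB1 cgc (M := Num.max 0 Bs)) => [x|n i].
    by rewrite cg0 capped_gap_le.
  under eq_fun do rewrite cgE.
  apply: measurable_minr; first exact: measurable_cst.
  exact: measurable_gap.
have limD : (\int[PP]_x capped_gap Bs k x)%R <= Gamma Pl Gl Q B k.
  have E : (\int[PP]_x (capped_gap Bs k x)%:E <= (Gamma Pl Gl Q B k)%:E)%E.
    rewrite (integral_limit_class hGl_class hPP cgc cg0).
    apply: le_trans (gap_le k); apply: ge0_le_integral => //.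
    - by move=> w _; rewrite lee_fin.
    - apply: (@measurableT_comp _ _ _ _ _ _
        (fun x : borel (rooted_space T) => (capped_gap Bs k x)%:E)) => //.
      by apply/measurable_EFinP; exact: continuous_borel.
    - by apply/measurable_EFinP; exact: measurable_gap.
    - by move=> w _; rewrite lee_fin /capped_gap !class_iterE ge_min lexx orbT.
  rewrite /Rintegral -lee_fin fineK// ge0_fin_numE; first exact: le_lt_trans E (ltry _).
  by apply: integral_ge0 => x _; rewrite lee_fin.
exists (fun n w => Lrho * Lipl * `|D n w| +
  infs (fun m => Lrho * m.+1%:R^-1 + `|Lrho * `|Y m n w| |) 0).
have nZ : null_in_prob P (fun n w => Lrho * Lipl * `|D n w| +
  infs (fun m => Lrho * m.+1%:R^-1 + `|Lrho * `|Y m n w| |) 0).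
  apply: null_in_probD; first exact: null_in_probZ.
  apply: (null_in_prob_inf (a := fun m => Lrho * m.+1%:R^-1)
    (Y := fun m n w => Lrho * `|Y m n w|)) => [m| |m].
  - by rewrite mulr_ge0.
  - rewrite -[X in _ --> X](mulr0 Lrho); apply: cvgMr; exact: cvg_harmonic.
  - by apply: null_in_probZ; have [] := YP m.
have [mZ Z0] := nZ; split => // n.
apply: filterS3 (hBs n) (fin n) (hDDn n) => w wB wfin [_ DDk].
have [_ DDlk] := hDDl.
set nu := vrho (finite_loss_law l (G n w) (xs n w)).
set nu1 := vrho (finite_loss_law l (G n w) (ext_iter (G n w) true k)).
have mgE : mean_gap (G n w) k = D n w + (\int[PP]_x capped_gap Bs k x)%R.
  rewrite /D subrK Rintegral_rooted_law//; congr (_ * _).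
  by apply: eq_bigr => i _; rewrite capped_gapE.
(* pass from the equilibrium to the iterate, then to the limiting iterate, then
   to the limiting equilibrium *)
have b1 : `|nu - nu1| <= Lrho * Lipl * `|D n w| + Lrho * Lipl * Gamma Pl Gl Q B k.
  rewrite (le_trans (wfin true k))// -mulrDr ler_wpM2l ?mulr_ge0// mgE.
  by rewrite lerD// ler_norm.
have b2 : `|nu1 - vrho (limit_loss_law l Pl Gl (fun w => ext_iter (Gl w) true k [::]))|
    <= infs (fun m => Lrho * m.+1%:R^-1 + `|Lrho * `|Y m n w| |) 0.
  apply: lb_le_inf; first by eexists; exists 0%N.
  move=> _ [m _ <-]; have [_ WY] := YP m.
  have := scale _ _ _ (hvrho_lip _ _ (DDk true k) (DDlk true k))
    (WY n w (hDD _ (DDk true k)) (hDD _ (DDlk true k))).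
  move=> /le_trans; apply; rewrite mulrDr lerD2l ger0_norm ?mulr_ge0//.
  by rewrite ler_wpM2l// ler_norm.
have b3 := lim true k.
have -> : nu - vrho (limit_loss_law l Pl Gl xo) = (nu - nu1) +
  ((nu1 - vrho (limit_loss_law l Pl Gl (fun w => ext_iter (Gl w) true k [::]))) +
   (vrho (limit_loss_law l Pl Gl (fun w => ext_iter (Gl w) true k [::])) -
    vrho (limit_loss_law l Pl Gl xo))) by ring.
rewrite (le_trans (ler_normD _ _))//.
apply: le_trans (lerD b1 (le_trans (ler_normD _ _) (lerD b2 b3))) _.
by rewrite le_eqVlt; apply/orP; left; apply/eqP; ring.
Qed.
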